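(* The following identities hold between the functions $g_{a,b}$ of an oriented basis $(\omega_1,\omega_2)$ of $\mathbb{C}$ (with $g_{a,b}=0$ when $a$ and $b$ have the same parity). All summation indices with subscripts are nonnegative integers. (i) For positive integers $a,b,c,d,e,f$ one has $$\sum_{a=a_1+a_2;\,d=d_1+d_2}(-1)^{c+d_1+1}\binom{a}{a_1}\binom{d}{d_1}g_{a_2+c,b+d_1}\,g_{a_1+e,d_2+f}$$ $$+\sum_{b=b_1+b_2;\,e=e_1+e_2}(-1)^{b_2+1}\binom{b}{b_1}\binom{e}{e_1}g_{b_2+d,c+e_1}\,g_{a+e_2,b_1+f}$$ $$+\sum_{c=c_1+c_2;\,f=f_1+f_2}(-1)^{c_1}\binom{c}{c_1}\binom{f}{f_1}g_{c_2+e,d+f_1}\,g_{a+c_1,b+f_2}=0.$$ (ii) For integers $a,b\ge 0$ one has $$\sum_{a=a_1+a_2}\binom{a}{a_1}g_{a_1,0}\,g_{a_2,b}-\frac{a+2+\delta_{b,0}}{a+1}\,g_{a+1,b}=\sum_{b=b_1+b_2}\binom{b}{b_1}g_{0,b_1}\,g_{a,b_2}-\frac{b+2+\delta_{a,0}}{b+1}\,g_{a,b+1},$$ where $\delta$ is the Kronecker delta.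
   Context: For an oriented basis $(\omega_1,\omega_2)$ of $\mathbb{C}=\mathbb{R}^2$ let $L=\mathbb{Z}\omega_1+\mathbb{Z}\omega_2$ and $a(L)=\operatorname{Im}(\overline{\omega}_1\omega_2)$. For $k\ge 2$, $e^*_{2k}=e_{2k}=\sum_{\omega\in L\setminus\{0\}}\omega^{-2k}$. For $k=1$, $e_2(\omega_1,\omega_2)=\sum_m\sum_{n;\,n\ne 0\text{ if }m=0}\frac{1}{(m\omega_2+n\omega_1)^2}$ (inner sum over $n$ first), and $e^*_2=e_2-\frac{\pi}{a(L)}\frac{\overline{\omega}_1}{\omega_1}$. These are $C^\infty$ functions of $(\omega_1,\omega_2)$. Let $W=-\frac{\pi}{a(L)}\left(\overline{\omega}_1\frac{\partial}{\partial\omega_1}+\overline{\omega}_2\frac{\partial}{\partial\omega_2}\right)$. For integers $b>a\ge 0$ of different parity, $g_{a,b}=g_{b,a}=(b-a)!\,W^a(e^*_{b-a+1})$. For $a,b\ge 0$ of the same parity, set $g_{a,b}=0$. *)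

(* Defs.v *)
(* MathComp / MathComp-Analysis, over an arbitrary R : realType. *)
From HB Require Import structures.
From mathcomp Require Import all_boot all_order all_algebra.
From mathcomp Require Import complex.
From mathcomp Require Import all_classical all_reals all_analysis.
From mathcomp Require Import summability.

Set Implicit Arguments.
Unset Strict Implicit.
Unset Printing Implicit Defensive.

Import Order.TTheory GRing.Theory Num.Theory.
Import numFieldNormedType.Exports.

Local Open Scope classical_set_scope.
Local Open Scope ring_scope.

(* The library's Rcomplex R is the field R[i] seen as an R-vector space, with
   the modulus as an R-valued norm.  It is completed here to a normed module
   over R, so that sums and real directional derivatives of complex-valued
   functions are the library's. *)
Section RcomplexNormedModule.
Variable R : realType.

HB.instance Definition _ :=
  PseudoMetric.copy (Rcomplex R) (pseudoMetric_normed (Rcomplex R)).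
HB.instance Definition _ := isPointed.Build (Rcomplex R) 0.
HB.instance Definition _ :=
  NormedZmod_PseudoMetric_eq.Build R (Rcomplex R) erefl.

Let Rcomplex_normrZ (l : R) (x : Rcomplex R) : `|l *: x| = `|l| * `|x|.
Proof.
case: x => x y; rewrite /Num.norm /= /Normc.normc /=.
by rewrite !exprMn -mulrDr sqrtrM ?sqr_ge0// sqrtr_sqr.
Qed.

HB.instance Definition _ :=
  PseudoMetricNormedZmod_Lmodule_isNormedModule.Build R (Rcomplex R)
    Rcomplex_normrZ.

End RcomplexNormedModule.

Section EisensteinFunctions.
Variable R : realType.

Local Notation C := (Rcomplex R).

Definition imC : C := Complex 0 1.

(* A pair p = (omega_1, omega_2); all functions below are defined on C * C
   but only meaningful on the open subset of oriented bases. *)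
Implicit Types (p : C * C) (F : C * C -> C).

Definition lattice p : set C :=
  [set w | exists m n : int, w = p.1 *~ m + p.2 *~ n].

(* This is the determinant of (omega_1, omega_2) in the basis (1, i). *)
Definition area p : R := complex.Im (conjc p.1 * p.2 : C).

Definition oriented_basis p : Prop := 0 < area p.

(* [sum] is the unconditional sum, i.e. the limit of the sums over finite
   subsets of the index type. *)
Definition eisenstein (n : nat) p : C :=
  sum (fun w : C => if w \in lattice p `\ 0 then w ^- n else 0).

(* The iterated sum of Eisenstein: the double family itself is not summable,
   but every row is, and so is the family of the row sums. *)
Definition eisenstein2 p : C :=
  sum (fun m : int => sum (fun n : int =>
    if (m == 0) && (n == 0) then 0 else (p.2 *~ m + p.1 *~ n) ^- 2 : C)).

(* The index n is the weight 2k; only even n >= 2 are relevant. *)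
Definition eisenstein_star (n : nat) p : C :=
  if n == 2%N then eisenstein2 p - (pi / area p) *: (conjc p.1 / p.1 : C)
  else eisenstein n p.

(* Wirtinger derivatives (d/dx - i d/dy) / 2 in each of the two variables. *)
Definition wirtinger1 F p : C :=
  2^-1 *: ('D_((1 : C), (0 : C)) F p - imC * 'D_(imC, (0 : C)) F p).
Definition wirtinger2 F p : C :=
  2^-1 *: ('D_((0 : C), (1 : C)) F p - imC * 'D_((0 : C), imC) F p).

Definition W F p : C :=
  - (pi / area p) *: ((conjc p.1 : C) * wirtinger1 F p
                      + (conjc p.2 : C) * wirtinger2 F p).

Definition g (a b : nat) p : C :=
  let m := minn a b in
  let n := maxn a b in
  if odd (a + b) then (n - m)`!%:R * iter m W (eisenstein_star (n - m).+1) p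
  else 0.

End EisensteinFunctions.

(* Main.v *)
(* Write tau = w2 / w1, q = e^(2 pi i tau), s = (pi / a(L)) conj(w1) / w1, and let
     h_{a,b} = (2 pi i / w1)^(a+b+1) (sum_{mn > 0} sgn(m) m^b n^a q^|mn|
                                        + [a = 0] zeta(-b) + [b = 0] zeta(-a)),
   where zeta(0) is replaced by 0.  By the Lipschitz formula h_{0,k} = k! e_{k+1} for odd k;
   moreover W h_{a,b} = h_{a+1,b+1} + (a+b+1) s h_{a,b} and W s = s^2, so that g_{a,b} is a
   polynomial in s with coefficients among the h_{i,j}: g is the transform of h by the
   one-parameter group of multiplications of the generating function by exp(t z w), at t = s.

   Identity (i) holds for h: each term is a sum over Z^4, and after linear changes of
   variables the three of them differ only by products of signs of the same six linear forms,
   which add up to 0.  Identity (ii) holds for h by another such change of variables, the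
   boundary terms being matched by Faulhaber's formula and by Euler's recursion for zeta(-j).
   For the transform of h at t, (ii) is a polynomial in t whose derivative is a multiple of the
   same identity with smaller indices; hence (ii) holds for g.

   The case a = 0 of (ii) expresses e_k e_2^* by functions of the lattice, and some e_k with
   k >= 4 does not vanish; hence e_2^*, and all of g, is invariant under
   (w1, w2) -> (w1 + w2, w2).  Along the orbit of this map s takes infinitely many values, so the
   polynomial in t given by (i) for the transform of g at t vanishes at infinitely many points
   t = -s, where this transform is an h; at t = 0 this is (i) for g. *)
Require Import Defs.
From HB Require Import structures.
From mathcomp Require Import all_boot all_order all_algebra.
From mathcomp Require Import complex.
From mathcomp Require Import all_classical all_reals all_analysis.
From mathcomp Require Import finmap summability.
From mathcomp Require Import ring lra zify.
Import Order.TTheory GRing.Theory Num.Theory.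
Import numFieldNormedType.Exports.
Set Implicit Arguments.
Unset Strict Implicit.
Unset Printing Implicit Defensive.
Local Open Scope classical_set_scope.
Local Open Scope ring_scope.

(** * Summable families of complex numbers *)

(** Identity (i) does not pass from h to its transform the way (ii) does: differentiation in t
    lowers both indices of a factor, so index 0 is reached, where zeta constants enter and the
    lattice sum behind (i) meets the hyperplanes on which a linear form vanishes. The transform is
    undone instead: invariance lets the same values of g be read at infinitely many bases, and at
    each of them t = -s removes the nonholomorphic part. Invariance is immediate for e_k with k >=
    4, which depends on the lattice alone, and W preserves it; only e_2^* needs an argument, since
    its definition singles out a basis and an order of summation. No theory of holomorphic functions
    is used. Derivatives are read off first-order expansions with explicit quadratic remainder,
    which can be multiplied, composed and summed over a series. The Lipschitz formula in weight 2 is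
    obtained by Herglotz's trick (periodicity, boundedness, duplication), and the values zeta(-j) by
    Abel summation of m^j e^(-2 pi m y) as y tends to 0. *)

Section ComplexNorm.
Variable R : realType.
Local Notation C := (Rcomplex R).
(** Pins the modulus with values in R; the underlying field R[i] also carries a norm with values in
    R[i]. *)
Local Notation cn := (@Num.norm
  (Num_RealClosedField__to__Num_POrderedZmodule (reals_Real__to__Num_RealClosedField R))
  (complex_Rcomplex__canonical__Num_SemiNormedZmodule (reals_Real__to__Num_RealClosedField R))).
Implicit Types x y z : C.

Lemma cnormE (a b : R) : cn (Complex a b) = Num.sqrt (a ^+ 2 + b ^+ 2).
Proof. by []. Qed.

Lemma cnormM x y : cn (x * y) = cn x * cn y.
Proof. exact: Normc.normcM. Qed.

Lemma cnormV x : cn x^-1 = (cn x)^-1.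
Proof. exact: Normc.normcV. Qed.

Lemma cnorm1 : cn 1 = 1.
Proof. exact: Normc.normc1. Qed.

Lemma cnormX x n : cn (x ^+ n) = cn x ^+ n.
Proof. by elim: n => [|n IH]; rewrite ?expr0 ?cnorm1// !exprS cnormM IH. Qed.

Lemma cnorm_nat n : cn n%:R = n%:R.
Proof. by rewrite -[n%:R]/(1 *+ n) normrMn cnorm1. Qed.

Lemma cnorm_int (n : int) : cn n%:~R = `|n%:~R|.
Proof.
by case: n => n; rewrite ?NegzE ?rmorphN ?normrN /= -?[_%:~R]/(_%:R) cnorm_nat normr_nat.
Qed.

Lemma cnorm_scale (r : R) x : `|r *: x| = `|r| * `|x|.
Proof. exact: normrZ. Qed.

Lemma normrZC (r : R) : cn (r%:C)%C = `|r|.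
Proof. by rewrite cnormE expr0n/= addr0 sqrtr_sqr. Qed.

Lemma scaleCE (r : R) x : r *: x = (r%:C)%C * x.
Proof. by case: x => a b; simpc. Qed.

Lemma ler_normRe x : `|complex.Re x| <= `|x|.
Proof.
case: x => a b; rewrite !cnormE /=.
by rewrite -sqrtr_sqr ler_wsqrtr// lerDl sqr_ge0.
Qed.

Lemma ler_normIm x : `|complex.Im x| <= `|x|.
Proof.
case: x => a b; rewrite !cnormE /=.
by rewrite -sqrtr_sqr ler_wsqrtr// lerDr sqr_ge0.
Qed.

Lemma ler_cnorm x : `|x| <= `|complex.Re x| + `|complex.Im x|.
Proof.
case: x => a b; rewrite !cnormE /=.
rewrite -(@ger0_norm _ (`|a| + `|b|)) ?addr_ge0// -sqrtr_sqr ler_wsqrtr//.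
by rewrite sqrrD !real_normK ?num_real// lerD2r lerDl mulrn_wge0// mulr_ge0.
Qed.

Lemma sqr_cnorm x : `|x| ^+ 2 = complex.Re x ^+ 2 + complex.Im x ^+ 2.
Proof.
case: x => a b; rewrite !cnormE /=.
by rewrite sqr_sqrtr// addr_ge0 ?sqr_ge0.
Qed.

Lemma cnorm_conj x : `|(conjc x : C)| = `|x|.
Proof.
by case: x => a b; rewrite !cnormE sqrrN.
Qed.

Lemma le0_eqC x : (forall e : R, 0 < e -> `|x| <= e) -> x = 0.
Proof.
move=> H; apply/eqP; rewrite -normr_le0; apply/ler_addgt0Pl => e e0.
by rewrite addr0 H.
Qed.

End ComplexNorm.

Section Sums.
Variable R : realType.
Local Notation C := (Rcomplex R).
Local Notation cn := (@Num.norm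
  (Num_RealClosedField__to__Num_POrderedZmodule (reals_Real__to__Num_RealClosedField R))
  (complex_Rcomplex__canonical__Num_SemiNormedZmodule (reals_Real__to__Num_RealClosedField R))).

(* Unconditional convergence, with finite index sets represented by
   duplicate-free sequences. *)
Definition has_sum (I : choiceType) (f : I -> C) (l : C) : Prop :=
  forall e : R, 0 < e -> exists s0 : seq I, forall s, uniq s ->
    {subset s0 <= s} -> `|\sum_(i <- s) f i - l| <= e.

Definition abs_bound (I : choiceType) (f : I -> C) (B : R) : Prop :=
  forall s, uniq s -> \sum_(i <- s) `|f i| <= B.

Definition abs_summable (I : choiceType) (f : I -> C) : Prop :=
  exists B, abs_bound f B.

Section OneFamily.
Variable I : choiceType.
Implicit Types f g : I -> C.

Lemma eq_has_sum f g l : f =1 g -> has_sum f l -> has_sum g l.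
Proof. by move=> /funext->. Qed.

Lemma has_sum_undup f l e : 0 < e -> has_sum f l -> exists2 s0, uniq s0 &
  forall s, uniq s -> {subset s0 <= s} -> `|\sum_(i <- s) f i - l| <= e.
Proof.
move=> e0 /(_ e e0)[s0 Hs0]; exists (undup s0); rewrite ?undup_uniq// => s us ss.
by apply: Hs0 => // i is0; apply: ss; rewrite mem_undup.
Qed.

Lemma has_sum_uniq f a b : has_sum f a -> has_sum f b -> a = b.
Proof.
move=> fa fb; apply/eqP; rewrite -subr_eq0; apply/eqP/le0_eqC => e e0.
have e2 : 0 < e / 2 by rewrite divr_gt0.
have [s1 H1] := fa _ e2; have [s2 H2] := fb _ e2.
pose s := undup (s1 ++ s2).
have {}H1 : `|\sum_(i <- s) f i - a| <= e / 2.
  by apply: H1; rewrite ?undup_uniq// => i; rewrite mem_undup mem_cat => ->.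
have {}H2 : `|\sum_(i <- s) f i - b| <= e / 2.
  by apply: H2; rewrite ?undup_uniq// => i; rewrite mem_undup mem_cat orbC => ->.
have -> : a - b = (\sum_(i <- s) f i - b) - (\sum_(i <- s) f i - a) by ring.
by rewrite (splitr e) (le_trans (ler_normB _ _)) ?lerD.
Qed.

(** Bridge to the library's [sum], a limit along finite sets: values of sums are found by exhibiting
    a [has_sum]. *)
Lemma sumP f l : has_sum f l -> sum f = l.
Proof.
move=> fl; have PF := @totally_filter I.
apply: cvg_lim; first exact: norm_hausdorff.
apply/cvgrPdist_le => /= e e0; have [s0 Hs0] := fl e e0.
exists [fset i in s0]%fset => //= A sA.
rewrite /partial_sum distrC.
have -> : (\sum_(i : A) f (val i) = \sum_(i <- enum_fset A) f i) by rewrite big_seq_fsetE.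
apply: Hs0; first exact: fset_uniq.
by move=> i is0; apply: (fsubsetP sA); rewrite !inE.
Qed.

Lemma has_sumD f g a b : has_sum f a -> has_sum g b ->
  has_sum (fun i => f i + g i) (a + b).
Proof.
move=> fa fb e e0.
have e2 : 0 < e / 2 by rewrite divr_gt0.
have [s1 H1] := fa _ e2; have [s2 H2] := fb _ e2.
exists (s1 ++ s2) => s us ss; rewrite big_split /=.
have -> : \sum_(i <- s) f i + \sum_(i <- s) g i - (a + b) =
  (\sum_(i <- s) f i - a) + (\sum_(i <- s) g i - b) by ring.
rewrite (splitr e) (le_trans (ler_normD _ _)) ?lerD//.
  by apply: H1 => // i i1; apply: ss; rewrite mem_cat i1.
by apply: H2 => // i i1; apply: ss; rewrite mem_cat i1 orbT.
Qed.

Lemma has_sumZ (c : C) f a : has_sum f a -> has_sum (fun i => c * f i) (c * a).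
Proof.
move=> fa e e0.
have c0 : 0 < `|c| + 1 by rewrite ltr_wpDl.
have [s0 Hs0] := fa (e / (`|c| + 1)) (divr_gt0 e0 c0).
exists s0 => s us ss; rewrite -mulr_sumr -mulrBr cnormM.
rewrite (@le_trans _ _ ((`|c| + 1) * (e / (`|c| + 1))))//.
  by rewrite ler_pM// ?lerDl//; apply: Hs0.
by rewrite mulrC divfK ?gt_eqF.
Qed.

Lemma has_sumN f a : has_sum f a -> has_sum (fun i => - f i) (- a).
Proof.
move=> /(has_sumZ (-1)); rewrite mulN1r; apply: eq_has_sum => i.
by rewrite mulN1r.
Qed.

Lemma has_sumB f g a b : has_sum f a -> has_sum g b ->
  has_sum (fun i => f i - g i) (a - b).
Proof. by move=> fa /has_sumN gb; exact: has_sumD. Qed.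

Lemma has_sum0 : has_sum (fun _ : I => 0) 0.
Proof. by move=> e e0; exists [::] => s _ _; rewrite big1// subrr normr0 ltW. Qed.

Lemma has_sum_bigop (K : Type) (r : seq K) (P : pred K) (f : K -> I -> C) (a : K -> C) :
  (forall k, P k -> has_sum (f k) (a k)) ->
  has_sum (fun i => \sum_(k <- r | P k) f k i) (\sum_(k <- r | P k) a k).
Proof.
move=> H; elim: r => [|k r IH].
  by rewrite big_nil; apply: (eq_has_sum _ has_sum0) => i; rewrite big_nil.
rewrite big_cons; have [Pk|nPk] := boolP (P k).
  apply: (eq_has_sum _ (has_sumD (H k Pk) IH)) => i.
  by rewrite big_cons Pk.
by apply: (eq_has_sum _ IH) => i; rewrite big_cons (negPf nPk).
Qed.

Lemma has_sum_seq (s0 : seq I) f : uniq s0 -> (forall i, i \notin s0 -> f i = 0) ->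
  has_sum f (\sum_(i <- s0) f i).
Proof.
move=> us0 fs0 e e0; exists s0 => s us ss.
rewrite [X in X - _](bigID (mem s0)) /= [X in _ + X - _]big1 ?addr0; last by move=> i /fs0.
rewrite -big_filter (perm_big s0) ?subrr ?normr0 ?ltW//.
apply: uniq_perm => //; first exact: filter_uniq.
by move=> i; rewrite mem_filter; case: (boolP (i \in s0)) => //= /ss.
Qed.

Lemma has_sum_le f l B : has_sum f l -> abs_bound f B -> `|l| <= B.
Proof.
move=> fl fB; apply/ler_addgt0Pl => e e0.
have [s0 us0 Hs0] := has_sum_undup e0 fl.
have := Hs0 _ us0 (fun _ => id); rewrite distrC => H.
rewrite -[l](subrK (\sum_(i <- s0) f i)) (le_trans (ler_normD _ _))// lerD//.
by rewrite (le_trans (ler_norm_sum _ _ _))// fB.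
Qed.

Lemma abs_bound_ge0 f B : abs_bound f B -> 0 <= B.
Proof. by move=> /(_ [::] isT); rewrite big_nil. Qed.

Lemma abs_bound_le f g B : (forall i, `|f i| <= `|g i|) -> abs_bound g B ->
  abs_bound f B.
Proof.
by move=> fg gB s us; apply: le_trans (gB s us); apply: ler_sum.
Qed.

Lemma abs_boundD f g A B : abs_bound f A -> abs_bound g B ->
  abs_bound (fun i => f i + g i) (A + B).
Proof.
move=> fA gB s us; rewrite (le_trans _ (lerD (fA s us) (gB s us)))//.
by rewrite -big_split ler_sum// => i _; exact: ler_normD.
Qed.

Lemma abs_boundZ (c : C) f A : abs_bound f A ->
  abs_bound (fun i => c * f i) (`|c| * A).
Proof.
move=> fA s us; under eq_bigr do rewrite cnormM.
by rewrite -mulr_sumr ler_wpM2l// fA.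
Qed.

Lemma abs_summable_le f g : (forall i, `|f i| <= `|g i|) -> abs_summable g ->
  abs_summable f.
Proof. by move=> fg [B gB]; exists B; apply: abs_bound_le gB. Qed.

Lemma abs_summableD f g : abs_summable f -> abs_summable g ->
  abs_summable (fun i => f i + g i).
Proof. by move=> [A fA] [B gB]; exists (A + B); exact: abs_boundD. Qed.

Lemma abs_summableZ (c : C) f : abs_summable f ->
  abs_summable (fun i => c * f i).
Proof. by move=> [A fA]; exists (`|c| * A); exact: abs_boundZ. Qed.

(** The sum is the supremum of the finite partial sums, which grow with the index set. *)
Lemma nonneg_has_sum (u : I -> R) B : (forall i, 0 <= u i) ->
  (forall s, uniq s -> \sum_(i <- s) u i <= B) ->
  exists l : R, forall e, 0 < e -> exists s0 : seq I, forall s, uniq s ->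
    {subset s0 <= s} -> `|\sum_(i <- s) u i - l| <= e.
Proof.
move=> u0 uB; pose E := [set x | exists2 s, uniq s & x = \sum_(i <- s) u i].
have supE : has_sup E.
  by split; [exists 0, [::]; rewrite ?big_nil | exists B => _ [s us ->]; exact: uB].
exists (sup E) => e e0.
have [_ [s0 us0 ->] Hs0] := sup_adherent e0 supE.
exists s0 => s us ss.
have le1 : \sum_(i <- s) u i <= sup E by apply: sup_upper_bound => //; exists s.
have le2 : \sum_(i <- s0) u i <= \sum_(i <- s) u i.
  rewrite [leRHS](bigID (mem s0)) /= -[X in X + _]big_filter.
  rewrite (_ : \sum_(i <- [seq _ <- _ | _]) _ = \sum_(i <- s0) u i).
    by rewrite lerDl sumr_ge0.
  apply: perm_big; apply: uniq_perm => //; first exact: filter_uniq.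
  by move=> i; rewrite mem_filter; case: (boolP (i \in s0)) => //= /ss.
rewrite distrC ger0_norm ?subr_ge0//.
by rewrite lerBlDr -lerBlDl (le_trans (ltW Hs0)).
Qed.

Lemma abs_has_sum f : abs_summable f -> has_sum f (sum f).
Proof.
move=> [B fB].
suff [l fl] : exists l, has_sum f l by rewrite (sumP fl).
(* A real family r is the difference of the nonnegative families |r| + r and |r|; this serves for
   real and imaginary parts. *)
have real_part (r : I -> R) : (forall i, `|r i| <= `|f i|) ->
  exists l : R, forall e, 0 < e -> exists s0 : seq I, forall s, uniq s ->
    {subset s0 <= s} -> `|\sum_(i <- s) r i - l| <= e.
  move=> rf.
  have [|s us|l1 H1] := @nonneg_has_sum (fun i => `|r i| + r i) (B + B).
  - by move=> i; rewrite -lerBlDr sub0r -normrN ler_norm.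
  - rewrite big_split /= lerD//; last first.
      rewrite (le_trans (ler_norm _))// (le_trans (ler_norm_sum _ _ _))//.
      by apply: le_trans (fB s us); apply: ler_sum.
    by apply: le_trans (fB s us); apply: ler_sum.
  have [|s us|l2 H2] := @nonneg_has_sum (fun i => `|r i|) B => //.
    by apply: le_trans (fB s us); apply: ler_sum.
  exists (l1 - l2) => e e0; have e2 : 0 < e / 2 by rewrite divr_gt0.
  have [s1 {}H1] := H1 _ e2; have [s2 {}H2] := H2 _ e2.
  exists (s1 ++ s2) => s us ss.
  have -> : \sum_(i <- s) r i - (l1 - l2) =
     (\sum_(i <- s) (`|r i| + r i) - l1) - (\sum_(i <- s) `|r i| - l2).
    by rewrite big_split /=; ring.
  rewrite (splitr e) (le_trans (ler_normB _ _)) ?lerD//.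
    by apply: H1 => // i i1; apply: ss; rewrite mem_cat i1.
  by apply: H2 => // i i1; apply: ss; rewrite mem_cat i1 orbT.
have [l1 H1] := real_part (fun i => complex.Re (f i)) (fun i => ler_normRe (f i)).
have [l2 H2] := real_part (fun i => complex.Im (f i)) (fun i => ler_normIm (f i)).
exists (Complex l1 l2) => e e0; have e2 : 0 < e / 2 by rewrite divr_gt0.
have [s1 {}H1] := H1 _ e2; have [s2 {}H2] := H2 _ e2.
exists (s1 ++ s2) => s us ss.
rewrite (le_trans (ler_cnorm _))// (splitr e) lerD//.
  have -> : complex.Re (\sum_(i <- s) f i - Complex l1 l2) =
    \sum_(i <- s) complex.Re (f i) - l1.
    by rewrite [LHS](raddfB (@complex.Re R : C -> R)) raddf_sum.
  by apply: H1 => // i i1; apply: ss; rewrite mem_cat i1.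
have -> : complex.Im (\sum_(i <- s) f i - Complex l1 l2) =
    \sum_(i <- s) complex.Im (f i) - l2.
  by rewrite [LHS](raddfB (@complex.Im R : C -> R)) raddf_sum.
by apply: H2 => // i i1; apply: ss; rewrite mem_cat i1 orbT.
Qed.

End OneFamily.

(** Only the support of [f] has to lie in the image of [h], which lets lower-dimensional families be
    summed inside a larger index set. *)
Lemma has_sum_reindex (I K : choiceType) (h : I -> K) (f : K -> C) l :
  injective h -> (forall k, f k != 0 -> exists i, k = h i) ->
  has_sum (f \o h) l -> has_sum f l.
Proof.
move=> hinj hf fl e e0; have [s0 Hs0] := fl e e0.
exists (map h s0) => s us ss.
have [t ts] : exists t : seq I, [seq k <- s | f k != 0] = [seq k <- [seq h i | i <- t] | f k != 0].
  elim: s {us ss} => [|k s [t IH]] /=; first by exists [::].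
  case: ifPn => fk; last by exists t.
  have [i ki] := hf k fk.
  by exists (i :: t) => /=; rewrite -ki fk IH.
pose s' := [seq k <- s | f k != 0].
(* Adjoining [s0] is harmless: its image lies in [s], so the nonzero terms over [t'] and over [s]
   are the same. *)
pose t' := undup (s0 ++ [seq i <- t | f (h i) != 0]).
have us' : uniq s' by exact: filter_uniq.
have -> : \sum_(i <- s) f i = \sum_(i <- t') (f \o h) i.
  rewrite -[RHS](big_map h xpredT f) [LHS](bigID (fun k => f k != 0)) /=.
  rewrite [X in _ + X]big1 ?addr0; last by move=> i /negPn/eqP.
  rewrite [RHS](bigID (fun k => f k != 0)) /=.
  rewrite [X in _ = _ + X]big1 ?addr0; last by move=> i /negPn/eqP.
  rewrite -!(big_filter _ (fun k => f k != 0)); apply: perm_big.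
  apply: uniq_perm => //.
    by rewrite filter_uniq// map_inj_uniq// undup_uniq.
  move=> k; rewrite [in RHS]mem_filter.
  rewrite [LHS]mem_filter; case: (boolP (f k != 0)) => //= fk.
  apply/idP/idP => [ks|/mapP[j]].
    have : k \in [seq k <- s | f k != 0] by rewrite mem_filter fk.
    rewrite ts mem_filter => /andP[_ /mapP[i it ki]].
    by apply/mapP; exists i => //; rewrite mem_undup mem_cat mem_filter it -ki fk orbT.
  rewrite mem_undup mem_cat => /orP[js0 ->|].
    by apply: ss; rewrite map_f.
  rewrite mem_filter => /andP[_ it] ki.
  have : k \in [seq k <- [seq h i | i <- t] | f k != 0].
    by rewrite mem_filter fk ki map_f.
  by rewrite -ts mem_filter => /andP[].
apply: Hs0; first exact: undup_uniq.
by move=> i is0; rewrite mem_undup mem_cat is0.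
Qed.

Lemma abs_bound_reindex (I K : choiceType) (h : I -> K) (f : K -> C) B :
  injective h -> abs_bound f B -> abs_bound (f \o h) B.
Proof.
move=> hinj fB s us; rewrite -(big_map h xpredT (fun k => `|f k|)).
by apply: fB; rewrite map_inj_uniq.
Qed.

Lemma abs_summable_reindex (I K : choiceType) (h : I -> K) (f : K -> C) :
  injective h -> abs_summable f -> abs_summable (f \o h).
Proof. by move=> hinj [B fB]; exists B; exact: abs_bound_reindex. Qed.

Lemma abs_summable_ext (I K : choiceType) (h : I -> K) (f : K -> C) :
  injective h -> (forall k, f k != 0 -> exists i, k = h i) ->
  abs_summable (f \o h) -> abs_summable f.
Proof.
move=> hinj hf [B fB]; exists B => s us.
have [t ts] : exists t : seq I, [seq k <- s | f k != 0] = [seq h i | i <- t].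
  elim: s {us} => [|k s [t IH]] /=; first by exists [::].
  case: ifPn => fk; last by exists t.
  by have [i ki] := hf k fk; exists (i :: t) => /=; rewrite -ki IH.
rewrite (bigID (fun k => f k != 0)) /= [X in _ + X]big1 ?addr0; last first.
  by move=> i /negPn/eqP ->; rewrite normr0.
rewrite -big_filter ts big_map; apply: fB.
by rewrite -(map_inj_uniq hinj) -ts filter_uniq.
Qed.

Lemma abs_summable_row (I K : choiceType) (f : I * K -> C) i :
  abs_summable f -> abs_summable (fun k => f (i, k)).
Proof. by move=> fs; apply: (@abs_summable_reindex _ _ (pair i) f) => // ? ? []. Qed.

(** Finitely many row sums are approximated at once by one finite set of columns ([approx]); both
    claims then reduce to finite rectangles. *)
Lemma fubini (I K : choiceType) (f : I * K -> C) : abs_summable f ->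
  abs_summable (fun i => sum (fun k => f (i, k))) /\
  has_sum (fun i => sum (fun k => f (i, k))) (sum f).
Proof.
move=> fs; have [B fB] := fs.
pose F i := sum (fun k => f (i, k)).
have rowP i := abs_has_sum (abs_summable_row i fs).
have approx (s : seq I) (e : R) (t0 : seq K) : 0 < e -> exists2 t : seq K,
    uniq t /\ {subset t0 <= t} & forall t', uniq t' -> {subset t <= t'} ->
    forall i, i \in s -> `|\sum_(k <- t') f (i, k) - F i| <= e.
  move=> e0; elim: s => [|i s [t [ut tt0] Ht]].
    exists (undup t0) => //; split; first exact: undup_uniq.
    by move=> k; rewrite mem_undup.
  have [t1 Ht1] := rowP i e e0.
  exists (undup (t ++ t1)); first split; first exact: undup_uniq.
    by move=> k /tt0 kt; rewrite mem_undup mem_cat kt.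
  move=> t' ut' tt' j; rewrite inE => /predU1P[->|js].
    by apply: Ht1 => // k kt; apply: tt'; rewrite mem_undup mem_cat kt orbT.
  by apply: Ht => // k kt; apply: tt'; rewrite mem_undup mem_cat kt.
have FB : abs_bound F B.
  move=> s us; apply/ler_addgt0Pl => e e0.
  have s0 : 0 < (size s).+1%:R :> R by rewrite ltr0n.
  have [t [ut _] Ht] := approx s (e / (size s).+1%:R) [::] (divr_gt0 e0 s0).
  apply: (@le_trans _ _ (\sum_(i <- s) (e / (size s).+1%:R + \sum_(k <- t) `|f (i, k)|))).
    rewrite big_seq [leRHS]big_seq; apply: ler_sum => i si.
    rewrite -[F i](subrK (\sum_(k <- t) f (i, k))) (le_trans (ler_normD _ _))//.
    rewrite lerD//; last exact: ler_norm_sum.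
    by rewrite distrC; apply: Ht.
  rewrite big_split /= lerD//.
    rewrite big_const_seq count_predT iter_addr_0 -[leLHS]mulr_natl mulrCA ger_pMr//.
    by rewrite ler_pdivrMr ?ltr0n// mul1r ler_nat.
  rewrite -(big_allpairs (F := fun ik => `|f ik|)) /=.
  by apply: fB; apply: allpairs_uniq => // -[? ?] [? ?] _ _ [-> ->].
split; first by exists B.
move=> e e0; have e2 : 0 < e / 2 by rewrite divr_gt0.
have [s0 us0 Hs0] := has_sum_undup e2 (abs_has_sum fs).
exists (map fst s0) => s us ss.
have n0 : 0 < (size s).+1%:R :> R by rewrite ltr0n.
have [t [ut st] Ht] := approx s (e / 2 / (size s).+1%:R) (map snd s0) (divr_gt0 e2 n0).
have H1 : `|\sum_(i <- s) \sum_(k <- t) f (i, k) - sum f| <= e / 2.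
  rewrite -(big_allpairs (F := f)) /=; apply: Hs0.
    by apply: allpairs_uniq => // -[? ?] [? ?] _ _ [-> ->].
  move=> [i k] iks0; apply/allpairsP; exists (i, k); split=> //=.
    by apply: ss; apply/mapP; exists (i, k).
  by apply: st; apply/mapP; exists (i, k).
rewrite -[X in `|X - _|](subrK (\sum_(i <- s) \sum_(k <- t) f (i, k))) -addrA.
rewrite (splitr e) (le_trans (ler_normD _ _))// lerD//.
rewrite -sumrB (le_trans (ler_norm_sum _ _ _))//.
apply: (@le_trans _ _ (\sum_(i <- s) (e / 2 / (size s).+1%:R))).
  by rewrite big_seq [leRHS]big_seq; apply: ler_sum => i si; rewrite distrC; apply: Ht.
rewrite big_const_seq count_predT iter_addr_0 -[leLHS]mulr_natl mulrCA ger_pMr//.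
by rewrite ler_pdivrMr ?ltr0n// mul1r ler_nat.
Qed.

Lemma abs_summableM (I K : choiceType) (f : I -> C) (g : K -> C) :
  abs_summable f -> abs_summable g ->
  abs_summable (fun ik : I * K => f ik.1 * g ik.2).
Proof.
move=> [A fA] [B gB]; exists (A * B) => s us.
(* A finite set of pairs is enclosed in a rectangle, over which the sum factors. *)
pose s1 := undup (map fst s); pose s2 := undup (map snd s).
apply: (@le_trans _ _ (\sum_(ik <- [seq (i, k) | i <- s1, k <- s2]) cn (f ik.1 * g ik.2))).
  rewrite [leRHS](bigID (mem s)) /= -[X in X + _]big_filter.
  rewrite (_ : \sum_(i <- [seq _ <- _ | _]) _ = \sum_(ik <- s) cn (f ik.1 * g ik.2)).
    by rewrite lerDl sumr_ge0.
  apply: perm_big; apply: uniq_perm => //; first by rewrite filter_uniq// allpairs_uniq ?undup_uniq// => -[? ?] [? ?] _ _ [-> ->].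
  move=> [i k]; rewrite mem_filter; case: (boolP ((i, k) \in s)) => //= iks.
  by apply/allpairsP; exists (i, k); rewrite !mem_undup; split=> //; apply/mapP; exists (i, k).
rewrite big_allpairs; under eq_bigr do under eq_bigr do rewrite cnormM /=.
under eq_bigr do rewrite -mulr_sumr; rewrite -mulr_suml.
by rewrite ler_pM// ?sumr_ge0// ?fA ?gB ?undup_uniq.
Qed.

Lemma sumZ (I : choiceType) (c : C) (f : I -> C) : abs_summable f ->
  sum (fun i => c * f i) = c * sum f.
Proof. by move=> /abs_has_sum/(has_sumZ c)/sumP. Qed.

Lemma sumM (I K : choiceType) (f : I -> C) (g : K -> C) :
  abs_summable f -> abs_summable g ->
  has_sum (fun ik : I * K => f ik.1 * g ik.2) (sum f * sum g).
Proof.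
move=> fs gs; have fgs := abs_summableM fs gs.
have := abs_has_sum fgs; rewrite -(sumP (proj2 (fubini fgs))) /=.
have -> : (fun i => sum (fun k => f i * g k)) = (fun i => sum g * f i).
  by apply/funext => i; rewrite sumZ// mulrC.
by rewrite sumZ// mulrC.
Qed.

End Sums.

(** * The complex exponential *)

Section ComplexExp.
Variable R : realType.
Local Notation C := (Rcomplex R).
Local Notation cn := (@Num.norm
  (Num_RealClosedField__to__Num_POrderedZmodule (reals_Real__to__Num_RealClosedField R))
  (complex_Rcomplex__canonical__Num_SemiNormedZmodule (reals_Real__to__Num_RealClosedField R))).
Implicit Types z w : C.

Definition cexp z : C :=
  Complex (expR (complex.Re z) * cos (complex.Im z))
          (expR (complex.Re z) * sin (complex.Im z)).

Lemma cexpD z w : cexp (z + w) = cexp z * cexp w.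
Proof.
case: z => a b; case: w => c d; rewrite /cexp /= expRD cosD sinD.
by apply/eqP; rewrite eq_complex /=; apply/andP; split; apply/eqP; ring.
Qed.

Lemma cexp0 : cexp 0 = 1.
Proof. by rewrite /cexp /= expR0 cos0 sin0 mulr1 mulr0. Qed.

Lemma cnorm_cexp z : cn (cexp z) = expR (complex.Re z).
Proof.
by rewrite cnormE !exprMn -mulrDr cos2Dsin2 mulr1 sqrtr_sqr ger0_norm ?expR_ge0.
Qed.

Lemma cexpMn z n : cexp (n%:R * z) = cexp z ^+ n.
Proof.
elim: n => [|n IH]; first by rewrite mul0r cexp0 expr0.
by rewrite -natr1 mulrDl mul1r cexpD IH exprSr.
Qed.

(** The mean value theorem raises the order of vanishing at 0 by one; iterating it gives the Taylor
    bounds below, whose constants need not be sharp. *)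
Lemma ivt_bound (f f1 : R -> R) (K r : R) (n : nat) :
  (forall t : R, is_derive t (1 : R) f (f1 t)) -> f 0 = 0 ->
  (forall t, `|t| <= r -> `|f1 t| <= K * `|t| ^+ n) ->
  forall t, `|t| <= r -> `|f t| <= K * `|t| ^+ n.+1.
Proof.
move=> df f0 Hf1 t tr.
have cf : forall a b, {within `[a, b], continuous f}.
  move=> a b; apply: continuous_subspaceT => x.
  by apply: differentiable_continuous; apply/derivable1_diffP; case: (df x).
have K0 : 0 <= K * `|t| ^+ n by apply: le_trans (Hf1 t tr).
have [/eqP t0|tn0] := boolP (t == 0).
  by rewrite t0 f0 normr0 exprS mul0r mulr0.
have bound c : `|c| <= `|t| -> `|f1 c * t| <= K * `|t| ^+ n.+1.
  move=> ct; rewrite normrM exprSr mulrA ler_wpM2r//.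
  apply: le_trans (Hf1 c (le_trans ct tr)) _.
  have Kp : 0 <= K.
    by move: K0; rewrite pmulr_lge0// exprn_gt0// normr_gt0.
  by rewrite ler_wpM2l// lerXn2r// nnegrE.
have [t_gt0|t_lt0|t_0] := ltgtP 0 t; last by rewrite -t_0 eqxx in tn0.
  have [c cI] := MVT t_gt0 (fun x _ => df x) (cf _ _).
  rewrite f0 !subr0 => ->; apply: bound.
  by move: cI; rewrite in_itv /= => /andP[c0 ct]; rewrite !gtr0_norm// ltW.
have [c cI] := MVT t_lt0 (fun x _ => df x) (cf _ _).
rewrite f0 !sub0r mulrN => /eqP; rewrite eqr_opp => /eqP ->; apply: bound.
move: cI; rewrite in_itv /= => /andP[c0 ct].
by rewrite !ltr0_norm// lerN2 ltW.
Qed.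

Lemma expR_taylor (t : R) : `|t| <= 1 ->
  [/\ `|expR t - 1| <= expR 1 * `|t|, `|expR t - 1 - t| <= expR 1 * `|t| ^+ 2 &
      `|expR t - 1 - t - t ^+ 2 / 2| <= expR 1 * `|t| ^+ 3].
Proof.
move=> t1.
have b0 (u : R) : `|u| <= 1 -> `|expR u| <= expR 1 * `|u| ^+ 0.
  move=> u1; rewrite expr0 mulr1 ger0_norm ?expR_ge0// ler_expR.
  by rewrite (le_trans (ler_norm _)).
have b1 (u : R) : `|u| <= 1 -> `|expR u - 1| <= expR 1 * `|u| ^+ 1.
  apply: (@ivt_bound (fun u => expR u - 1) expR _ 1 _ _ _ b0); last by rewrite expR0 subrr.
  by move=> v; apply: is_derive_eq; rewrite subr0.
have b2 (u : R) : `|u| <= 1 -> `|expR u - 1 - u| <= expR 1 * `|u| ^+ 2.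
  apply: (@ivt_bound (fun u => expR u - 1 - u) (fun u => expR u - 1) _ 1 _ _ _ b1); last by rewrite expR0 !subr0 subrr.
  by move=> v; apply: is_derive_eq; rewrite subr0.
have b3 (u : R) : `|u| <= 1 -> `|expR u - 1 - u - u ^+ 2 / 2| <= expR 1 * `|u| ^+ 3.
  apply: (@ivt_bound (fun u => expR u - 1 - u - u ^+ 2 / 2) (fun u => expR u - 1 - u) _ 1 _ _ _ b2); last by rewrite expR0 expr2 mul0r mul0r !subr0 subrr.
  move=> v; apply: is_derive_eq; rewrite /GRing.scale /=; by field.
have := b1 t t1; have := b2 t t1; have := b3 t t1; by rewrite expr1.
Qed.

Lemma trig_taylor (t : R) :
  [/\ `|sin t| <= `|t|, `|cos t - 1| <= `|t|, `|cos t - 1| <= `|t| ^+ 2 &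
    [/\ `|sin t - t| <= `|t| ^+ 2, `|sin t - t| <= `|t| ^+ 3 &
      `|cos t - 1 + t ^+ 2 / 2| <= `|t| ^+ 3]].
Proof.
have g (f f1 : R -> R) n : (forall t : R, is_derive t (1 : R) f (f1 t)) -> f 0 = 0 ->
    (forall t : R, `|f1 t| <= `|t| ^+ n) -> forall t : R, `|f t| <= `|t| ^+ n.+1.
  move=> df f0 H u; rewrite -[leRHS]mul1r; apply: (ivt_bound df f0 _ (lexx _)).
  by move=> v _; rewrite mul1r.
have s1 (u : R) : `|sin u| <= `|u| ^+ 1.
  apply: (g (@sin R) (@cos R) 0) => [|v]; first by rewrite sin0.
  by rewrite expr0 cos_max.
have c1 (u : R) : `|cos u - 1| <= `|u| ^+ 1.
  apply: (g (fun u => cos u - 1) (fun u => - sin u) 0) => [v||v].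
  - by apply: is_derive_eq; rewrite subr0.
  - by rewrite cos0 subrr.
  - by rewrite expr0 normrN sin_max.
have c2 (u : R) : `|cos u - 1| <= `|u| ^+ 2.
  apply: (g (fun u => cos u - 1) (fun u => - sin u) 1) => [v||v].
  - by apply: is_derive_eq; rewrite subr0.
  - by rewrite cos0 subrr.
  - by rewrite normrN.
have s2 n : (forall u : R, `|cos u - 1| <= `|u| ^+ n) ->
    forall u : R, `|sin u - u| <= `|u| ^+ n.+1.
  by apply: (g (fun u => sin u - u) (fun u => cos u - 1)); rewrite sin0 subrr.
have c3 (u : R) : `|cos u - 1 + u ^+ 2 / 2| <= `|u| ^+ 3.
  apply: (g (fun u => cos u - 1 + u ^+ 2 / 2) (fun u => - (sin u - u)) 2) => [v||v].
  - by apply: is_derive_eq; rewrite /GRing.scale /=; by field.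
  - by rewrite cos0 subrr expr2 !mul0r addr0.
  - by rewrite normrN; exact: (s2 1 c1).
have s11 := s1 t; have c11 := c1 t; rewrite expr1 in s11 c11.
by split=> //; split; [exact: (s2 1 c1)|exact: (s2 2 c2)|exact: c3].
Qed.

(* With z = x + iy, expand the product of the Taylor expansions of e^x and of
   cos y + i sin y; every term left over has total degree at least 3. *)
Lemma cexp_taylor z : cn z <= 1 ->
  cn (cexp z - 1 - z - z ^+ 2 / 2) <= (6 * expR 1 + 8) * cn z ^+ 3.
Proof.
case: z => x y; pose Z : C := Complex x y; rewrite -/Z => z1.
have x1 : `|x| <= cn Z by exact: (ler_normRe (Complex x y)).
have y1 : `|y| <= cn Z by exact: (ler_normIm (Complex x y)).
set r := cn _ in z1 x1 y1 *.
have [Ex0 Ex1 Ex2] := expR_taylor (le_trans x1 z1).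
have [Sy0 Cy1 Cy2 [Sy1 Sy2 Cy3]] := trig_taylor y.
have r0 : 0 <= r by exact: normr_ge0.
have e1 : 0 <= expR 1 :> R by exact: expR_ge0.
have pw n (t : R) : `|t| <= r -> `|t| ^+ n <= r ^+ n by move=> tr; rewrite lerXn2r// nnegrE.
have r32 : r ^+ 3 <= r ^+ 2 by rewrite exprS ler_piMl// sqr_ge0.
have mm (u v A B : R) : `|u| <= A -> `|v| <= B -> `|u * v| <= A * B.
  by move=> uA vB; rewrite normrM ler_pM.
set Ex := expR x in Ex0 Ex1 Ex2 *.
have Ex1' : `|Ex - 1 - x| <= expR 1 * r ^+ 2 by rewrite (le_trans Ex1)// ler_wpM2l// pw.
have Ex0' : `|Ex - 1| <= expR 1 * r by rewrite (le_trans Ex0)// ler_wpM2l.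
have Ex2' : `|Ex - 1 - x - x ^+ 2 / 2| <= expR 1 * r ^+ 3.
  by rewrite (le_trans Ex2)// ler_wpM2l// pw.
have Cy1' : `|cos y - 1| <= r ^+ 2 by rewrite (le_trans Cy2)// pw.
have Cy3' : `|cos y - 1 + y ^+ 2 / 2| <= r ^+ 3 by rewrite (le_trans Cy3)// pw.
have Sy0' : `|sin y| <= r by rewrite (le_trans Sy0).
have Sy2' : `|sin y - y| <= r ^+ 3 by rewrite (le_trans Sy2)// pw.
have Sy1' : `|sin y - y| <= r ^+ 2 by rewrite (le_trans Sy1)// pw.
have half (u : C) : u / 2 = 2^-1 *: u.
  rewrite scaleCE mulrC; congr (_ * _).
  by rewrite [RHS](fmorphV (real_complex R)) (rmorph_nat (real_complex R)).
rewrite half.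
have -> : cexp Z - 1 - Z - 2^-1 *: (Z ^+ 2) =
    Complex ((Ex - 1 - x - x ^+ 2 / 2) + (Ex - 1) * (cos y - 1) + (cos y - 1 + y ^+ 2 / 2))
      ((Ex - 1 - x) * sin y + x * (sin y - y) + (sin y - y)).
  rewrite /Z /cexp expr2 /= -/Ex; simpc => /=.
  by apply/eqP; rewrite eq_complex /=; apply/andP; split; apply/eqP; field.
rewrite (le_trans (ler_cnorm _))//=.
rewrite (le_trans (lerD (ler_normD _ _) (ler_normD _ _)))//.
rewrite (le_trans (lerD (lerD (ler_normD _ _) (lexx _)) (lerD (ler_normD _ _) (lexx _))))//.
have H1 : `|(Ex - 1) * (cos y - 1)| <= expR 1 * r ^+ 3.
  by rewrite (le_trans (mm _ _ _ _ Ex0' Cy1'))// -mulrA -exprS.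
have H2 : `|(Ex - 1 - x) * sin y| <= expR 1 * r ^+ 3.
  by rewrite (le_trans (mm _ _ _ _ Ex1' Sy0'))// -mulrA -exprSr.
have H3 : `|x * (sin y - y)| <= r ^+ 3.
  by rewrite (le_trans (mm _ _ _ _ x1 Sy1'))// -exprS.
have H4 : 0 <= expR 1 * r ^+ 3 by rewrite mulr_ge0 ?exprn_ge0.
have H5 : 0 <= r ^+ 3 by rewrite exprn_ge0.
rewrite (le_trans (lerD (lerD (lerD Ex2' H1) Cy3') (lerD (lerD H2 H3) Sy2')))//.
rewrite mulrDl; move: H4 H5; lra.
Qed.

(** Unlike a Taylor bound near 0 this holds for all w: beyond |w| = 1 each of the three terms is at
    most e^|w|. A global bound is needed to expand q^N uniformly in N. *)
Lemma cexp_taylor1 : exists2 K : R, 0 <= K & forall w,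
  cn (cexp w - 1 - w) <= K * cn w ^+ 2 * expR (cn w).
Proof.
have e1 : 0 <= expR 1 :> R by exact: expR_ge0.
exists (6 * expR 1 + 12); first by rewrite addr_ge0// mulr_ge0.
move=> w; have w0 : 0 <= cn w by exact: normr_ge0.
have E1 : 1 <= expR (cn w) by rewrite -expR0 ler_expR.
have w2 : 0 <= cn w ^+ 2 by rewrite exprn_ge0.
have K0 : 0 <= (6 * expR 1 + 12) * cn w ^+ 2 by rewrite mulr_ge0// addr_ge0// mulr_ge0.
have [w1|w1] := leP (cn w) 1.
  apply: (@le_trans _ _ ((6 * expR 1 + 12) * cn w ^+ 2)); last by rewrite ler_peMr.
  have -> : cexp w - 1 - w = (cexp w - 1 - w - w ^+ 2 / 2) + w ^+ 2 / 2 by ring.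
  rewrite (le_trans (ler_normD _ _))//.
  have H := cexp_taylor w1.
  have -> : cn (w ^+ 2 / 2) = cn w ^+ 2 / 2.
    by rewrite cnormM cnormX cnormV cnorm_nat.
  have w3 : cn w ^+ 3 <= cn w ^+ 2 by rewrite [cn w ^+ 3]exprS ler_piMl.
  have : (6 * expR 1 + 8) * cn w ^+ 3 <= (6 * expR 1 + 8) * cn w ^+ 2.
    by rewrite ler_wpM2l// addr_ge0// mulr_ge0.
  move: H; lra.
have Hb : cn (cexp w - 1 - w) <= expR (cn w) + 1 + cn w.
  rewrite (le_trans (ler_normB _ _))// lerD// (le_trans (ler_normB _ _))//.
  rewrite cnorm1 lerD// cnorm_cexp ler_expR.
  by rewrite (le_trans (ler_norm _))// ler_normRe.
have wE : cn w <= expR (cn w) by apply: le_trans (expR_ge1Dx _); rewrite lerDr.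
have w21 : 1 <= cn w ^+ 2 by rewrite exprn_ege1// ltW.
have : 12 * expR (cn w) <= (6 * expR 1 + 12) * cn w ^+ 2 * expR (cn w).
  rewrite ler_wpM2r ?expR_ge0// -[12]mulr1 ler_pM// ?lerDr ?mulr_ge0//.
  by rewrite mulr1 lerDr mulr_ge0.
move: Hb wE E1; lra.
Qed.

End ComplexExp.

(** * Series over the natural numbers and the integers *)

Section OneDimensionalSums.
Variable R : realType.
Local Notation C := (Rcomplex R).
Local Notation cn := (@Num.norm
  (Num_RealClosedField__to__Num_POrderedZmodule (reals_Real__to__Num_RealClosedField R))
  (complex_Rcomplex__canonical__Num_SemiNormedZmodule (reals_Real__to__Num_RealClosedField R))).

Lemma ler_sum_subset (I : choiceType) (s t : seq I) (u : I -> R) :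
  uniq s -> uniq t -> {subset s <= t} -> (forall i, 0 <= u i) ->
  \sum_(i <- s) u i <= \sum_(i <- t) u i.
Proof.
move=> us ut st u0; rewrite [leRHS](bigID (mem s)) /= -[X in X + _]big_filter.
rewrite (_ : \sum_(i <- [seq _ <- _ | _]) _ = \sum_(i <- s) u i).
  by rewrite lerDl sumr_ge0.
apply: perm_big; apply: uniq_perm => //; first exact: filter_uniq.
by move=> j; rewrite mem_filter; case: (boolP (j \in s)) => //= /st.
Qed.

Lemma abs_bound_nat (f : nat -> C) B :
  (forall n, \sum_(i < n) cn (f i) <= B) -> abs_bound f B.
Proof.
move=> H s us; pose n := (\max_(i <- s) i).+1.
apply: le_trans (H n); rewrite -(big_mkord xpredT (fun i => cn (f i))).
apply: ler_sum_subset => //; first exact: iota_uniq.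
by move=> j js; rewrite mem_index_iota /= ltnS; apply: (@leq_bigmax_seq _ _ xpredT id).
Qed.

(** Partial sums of the binomial series: by Pascal's rule, multiplication by 1 - r lowers k by one,
    up to a discarded nonnegative term. *)
Lemma binomial_power_sum (r : R) k n : 0 <= r -> r < 1 ->
  \sum_(m < n) 'C(m + k, k)%:R * r ^+ m <= (1 - r) ^- k.+1.
Proof.
move=> r0 r1; have r10 : 0 < 1 - r by rewrite subr_gt0.
pose A k n := \sum_(m < n) 'C(m + k, k)%:R * r ^+ m.
have A0 k' n' : 0 <= A k' n' by apply: sumr_ge0 => m _; rewrite mulr_ge0// exprn_ge0.
have key k' n' : A k'.+1 n' * (1 - r) <= A k' n'.
  elim: n' => [|n' IH]; first by rewrite /A !big_ord0 mul0r.
  suff H : A k'.+1 n'.+1 <= r * A k'.+1 n'.+1 + A k' n'.+1.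
    by rewrite mulrBr mulr1 lerBlDr addrC mulrC.
  have mono : A k'.+1 n' <= A k'.+1 n'.+1.
    by rewrite /A [leRHS]big_ord_recr lerDl /= mulr_ge0// exprn_ge0.
  apply: (@le_trans _ _ (r * A k'.+1 n' + A k' n'.+1)); last first.
    by rewrite lerD2r ler_wpM2l.
  suff -> : A k'.+1 n'.+1 = r * A k'.+1 n' + A k' n'.+1 by [].
  rewrite /A !big_ord_recl /= !add0n !binn expr0 !mulr1 mulr_sumr.
  rewrite addrCA -big_split /=; congr (_ + _); apply: eq_bigr => i _.
  rewrite /bump /= add1n.
  have -> : 'C(i.+1 + k'.+1, k'.+1) = ('C(i + k'.+1, k'.+1) + 'C(i.+1 + k', k'))%N.
    by rewrite addSn binS [in X in (_ + X)%N]addnS -addSn.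
  rewrite natrD exprS; ring.
elim: k n => [|k IH] n; rewrite -/(A _ _).
  rewrite expr1 -[leRHS]mul1r ler_pdivlMr// /A.
  under eq_bigr do rewrite bin0 mul1r.
  have -> : (\sum_(i < n) r ^+ i) * (1 - r) = 1 - r ^+ n.
    by rewrite mulrC -opprB mulNr -subrX1 opprB.
  by rewrite gerBl exprn_ge0.
rewrite exprS invfM -ler_pdivrMl ?invr_gt0// invrK mulrC.
exact: le_trans (key _ _) (IH n).
Qed.

(** Reduces power series with polynomial coefficients to the binomial series. *)
Lemma power_le_binomial m k : ((m ^ k)%N <= k`! * 'C(m + k, k))%N.
Proof.
elim: k => [|k IH]; first by rewrite expn0 fact0 addn0 bin0.
rewrite factS expnS -mulnA.
have -> : (k.+1 * (k`! * 'C(m + k.+1, k.+1)) = (m + k).+1 * (k`! * 'C(m + k, k)))%N.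
  by rewrite addnS mulnCA [RHS]mulnCA mul_bin_diag.
apply: leq_mul => //; by rewrite -addnS leq_addr.
Qed.

Lemma summable_powers (u : C) k : cn u < 1 ->
  abs_summable (fun m : nat => (m ^ k)%:R * u ^+ m : C).
Proof.
move=> u1; exists (k`!%:R * (1 - cn u) ^- k.+1); apply: abs_bound_nat => n.
apply: le_trans (ler_wpM2l (ler0n _ _) (binomial_power_sum k n (normr_ge0 u) u1)).
rewrite mulr_sumr ler_sum// => m _; rewrite cnormM cnorm_nat cnormX mulrA.
by rewrite ler_wpM2r ?exprn_ge0// -natrM ler_nat power_le_binomial.
Qed.

Lemma has_sum_nat_shift (f : nat -> C) l :
  has_sum (fun n => f n.+1) l -> has_sum f (f 0 + l).
Proof.
move=> fl; pose g n : C := if n is 0 then 0 else f n.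
have gl : has_sum g l.
  apply: (@has_sum_reindex _ _ _ S) => //; first by move=> ? ? [].
  by case=> [|n]; rewrite ?eqxx// => _; exists n.
have f0 : has_sum (fun n => if n is 0 then f 0 else 0 : C) (f 0).
  have := @has_sum_seq R _ [:: 0] (fun n => if n is 0 then f 0 else 0 : C) isT.
  by rewrite big_seq1; apply; case.
by apply: eq_has_sum (has_sumD f0 gl) => -[|n]; rewrite ?addr0 ?add0r.
Qed.

Lemma sum_nat_shift (f : nat -> C) : abs_summable f ->
  sum f = f 0 + sum (fun n => f n.+1).
Proof.
move=> fs; apply/sumP/has_sum_nat_shift/abs_has_sum.
by apply: (@abs_summable_reindex _ _ _ S f) => // ? ? [].
Qed.

Lemma has_sum_int (f : int -> C) a b :
  has_sum (fun n : nat => f (Posz n)) a -> has_sum (fun n : nat => f (Negz n)) b ->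
  has_sum f (a + b).
Proof.
move=> fa fb.
pose f1 n : C := if n is Posz _ then f n else 0.
pose f2 n : C := if n is Negz _ then f n else 0.
have H1 : has_sum f1 a.
  apply: (@has_sum_reindex _ _ _ Posz) => //; first by move=> ? ? [].
  by case=> n; rewrite /f1 ?eqxx// => _; exists n.
have H2 : has_sum f2 b.
  apply: (@has_sum_reindex _ _ _ Negz) => //; first by move=> ? ? [].
  by case=> n; rewrite /f2 ?eqxx// => _; exists n.
by apply: eq_has_sum (has_sumD H1 H2) => -[n|n]; rewrite /f1 /f2 ?addr0 ?add0r.
Qed.

Lemma abs_summable_int (f : int -> C) :
  abs_summable (fun n : nat => f (Posz n)) -> abs_summable (fun n : nat => f (Negz n)) ->
  abs_summable f.
Proof.
move=> fa fb.
pose f1 n : C := if n is Posz _ then f n else 0.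
pose f2 n : C := if n is Negz _ then f n else 0.
have H1 : abs_summable f1.
  apply: (@abs_summable_ext _ _ _ Posz) => //; first by move=> ? ? [].
  by case=> n; rewrite /f1 ?eqxx// => _; exists n.
have H2 : abs_summable f2.
  apply: (@abs_summable_ext _ _ _ Negz) => //; first by move=> ? ? [].
  by case=> n; rewrite /f2 ?eqxx// => _; exists n.
apply: abs_summable_le (abs_summableD H1 H2) => -[n|n]; by rewrite /f1 /f2 ?addr0 ?add0r.
Qed.

Lemma sum_int (f : int -> C) : abs_summable f ->
  sum f = sum (fun n : nat => f (Posz n)) + sum (fun n : nat => f (Negz n)).
Proof.
move=> fs; apply/sumP/has_sum_int; apply: abs_has_sum.
  by apply: (@abs_summable_reindex _ _ _ Posz f) => // ? ? [].
by apply: (@abs_summable_reindex _ _ _ Negz f) => // ? ? [].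
Qed.

(** The fixed summable majorant with which families over the integers are compared; it has no
    singularity at n = 0. *)
Definition int_weight (n : int) : R := (1 + n%:~R ^+ 2)^-1.

Lemma int_weight_gt0 n : 0 < int_weight n.
Proof. by rewrite invr_gt0 ltr_pwDl// sqr_ge0. Qed.

Lemma nat_weight_sum n : \sum_(i < n) (1 + i%:R ^+ 2)^-1 <= 4 :> R.
Proof.
(* Telescoping: 1/(1 + n^2) <= 4/(n + 1) - 4/(n + 2). *)
suff : \sum_(i < n) (1 + i%:R ^+ 2)^-1 <= 4 - 4 / n.+1%:R :> R.
  by move/le_trans; apply; rewrite gerBl divr_ge0.
elim: n => [|n IH]; first by rewrite big_ord0 divr1 subrr.
rewrite big_ord_recr /= (le_trans (lerD IH (lexx _)))//.
rewrite -subr_ge0.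
have p1 : 0 < 1 + n%:R ^+ 2 :> R by rewrite ltr_pwDl// sqr_ge0.
have -> : 4 - 4 / n.+2%:R - (4 - 4 / n.+1%:R + (1 + n%:R ^+ 2)^-1) =
   (4 * (1 + n%:R ^+ 2) - n.+1%:R * n.+2%:R) / (n.+1%:R * n.+2%:R * (1 + n%:R ^+ 2)) :> R.
  by field; rewrite (gt_eqF p1) !gt_eqF// ltr_wpDr.
apply: divr_ge0; last by rewrite !mulr_ge0// ltW.
have -> : n.+1%:R = n%:R + 1 :> R by rewrite natr1.
have -> : n.+2%:R = n%:R + 2 :> R by rewrite -addn2 natrD.
have : 0 <= n%:R :> R by []; have := sqr_ge0 (n%:R - 1 : R); nra.
Qed.

Lemma summable_int_weight : abs_summable (fun n => (int_weight n)%:C%C : C).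
Proof.
apply: abs_summable_int; exists 4; apply: abs_bound_nat => n.
  apply: le_trans (nat_weight_sum n); rewrite ler_sum// => m _.
  by rewrite normrZC gtr0_norm// int_weight_gt0.
apply: le_trans (nat_weight_sum n); rewrite ler_sum// => m _.
rewrite normrZC gtr0_norm ?int_weight_gt0// lef_pV2 ?posrE ?ltr_pwDl ?sqr_ge0//.
by rewrite lerD2l NegzE rmorphN sqrrN /= lerXn2r ?nnegrE// ler_nat.
Qed.

Lemma summable_int_le (f : int -> C) K :
  (forall n, cn (f n) <= K * int_weight n) -> abs_summable f.
Proof.
move=> H; have : abs_summable (fun n => (K%:C%C : C) * (int_weight n)%:C%C).
  exact/abs_summableZ/summable_int_weight.
apply: abs_summable_le => n; apply: le_trans (H n) _.
by rewrite cnormM !normrZC (gtr0_norm (int_weight_gt0 _)) ler_wpM2r ?ler_norm// ltW// int_weight_gt0.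
Qed.

Lemma shift_weight (x y : R) (n : int) : y != 0 ->
  ((x + n%:~R) ^+ 2 + y ^+ 2)^-1 <= ((1 + 2 * x ^+ 2) / y ^+ 2 + 2) * int_weight n.
Proof.
move=> y0; have y2 : 0 < y ^+ 2 by rewrite exprn_even_gt0.
have p1 : 0 < (x + n%:~R) ^+ 2 + y ^+ 2 by rewrite ltr_wpDl// sqr_ge0.
have p2 : 0 < 1 + n%:~R ^+ 2 :> R by rewrite ltr_pwDl// sqr_ge0.
rewrite /int_weight ler_pdivlMr// mulrC ler_pdivrMr//.
have p3 : 0 <= (1 + 2 * x ^+ 2) / y ^+ 2 * (x + n%:~R) ^+ 2.
  by rewrite mulr_ge0 ?sqr_ge0// divr_ge0 ?sqr_ge0// addr_ge0// mulr_ge0// sqr_ge0.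
have : (1 + 2 * x ^+ 2) / y ^+ 2 * y ^+ 2 = 1 + 2 * x ^+ 2 by rewrite divfK// gt_eqF.
move: p3; set q := _ / _; set m := n%:~R => p3 hq.
have : m ^+ 2 = (x + m) ^+ 2 - 2 * x * m - x ^+ 2 by ring.
have := sqr_ge0 (2 * x + m); nra.
Qed.

End OneDimensionalSums.

Section ComplexExponential.
Variable R : realType.
Local Notation C := (Rcomplex R).
Local Notation cn := (@Num.norm
  (Num_RealClosedField__to__Num_POrderedZmodule (reals_Real__to__Num_RealClosedField R))
  (complex_Rcomplex__canonical__Num_SemiNormedZmodule (reals_Real__to__Num_RealClosedField R))).
Local Notation re := (@complex.Re R).
Local Notation im := (@complex.Im R).
Implicit Types z w : C.

Lemma ReD z w : re (z + w) = re z + re w. Proof. by case: z; case: w. Qed.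
Lemma ImD z w : im (z + w) = im z + im w. Proof. by case: z; case: w. Qed.

Lemma Re_real (r : R) : re (r%:C)%C = r. Proof. by []. Qed.
Lemma Im_real (r : R) : im (r%:C)%C = 0. Proof. by []. Qed.

Lemma natC n : (n%:R : C) = (n%:R%:C)%C.
Proof. by rewrite (rmorph_nat (real_complex R)). Qed.

Lemma intC (n : int) : (n%:~R : C) = (n%:~R%:C)%C.
Proof. by rewrite (rmorph_int (real_complex R)). Qed.

Lemma Re_realM (r : R) z : re ((r%:C)%C * z) = r * re z.
Proof. by case: z => a b /=; rewrite mul0r subr0. Qed.

Lemma Im_realM (r : R) z : im ((r%:C)%C * z) = r * im z.
Proof. by case: z => a b /=; rewrite mul0r addr0. Qed.

Lemma realCV (r : R) : ((r^-1)%:C)%C = ((r%:C)%C : C)^-1.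
Proof. by rewrite [LHS](fmorphV (real_complex R)). Qed.

Lemma natC_neq0 n : (n.+1%:R : C) != 0.
Proof. by rewrite -normr_eq0 cnorm_nat pnatr_eq0. Qed.

Definition tpi : C := Complex 0 (pi *+ 2).

Definition ee z : C := cexp (tpi * z).

Lemma tpi_norm : cn tpi = 2 * pi.
Proof.
rewrite /tpi cnormE expr0n /= add0r sqrtr_sqr ger0_norm ?mulr_natl//.
by rewrite mulrn_wge0// pi_ge0.
Qed.

Lemma tpi_norm_gt0 : 0 < cn tpi.
Proof. by rewrite tpi_norm mulr_gt0// pi_gt0. Qed.

Lemma tpi_neq0 : tpi != 0.
Proof. by rewrite -normr_eq0 gt_eqF// tpi_norm_gt0. Qed.

Lemma Re_tpiM z : re (tpi * z) = - (2 * pi * im z).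
Proof. by case: z => a b /=; rewrite mul0r sub0r mulr_natl. Qed.

Lemma Im_tpiM z : im (tpi * z) = 2 * pi * re z.
Proof. by case: z => a b /=; rewrite mul0r add0r mulr_natl. Qed.

Lemma eeD z w : ee (z + w) = ee z * ee w.
Proof. by rewrite /ee mulrDr cexpD. Qed.

Lemma cnorm_ee z : cn (ee z) = expR (- (2 * pi * im z)).
Proof. by rewrite cnorm_cexp Re_tpiM. Qed.

Lemma ee_lt1 z : 0 < im z -> cn (ee z) < 1.
Proof.
by move=> z0; rewrite cnorm_ee expR_lt1 oppr_lt0 !mulr_gt0// pi_gt0.
Qed.

Lemma eeMn z n : ee (n%:R * z) = ee z ^+ n.
Proof. by rewrite /ee mulrCA cexpMn. Qed.

Lemma ee1 : ee 1 = 1.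
Proof.
by rewrite /ee mulr1 /cexp /tpi /= expR0 cos2pi sin2pi mulr1 mulr0.
Qed.

Lemma ee_int (n : int) : ee n%:~R = 1.
Proof.
have nat n' : ee n'%:R = 1 by rewrite -[n'%:R]mulr1 eeMn ee1 expr1n.
case: n => n; first exact: nat.
have : ee (Negz n)%:~R * ee n.+1%:R = 1.
  by rewrite -eeD NegzE rmorphN addNr /ee mulr0 cexp0.
by rewrite nat mulr1.
Qed.

Lemma eeDint z (n : int) : ee (z + n%:~R) = ee z.
Proof. by rewrite eeD ee_int mulr1. Qed.

End ComplexExponential.

HB.lock Definition Slat (R : realType) (k : nat) (z : Rcomplex R) : Rcomplex R :=
  sum (fun n : int => (z + n%:~R) ^- k).

(** Since 0^0 = 1 in [nat], the term m = 0 contributes 1 when k = 0 and nothing otherwise. *)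
HB.lock Definition Tser (R : realType) (k : nat) (z : Rcomplex R) : Rcomplex R :=
  sum (fun m : nat => (m ^ k)%:R * ee z ^+ m).

(** * The Lipschitz formula *)

Section Lipschitz.
Variable R : realType.
Local Notation C := (Rcomplex R).
Local Notation cn := (@Num.norm
  (Num_RealClosedField__to__Num_POrderedZmodule (reals_Real__to__Num_RealClosedField R))
  (complex_Rcomplex__canonical__Num_SemiNormedZmodule (reals_Real__to__Num_RealClosedField R))).
Local Notation re := (@complex.Re R).
Local Notation im := (@complex.Im R).
Implicit Types z w : C.

Lemma sqr_cnorm_shift z (n : int) :
  cn (z + n%:~R) ^+ 2 = (re z + n%:~R) ^+ 2 + im z ^+ 2.
Proof. by rewrite sqr_cnorm ReD ImD intC Re_real Im_real addr0. Qed.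

Lemma shift_norm_ge z (n : int) : `|im z| <= cn (z + n%:~R).
Proof.
by apply: le_trans (ler_normIm _); rewrite ImD intC Im_real addr0.
Qed.

(** Two of the k + 2 factors give the summable weight and the other k are bounded by 1/|Im z|; [K]
    depends on z alone. *)
Lemma row_le z : im z != 0 -> exists2 K : R, 0 <= K & forall k (n : int),
  cn ((z + n%:~R) ^- k.+2) <= `|im z| ^- k * K * int_weight R n.
Proof.
move=> z0; exists ((1 + 2 * re z ^+ 2) / im z ^+ 2 + 2).
  by rewrite addr_ge0// divr_ge0 ?sqr_ge0// addr_ge0// mulr_ge0// sqr_ge0.
move=> k n; rewrite cnormV cnormX -addn2 exprD invfM -mulrA; apply: ler_pM.
- by rewrite invr_ge0 exprn_ge0.
- by rewrite invr_ge0 sqr_ge0.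
- rewrite lef_pV2 ?posrE ?exprn_gt0 ?normr_gt0//; last first.
    by rewrite -normr_gt0 (lt_le_trans _ (shift_norm_ge _ _))// normr_gt0.
  by rewrite lerXn2r ?nnegrE// shift_norm_ge.
by rewrite sqr_cnorm_shift shift_weight.
Qed.

Lemma summable_row k z : im z != 0 ->
  abs_summable (fun n : int => (z + n%:~R) ^- k.+2).
Proof.
move=> z0; have [K K0 HK] := row_le z0.
by apply: (@summable_int_le _ _ (`|im z| ^- k * K)) => n; exact: HK.
Qed.

Lemma sum_bij (I K : choiceType) (h : I -> K) (h' : K -> I) (f : K -> C) :
  cancel h h' -> cancel h' h -> abs_summable f -> sum (fun i => f (h i)) = sum f.
Proof.
move=> hK h'K fs; apply/esym/sumP.
apply: (@has_sum_reindex _ _ _ h) => //; first exact: can_inj hK.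
  by move=> k _; exists (h' k); rewrite h'K.
by apply/abs_has_sum/(abs_summable_reindex (can_inj hK) fs).
Qed.

Lemma has_sum_cover (I J K : choiceType) (h1 : I -> K) (h2 : J -> K) (f : K -> C) a b :
  injective h1 -> injective h2 -> (forall i j, h1 i != h2 j) ->
  (forall k, (exists i, k = h1 i) \/ (exists j, k = h2 j)) ->
  has_sum (f \o h1) a -> has_sum (f \o h2) b -> has_sum f (a + b).
Proof.
move=> i1 i2 d12 cov fa fb.
pose P k := `[< exists i, k = h1 i >].
pose f1 k : C := if P k then f k else 0; pose f2 k : C := if P k then 0 else f k.
have H1 : has_sum f1 a.
  apply: (@has_sum_reindex _ _ _ h1) => //.
    by move=> k; rewrite /f1 /P; case: asboolP => //; rewrite eqxx.
  apply: eq_has_sum fa => i; rewrite /f1 /= (_ : P (h1 i)) //.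
  by apply/asboolP; exists i.
have H2 : has_sum f2 b.
  apply: (@has_sum_reindex _ _ _ h2) => //.
    move=> k; rewrite /f2 /P; case: asboolP => [|nP _]; rewrite ?eqxx//.
    by have [] := cov k.
  apply: eq_has_sum fb => j; rewrite /f2 /= (_ : P (h2 j) = false) //.
  by apply/asboolP => -[i /esym/eqP]; rewrite (negPf (d12 i j)).
by apply: eq_has_sum (has_sumD H1 H2) => k; rewrite /f1 /f2; case: (P k); rewrite ?addr0 ?add0r.
Qed.

Lemma SlatDint k z (N : int) : im z != 0 -> Slat k.+2 (z + N%:~R) = Slat k.+2 z.
Proof.
move=> z0; rewrite !Slat.unlock.
rewrite -(@sum_bij _ _ (fun n => N + n) (fun n => n - N) (fun n : int => (z + n%:~R) ^- k.+2)).
- by congr sum; apply/funext => n; rewrite rmorphD addrA.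
- by move=> n; rewrite addrC addKr.
- by move=> n; rewrite addrCA subrr addr0.
- exact: summable_row.
Qed.

Lemma im_half z : im (z / 2) = im z / 2.
Proof. by rewrite mulrC natC -realCV Im_realM mulrC. Qed.

(** Splits the integers by parity: z/2 + n = (z + 2n)/2 and (z + 1)/2 + n = (z + 2n + 1)/2. *)
Lemma Slat_dup z : im z != 0 ->
  Slat 2 (z / 2) + Slat 2 ((z + 1) / 2) = 4 * Slat 2 z.
Proof.
move=> z0; have c2 := natC_neq0 R 1.
have nz (n : int) : z + n%:~R != 0.
  by rewrite -normr_gt0 (lt_le_trans _ (shift_norm_ge _ _))// normr_gt0.
have z20 : im (z / 2) != 0 by rewrite im_half mulf_neq0// invr_neq0.
have z120 : im ((z + 1) / 2) != 0.
  by rewrite im_half mulf_neq0// ?invr_neq0// ImD addr0.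
rewrite !Slat.unlock; apply: (@has_sum_uniq R _ (fun n : int => 4 * (z + n%:~R) ^- 2)); last first.
  exact/has_sumZ/abs_has_sum/summable_row.
apply: (@has_sum_cover _ _ _ (fun n => 2 * n)%R (fun n => 2 * n + 1)%R).
- by move=> m n; lia.
- by move=> m n; lia.
- by move=> m n; lia.
- move=> n; have : (n %% 2)%Z = 0 \/ (n %% 2)%Z = 1 by lia.
  by case=> h; [left|right]; exists (n %/ 2)%Z; lia.
- apply: eq_has_sum (abs_has_sum (summable_row 0 z20)) => n /=.
  have -> : z / 2 + n%:~R = (z + (2 * n)%:~R) / 2 by rewrite rmorphM /=; field.
  by rewrite expr_div_n invf_div -natrX mulr_natl.
- apply: eq_has_sum (abs_has_sum (summable_row 0 z120)) => n /=.
  have -> : (z + 1) / 2 + n%:~R = (z + (2 * n + 1)%:~R) / 2 by rewrite rmorphD rmorphM /=; field.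
  by rewrite expr_div_n invf_div -natrX mulr_natl.
Qed.

Lemma summable_Tser k z : 0 < im z ->
  abs_summable (fun m : nat => (m ^ k)%:R * ee z ^+ m : C).
Proof. by move=> z0; apply: summable_powers; apply: ee_lt1. Qed.

Lemma geometric_sum (u : C) : cn u < 1 -> sum (fun m => u ^+ m) = (1 - u)^-1.
Proof.
move=> u1; have us : abs_summable (fun m => u ^+ m).
  by have := summable_powers 0 u1; apply: abs_summable_le => m; rewrite expn0 mul1r.
have := sum_nat_shift us; rewrite expr0.
have -> : (fun n => u ^+ n.+1) = (fun n => u * u ^+ n) by apply/funext => n; rewrite exprS.
rewrite sumZ// => /eqP; rewrite -subr_eq -[X in X - _]mul1r -mulrBl => /eqP H.
have u1n : 1 - u != 0.
  by apply/eqP => /eqP; rewrite subr_eq0 => /eqP u1'; rewrite -u1' cnorm1 ltxx in u1.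
by apply: (mulfI u1n); rewrite H divff.
Qed.

Lemma sub1_neq0 (u : C) : cn u < 1 -> 1 - u != 0.
Proof.
move=> u1; apply/eqP => /eqP; rewrite subr_eq0 => /eqP u1'.
by rewrite -u1' cnorm1 ltxx in u1.
Qed.

(** Shifting the index gives T = u T + u/(1 - u) for u = [ee z]. *)
Lemma Tser1E z : 0 < im z -> Tser 1 z = ee z / (1 - ee z) ^+ 2.
Proof.
move=> z0; have u1 := ee_lt1 z0; set u := ee z in u1 *.
have s1 := summable_Tser 1 z0; rewrite -/u in s1.
have s0 : abs_summable (fun m => u ^+ m).
  by have := summable_powers 0 u1; apply: abs_summable_le => m; rewrite expn0 mul1r.
have E : Tser 1 z = u * Tser 1 z + u * (1 - u)^-1.
  rewrite Tser.unlock {1}sum_nat_shift// exp0n// mul0r add0r -/u.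
  rewrite -geometric_sum// -mulrDr -(sumP (has_sumD (abs_has_sum s1) (abs_has_sum s0))).
  rewrite -sumZ; last exact: abs_summableD.
  congr sum; apply/funext => m; rewrite !expn1 exprS -natr1; ring.
have u1n := sub1_neq0 u1.
have E' : (1 - u) * Tser 1 z = u * (1 - u)^-1 by rewrite mulrBl mul1r {1}E; ring.
apply: (mulfI u1n); rewrite E'; by field.
Qed.

(** With v = [ee (z / 2)] this is v/(1 - v)^2 - v/(1 + v)^2 = 4 v^2/(1 - v^2)^2. *)
Lemma Tser_dup z : 0 < im z ->
  Tser 1 (z / 2) + Tser 1 ((z + 1) / 2) = 4 * Tser 1 z.
Proof.
move=> z0; have c2 := natC_neq0 R 1.
have z20 : 0 < im (z / 2) by rewrite im_half divr_gt0.
have z120 : 0 < im ((z + 1) / 2) by rewrite im_half divr_gt0// ImD addr0.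
have ehalf : ee (2^-1 : C) = -1.
  by rewrite /ee natC -realCV /cexp Re_tpiM Im_tpiM /= mulr0 oppr0 expR0 !mul1r mulrAC divff// mul1r cospi sinpi; apply/eqP; rewrite eq_complex /= oppr0 !eqxx.
have eD : ee ((z + 1) / 2) = - ee (z / 2) by rewrite mulrDl mul1r eeD ehalf mulrN1.
have eS : ee z = ee (z / 2) ^+ 2 by rewrite -eeMn mulrC divfK.
rewrite !Tser1E// eD eS; set v := ee (z / 2).
have v1 : 1 - v != 0 by apply/sub1_neq0/ee_lt1.
have v2 : 1 - (- v) != 0 by apply: sub1_neq0; rewrite normrN; apply: ee_lt1.
have v3 : 1 - v ^+ 2 = (1 - v) * (1 - (- v)) by ring.
rewrite v3; rewrite opprK in v2 *; field; by rewrite v2 v1.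
Qed.

End Lipschitz.

(** * The Lipschitz formula in weight 2 *)

Section LipschitzFormula.
Variable R : realType.
Local Notation C := (Rcomplex R).
Local Notation cn := (@Num.norm
  (Num_RealClosedField__to__Num_POrderedZmodule (reals_Real__to__Num_RealClosedField R))
  (complex_Rcomplex__canonical__Num_SemiNormedZmodule (reals_Real__to__Num_RealClosedField R))).
Local Notation re := (@complex.Re R).
Local Notation im := (@complex.Im R).
Implicit Types z w : C.

(** The difference equals (w^4/4 - 2 w rho - rho^2)/(w v)^2, where v = e^w - 1 and rho = O(w^3) is
    its second-order remainder, so the poles cancel. The radius ensures |v| >= |w|/2, and the bound
    is 4 (1/4 + 2K + K^2). *)
Lemma double_pole_near0 : exists r B : R, 0 < r /\ forall w, w != 0 -> cn w <= r ->
  cexp w != 1 -> cn (cexp w / (1 - cexp w) ^+ 2 - w ^- 2) <= B.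
Proof.
pose K : R := 6 * expR 1 + 8.
have K0 : 0 < K by rewrite ltr_wpDl// mulr_ge0// expR_ge0.
exists (2 * (1 + K))^-1, (1 + 8 * K + 4 * K ^+ 2); split.
  by rewrite invr_gt0 mulr_gt0// ltr_pwDr.
move=> w w0 wr ew; pose rho := cexp w - 1 - w - w ^+ 2 / 2.
set a := cn w in wr.
have a0 : 0 < a by rewrite normr_gt0.
have ar : a * (1 + K) <= 2^-1.
  have K1 : 0 < 1 + K by rewrite ltr_pwDl// ltW.
  by rewrite -ler_pdivlMr// -invfM.
have a1 : a <= 1 by nra.
have rhoK : cn rho <= K * a ^+ 3 by exact: cexp_taylor.
have c2 := natC_neq0 R 1.
have v0 : 1 - cexp w != 0 by rewrite subr_eq0 eq_sym.
pose v := w + w ^+ 2 / 2 + rho.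
have cE : cexp w = 1 + v by rewrite /v /rho; ring.
have v0' : v != 0 by move: v0; rewrite cE opprD addrA subrr sub0r oppr_eq0.
have vlow : a / 2 <= cn v.
  have -> : v = w - (- (w ^+ 2 / 2) - rho) by rewrite /v; ring.
  apply: le_trans (lerB_dist _ _); rewrite -/a.
  have : cn (- (w ^+ 2 / 2) - rho) <= a ^+ 2 / 2 + K * a ^+ 3.
    apply: le_trans (ler_normB _ _) _; rewrite normrN lerD//.
    by rewrite cnormM cnormX cnormV cnorm_nat.
  have : a ^+ 3 <= a ^+ 2 / 1 by rewrite divr1 exprS ler_piMl// sqr_ge0.
  have : a ^+ 2 / 2 + K * a ^+ 2 <= a / 2.
    have -> : a ^+ 2 / 2 + K * a ^+ 2 = a * (a * (2^-1 + K)) by ring.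
    rewrite ler_wpM2l// ?(ltW a0)//; apply: le_trans ar.
    by rewrite ler_wpM2l ?(ltW a0)// lerD2r invf_le1// ler1n.
  nra.
have E : cexp w / (1 - cexp w) ^+ 2 - w ^- 2 =
    (w ^+ 4 / 4 - 2 * w * rho - rho ^+ 2) / (w ^+ 2 * v ^+ 2).
  have -> : (1 - cexp w) ^+ 2 = v ^+ 2 by rewrite cE; ring.
  have -> : w ^+ 4 / 4 - 2 * w * rho - rho ^+ 2 = w ^+ 2 * cexp w - v ^+ 2.
    by rewrite cE /v; field.
  by field; rewrite v0' w0.
rewrite E cnormM cnormV cnormM !cnormX -/a.
have low : a ^+ 4 / 4 <= a ^+ 2 * cn v ^+ 2.
  have -> : a ^+ 4 / 4 = a ^+ 2 * (a / 2) ^+ 2 by field.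
  by rewrite ler_wpM2l ?sqr_ge0// lerXn2r// nnegrE ?divr_ge0// ltW.
have p0 : 0 < a ^+ 2 * cn v ^+ 2.
  by apply: lt_le_trans low; rewrite divr_gt0// exprn_gt0.
rewrite ler_pdivrMr//.
have hi : cn (w ^+ 4 / 4 - 2 * w * rho - rho ^+ 2) <= a ^+ 4 / 4 + 2 * K * a ^+ 4 + K ^+ 2 * a ^+ 4.
  rewrite (le_trans (ler_normB _ _))// lerD//.
    rewrite (le_trans (ler_normB _ _))// lerD//.
      by rewrite cnormM cnormX cnormV cnorm_nat.
    rewrite !cnormM cnorm_nat -/a; have : 0 <= 2 * a by rewrite mulr_ge0// ltW.
    by move=> h; have := ler_wpM2l h rhoK; rewrite [in leRHS]exprS; nra.
  rewrite cnormX; apply: (@le_trans _ _ ((K * a ^+ 3) ^+ 2)).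
    by rewrite lerXn2r// nnegrE// mulr_ge0 ?exprn_ge0// ltW.
  rewrite exprMn -exprM ler_wpM2l ?sqr_ge0//.
  by rewrite (_ : (3 * 2 = 4 + 2)%N)// exprD ler_piMr ?exprn_ge0 ?exprn_ile1// ltW.
apply: le_trans hi _.
apply: (@le_trans _ _ ((1 + 8 * K + 4 * K ^+ 2) * (a ^+ 4 / 4))); first lra.
by rewrite ler_wpM2l// !addr_ge0// ?mulr_ge0 ?sqr_ge0// ltW.
Qed.

(** In the closed strip 1 - q vanishes only at z = 0. If Im z >= r, then |q| <= e^(-2 pi r); if |Re
    z| >= r, the cosine of the argument of q is at most k = cos(2 pi r), which lies in [0, 1)
    because r <= 1/4. *)
Lemma one_sub_ee_away (r : R) : 0 < r -> r <= 4^-1 -> exists2 c : R, 0 < c &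
  forall z, 0 < im z -> `|re z| <= 2^-1 -> r <= im z \/ r <= `|re z| ->
  c <= cn (1 - ee z) ^+ 2.
Proof.
move=> r0 r4; have pi0 := pi_gt0 R.
pose rho : R := expR (- (2 * pi * r)); pose k : R := cos (2 * pi * r).
have rho1 : rho < 1 by rewrite expR_lt1 oppr_lt0 !mulr_gt0.
have pr : 0 < 2 * pi * r by rewrite !mulr_gt0.
have pr2 : 2 * pi * r <= pi / 2.
  have : 2 * pi * r <= 2 * pi * 4^-1 by rewrite ler_wpM2l// mulr_ge0// ltW.
  lra.
have k0 : 0 <= k.
  by apply: cos_ge0_pihalf; rewrite pr2 andbT (le_trans _ (ltW pr))// oppr_le0 divr_ge0// ltW.
have k1 : k < 1.
  rewrite -[ltRHS]cos0; rewrite ltr_cos//; rewrite in_itv /= ?lexx ?(ltW pi0)//.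
  by rewrite (ltW pr)/= (le_trans pr2)// ler_pdivrMr// ler_peMr// ?ler1n// ltW.
exists (Num.min ((1 - rho) ^+ 2) (1 - k ^+ 2)).
  rewrite lt_min exprn_gt0 ?subr_gt0//= expr_lt1//.
move=> z z0 x2 H; rewrite ge_min; apply/orP.
case: H => [ry|rx]; [left|right].
  rewrite lerXn2r ?nnegrE ?subr_ge0 ?(ltW rho1)//.
  have : cn (ee z) <= rho.
    by rewrite cnorm_ee ler_expR lerN2 ler_wpM2l// mulr_ge0// ltW.
  have := lerB_dist (1 : C) (ee z); rewrite cnorm1; lra.
have ck : cos (2 * pi * re z) <= k.
  have -> : cos (2 * pi * re z) = cos (2 * pi * `|re z|).
    by have [h|h] := leP 0 (re z); [rewrite ger0_norm|rewrite ltr0_norm// mulrN cosN].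
  have le_pi : 2 * pi * `|re z| <= pi.
    have : 2 * pi * `|re z| <= 2 * pi * 2^-1 by rewrite ler_wpM2l// mulr_ge0// ltW.
    lra.
  have I1 : 2 * pi * r \in `[0, pi].
    by rewrite in_itv /= (ltW pr)/= (le_trans pr2)// ler_pdivrMr// ler_peMr// ?ler1n// ltW.
  have I2 : 2 * pi * `|re z| \in `[0, pi] by rewrite in_itv /= le_pi andbT !mulr_ge0// ltW.
  by rewrite /k leNgt (ltr_cos I2 I1) -leNgt ler_wpM2l// mulr_ge0// ltW.
have -> : cn (1 - ee z) ^+ 2 = 1 - 2 * cn (ee z) * cos (2 * pi * re z) + cn (ee z) ^+ 2.
  rewrite cnorm_ee sqr_cnorm /ee /cexp Re_tpiM Im_tpiM /=.
  set E := expR _; set t := 2 * pi * re z.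
  have := cos2Dsin2 t; set c := cos t; set s := sin t => cs.
  have -> : (1 - E * c) ^+ 2 + (0 - E * s) ^+ 2 = 1 - 2 * E * c + E ^+ 2 * (c ^+ 2 + s ^+ 2) by ring.
  by rewrite cs mulr1.
have : cn (ee z) * cos (2 * pi * re z) <= cn (ee z) * k by rewrite ler_wpM2l.
(* With E = |q|: 1 - 2 E k + E^2 = 1 - k^2 + (E - k)^2. *)
have := sqr_ge0 (cn (ee z) - k); nra.
Qed.

Local Notation F z := (Slat 2 z - tpi R ^+ 2 * Tser 1 z).

Lemma Slat2_sub_pole : exists B : R, forall z, 0 < im z -> `|re z| <= 2^-1 ->
  cn (Slat 2 z - z ^- 2) <= B.
Proof.
have [B HB] := summable_int_weight R.
exists (8 * B) => z z0 x2.
pose g (n : int) : C := if n == 0 then 0 else (z + n%:~R) ^- 2.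
have gE : has_sum g (Slat 2 z - z ^- 2).
  rewrite Slat.unlock.
  have := @has_sum_seq R _ [:: (0 : int)] (fun n : int => if n == 0 then z ^- 2 else 0 : C) isT.
  rewrite big_seq1 eqxx => H.
  have {}H := H (fun i => _); have {}H : has_sum (fun n : int => if n == 0 then z ^- 2 else 0 : C) (z ^- 2).
    by apply: H => i; rewrite inE => /negPf ->.
  have := has_sumB (abs_has_sum (summable_row 0 (lt0r_neq0 z0))) H.
  apply: eq_has_sum => n; rewrite /g; case: eqP => [->|_]; last by rewrite subr0.
  by rewrite addr0 subrr.
have gB : abs_bound (fun n => (8%:R : C) * (int_weight R n)%:C%C) (8 * B).
  by have := abs_boundZ (8%:R : C) HB; rewrite cnorm_nat.
apply: (has_sum_le gE); apply: abs_bound_le gB => n.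
rewrite /g cnormM cnorm_nat normrZC gtr0_norm ?int_weight_gt0//.
case: eqP => [_|/eqP n0]; first by rewrite normr0 mulr_ge0// ltW// int_weight_gt0.
have n1 : 1 <= `|n%:~R| :> R.
  by rewrite -intr_norm ler1z -gtz0_ge1 normr_gt0.
have d1 : `|n%:~R| / 2 <= cn (z + n%:~R).
  apply: le_trans (ler_normRe _); rewrite ReD intC Re_real.
  rewrite (_ : re z + n%:~R = n%:~R - - re z); last by rewrite opprK addrC.
  by apply: le_trans (lerB_dist _ _); rewrite normrN; lra.
have p1 : 0 < `|n%:~R| / 2 :> R by rewrite divr_gt0// (lt_le_trans _ n1).
rewrite cnormV cnormX /int_weight -[X in X * _]invrK -invfM.
have d2 : (`|n%:~R| / 2) ^+ 2 <= cn (z + n%:~R) ^+ 2 by rewrite lerXn2r// nnegrE// ltW.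
rewrite lef_pV2 ?posrE ?mulr_gt0 ?invr_gt0 ?ltr_pwDl ?sqr_ge0 ?exprn_gt0// ?(lt_le_trans p1)//.
apply: le_trans d2; rewrite -(real_normK (num_real (n%:~R : R))); nra.
Qed.

Lemma Tser1_sub_pole : exists B : R, forall z, 0 < im z -> `|re z| <= 2^-1 ->
  cn (z ^- 2 - tpi R ^+ 2 * Tser 1 z) <= B.
Proof.
have [r1 [B1 [r10 H1]]] := double_pole_near0.
have pi0 := pi_gt0 R.
(* Near the pole both |Re z| and |Im z| are below r, so |2 pi i z| <= 4 pi r <= r1. *)
pose r := Num.min (r1 / (4 * pi)) 4^-1.
have r0 : 0 < r by rewrite lt_min divr_gt0 ?mulr_gt0//= invr_gt0.
have r4 : r <= 4^-1 by rewrite ge_min lexx orbT.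
have [c c0 Hc] := one_sub_ee_away r0 r4.
have tp : cn (tpi R) ^+ 2 = 4 * pi ^+ 2 by rewrite tpi_norm; ring.
exists (Num.max (4 * pi ^+ 2 * B1) (r ^- 2 + 4 * pi ^+ 2 * c^-1)) => z z0 x2.
have zn : z != 0 by apply/eqP => zE; rewrite zE ltxx in z0.
have u1 := sub1_neq0 (ee_lt1 z0).
rewrite Tser1E// le_max; apply/orP.
have [away|near] := pselect (r <= im z \/ r <= `|re z|).
  right; have {}Hc := Hc z z0 x2 away.
  apply: le_trans (ler_normB _ _) _; rewrite cnormV cnormX lerD//.
    have rz : r <= cn z.
      case: away => h; last exact: le_trans h (ler_normRe _).
      by apply: le_trans h (le_trans (ler_norm _) (ler_normIm _)).
    rewrite lef_pV2 ?posrE ?exprn_gt0// ?(lt_le_trans r0)//.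
    by rewrite lerXn2r// nnegrE// ltW.
  rewrite cnormM cnormX tp ler_wpM2l ?mulr_ge0 ?sqr_ge0 ?(ltW pi0)//.
  rewrite cnormM cnormV cnormX -[leRHS]mul1r ler_pM ?invr_ge0 ?sqr_ge0//.
    by rewrite ltW// ee_lt1.
  by rewrite lef_pV2 ?posrE// (lt_le_trans c0).
left; have {near}[near1 near2] : im z < r /\ `|re z| < r.
  by split; rewrite ltNge; apply/negP => h; apply: near; [left|right].
have w0 : tpi R * z != 0 by rewrite mulf_neq0// tpi_neq0.
have wr : cn (tpi R * z) <= r1.
  rewrite cnormM tpi_norm.
  have : cn z <= 2 * (r1 / (4 * pi)).
    apply: le_trans (ler_cnorm _) _; rewrite (gtr0_norm z0).
    have : r <= r1 / (4 * pi) by rewrite ge_min lexx.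
    lra.
  move=> h; have := ler_wpM2l (mulr_ge0 (ler0n R 2) (ltW pi0)) h.
  have aux (P q : R) : P != 0 -> 2 * P * (2 * (q / (4 * P))) = q.
    by move=> Pn; field.
  by rewrite aux// gt_eqF.
have ne1 : cexp (tpi R * z) != 1 by move: u1; rewrite subr_eq0 eq_sym.
have := H1 _ w0 wr ne1; rewrite -/(ee z) => h.
have -> : z ^- 2 - tpi R ^+ 2 * (ee z / (1 - ee z) ^+ 2) =
   - (tpi R ^+ 2 * (ee z / (1 - ee z) ^+ 2 - (tpi R * z) ^- 2)).
  by field; rewrite zn u1 tpi_neq0.
by rewrite normrN cnormM cnormX tp ler_wpM2l ?mulr_ge0 ?sqr_ge0 ?(ltW pi0).
Qed.

(** Herglotz's trick: the difference F of the two sides has period 1 and is bounded for |Re z| <=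
    1/2, hence on the whole upper half-plane. From 4 F(z) = F(z/2) + F((z + 1)/2) each iteration
    halves the bound, so F = 0. *)
Lemma Lipschitz2 z : 0 < im z -> Slat 2 z = tpi R ^+ 2 * Tser 1 z.
Proof.
have [B1 HB1] := Slat2_sub_pole; have [B2 HB2] := Tser1_sub_pole.
have bound w : 0 < im w -> cn (F w) <= B1 + B2.
  move=> w0; pose N := - Num.floor (re w + 2^-1).
  pose w' := w + N%:~R.
  have w'0 : 0 < im w' by rewrite /w' ImD intC Im_real addr0.
  have -> : F w = F w'.
    have -> : Slat 2 w' = Slat 2 w by apply: SlatDint; rewrite gt_eqF.
    have -> // : Tser 1 w' = Tser 1 w.
    by rewrite !Tser.unlock; congr sum; apply/funext => m; rewrite eeDint.
  have x2 : `|re w'| <= 2^-1.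
    have := real_floor_itv (num_real (re w + 2^-1)).
    rewrite ReD intC Re_real rmorphN /= rmorphD /= => /andP[h1 h2].
    rewrite ler_norml; apply/andP; split; lra.
  have -> : F w' = (Slat 2 w' - w' ^- 2) + (w' ^- 2 - tpi R ^+ 2 * Tser 1 w') by ring.
  by apply: le_trans (ler_normD _ _) _; rewrite lerD ?HB1 ?HB2.
have B0 : 0 <= B1 + B2 := le_trans (normr_ge0 _) (bound (Complex 0 1) (@ltr01 R)).
have halve n w : 0 < im w -> cn (F w) <= (B1 + B2) / 2 ^+ n.
  elim: n w => [|n IH] w w0; first by rewrite expr0 divr1 bound.
  have c4 := natC_neq0 R 3.
  have -> : F w = (F (w / 2) + F ((w + 1) / 2)) / 4.
    have := Slat_dup (lt0r_neq0 w0); have := Tser_dup w0 => Ht Hs.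
    have -> : F (w / 2) + F ((w + 1) / 2) = (Slat 2 (w / 2) + Slat 2 ((w + 1) / 2)) -
      tpi R ^+ 2 * (Tser 1 (w / 2) + Tser 1 ((w + 1) / 2)) by ring.
    by rewrite Hs Ht; field.
  rewrite cnormM cnormV cnorm_nat ler_pdivrMr//.
  have i1 : 0 < im (w / 2) by rewrite im_half divr_gt0.
  have i2 : 0 < im ((w + 1) / 2) by rewrite im_half divr_gt0// ImD addr0.
  apply: le_trans (ler_normD _ _) _; apply: le_trans (lerD (IH _ i1) (IH _ i2)) _.
  rewrite exprS invfM; lra.
move=> z0; apply/eqP; rewrite -subr_eq0; apply/eqP/le0_eqC => e e0.
have [n Hn] : exists n : nat, (B1 + B2) / e <= n%:R.
  exists (Num.truncn ((B1 + B2) / e)).+1; apply: ltW; exact: truncnS_gt.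
apply: le_trans (halve n z z0) _.
rewrite ler_pdivrMr ?exprn_gt0// mulrC -ler_pdivrMr//.
apply: le_trans Hn _; rewrite -natrX ler_nat; exact: ltnW (ltn_expl _ _).
Qed.

End LipschitzFormula.

(** * The Lipschitz formula in higher weights, by differentiation *)

Section LipschitzAllWeights.
Variable R : realType.
Local Notation C := (Rcomplex R).
Local Notation cn := (@Num.norm
  (Num_RealClosedField__to__Num_POrderedZmodule (reals_Real__to__Num_RealClosedField R))
  (complex_Rcomplex__canonical__Num_SemiNormedZmodule (reals_Real__to__Num_RealClosedField R))).
Local Notation re := (@complex.Re R).
Local Notation im := (@complex.Im R).
Implicit Types z w : C.

(** Expansion of x^(-k), with a = 1/(x + h) and b = 1/x. The factor |b|^2 is kept apart from the
    uniform bound [Y], since it is what makes the error summable over the integers. *)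
Lemma inv_power_taylor (a b h : C) (Y : R) k : cn a <= Y -> cn b <= Y ->
  b - a = h * a * b ->
  cn (a ^+ k - b ^+ k + k%:R * h * b ^+ k.+1) <= k%:R ^+ 2 * cn h ^+ 2 * Y ^+ k * cn b ^+ 2.
Proof.
move=> aY bY hab; have Y0 : 0 <= Y by apply: le_trans aY.
elim: k => [|k IH].
  by rewrite !expr0 subrr mul0r mul0r addr0 normr0 !mulr_ge0// ?exprn_ge0.
have -> : a ^+ k.+1 - b ^+ k.+1 + k.+1%:R * h * b ^+ k.+2 =
    a * (a ^+ k - b ^+ k + k%:R * h * b ^+ k.+1) + k.+1%:R * h ^+ 2 * a * b ^+ k * b ^+ 2.
  have -> : k.+1%:R * h ^+ 2 * a * b ^+ k * b ^+ 2 = k.+1%:R * h * b ^+ k.+1 * (b - a).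
    by rewrite hab (exprS b k); ring.
  have -> : a ^+ k.+1 = a * a ^+ k by rewrite exprS.
  have -> : a * (a ^+ k - b ^+ k + k%:R * h * b ^+ k.+1) =
    a * a ^+ k - b * b ^+ k + (b - a) * b ^+ k + a * (k%:R * h * b ^+ k.+1) by ring.
  rewrite (_ : (b - a) * b ^+ k = h * a * b * b ^+ k); last by rewrite hab.
  rewrite (_ : k.+1%:R = k%:R + 1 :> C); last by rewrite natr1.
  by rewrite (exprS b k.+1) (exprS b k); ring.
apply: le_trans (ler_normD _ _) _; rewrite !cnormM !cnormX cnorm_nat.
have h2 : 0 <= cn h ^+ 2 by rewrite sqr_ge0.
have b2 : 0 <= cn b ^+ 2 by rewrite sqr_ge0.
have P0 : 0 <= cn h ^+ 2 * Y ^+ k.+1 * cn b ^+ 2 by rewrite !mulr_ge0// exprn_ge0.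
have H1 : cn a * cn (a ^+ k - b ^+ k + k%:R * h * b ^+ k.+1) <=
    k%:R ^+ 2 * (cn h ^+ 2 * Y ^+ k.+1 * cn b ^+ 2).
  apply: le_trans (ler_pM _ _ aY IH) _ => //; rewrite (exprS Y k) le_eqVlt; apply/orP; left.
  by apply/eqP; ring.
have H2 : k.+1%:R * cn h ^+ 2 * cn a * cn b ^+ k * cn b ^+ 2 <=
    k.+1%:R * (cn h ^+ 2 * Y ^+ k.+1 * cn b ^+ 2).
  rewrite (exprS Y k) -!mulrA ler_wpM2l// ler_wpM2l//.
  apply: ler_pM => //; apply: ler_pM => //.
  by rewrite ler_wpM2r// lerXn2r// nnegrE.
apply: le_trans (lerD H1 H2) _; rewrite -mulrDl.
have -> : k.+1%:R ^+ 2 * cn h ^+ 2 * Y ^+ k.+1 * cn b ^+ 2 =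
  k.+1%:R ^+ 2 * (cn h ^+ 2 * Y ^+ k.+1 * cn b ^+ 2) by ring.
apply: ler_wpM2r => //.
rewrite -natrX -natrD -natrX ler_nat; nia.
Qed.

Lemma Slat_taylor k z : 0 < im z -> exists2 M : R, 0 <= M & forall h : R,
  cn (Slat k.+2 (z + (h%:C)%C) - Slat k.+2 z + k.+2%:R * (h%:C)%C * Slat k.+3 z) <= M * h ^+ 2.
Proof.
move=> z0; have zn : im z != 0 by rewrite gt_eqF.
have [K K0 HK] := row_le zn.
have [B HB] := summable_int_weight R.
pose Y := (im z)^-1.
have Y0 : 0 < Y by rewrite invr_gt0.
have k20 : 0 <= k.+2%:R ^+ 2 :> R by rewrite sqr_ge0.
have Yk0 : 0 <= Y ^+ k.+2 by rewrite exprn_ge0// ltW.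
have P0 : 0 <= k.+2%:R ^+ 2 * Y ^+ k.+2 * K := mulr_ge0 (mulr_ge0 k20 Yk0) K0.
exists (k.+2%:R ^+ 2 * Y ^+ k.+2 * K * B).
  exact: mulr_ge0 P0 (abs_bound_ge0 HB).
move=> h; have zh0 : im (z + (h%:C)%C) != 0 by rewrite ImD Im_real addr0.
have S := has_sumD (has_sumB (abs_has_sum (summable_row k zh0)) (abs_has_sum (summable_row k zn)))
  (has_sumZ (k.+2%:R * (h%:C)%C) (abs_has_sum (summable_row k.+1 zn))).
rewrite ?Slat.unlock ?Tser.unlock; apply: (has_sum_le S).
have HB' := abs_boundZ ((k.+2%:R ^+ 2 * Y ^+ k.+2 * K * h ^+ 2)%:C%C : C) HB.
have -> : k.+2%:R ^+ 2 * Y ^+ k.+2 * K * B * h ^+ 2 =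
   cn ((k.+2%:R ^+ 2 * Y ^+ k.+2 * K * h ^+ 2)%:C%C : C) * B.
  rewrite normrZC ger0_norm; first by ring.
  exact: mulr_ge0 P0 (sqr_ge0 h).
apply: abs_bound_le HB' => n.
have nz1 : z + n%:~R != 0.
  by rewrite -normr_gt0 (lt_le_trans _ (shift_norm_ge _ _))// normr_gt0.
have nz2 : z + (h%:C)%C + n%:~R != 0.
  by rewrite -normr_gt0 (lt_le_trans _ (shift_norm_ge _ _))// normr_gt0.
have invY w : `|im w| = im z -> cn (w + n%:~R)^-1 <= Y.
  move=> wz; rewrite cnormV lef_pV2 ?posrE//; last first.
    by rewrite (lt_le_trans _ (shift_norm_ge _ _))// wz.
  by rewrite -wz shift_norm_ge.
have T := @inv_power_taylor (z + (h%:C)%C + n%:~R)^-1 (z + n%:~R)^-1 (h%:C)%C Y k.+2.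
rewrite -!exprVn; apply: le_trans (T _ _ _) _.
- by apply: invY; rewrite ImD Im_real addr0 gtr0_norm.
- by apply: invY; rewrite gtr0_norm.
- by field; rewrite nz1 nz2.
rewrite cnormM !normrZC (gtr0_norm (int_weight_gt0 _ _)) (ger0_norm (mulr_ge0 P0 (sqr_ge0 h))).
have := HK 0 n; rewrite expr0 invr1 mul1r -exprVn cnormX => HKn.
have -> : k.+2%:R ^+ 2 * Y ^+ k.+2 * K * h ^+ 2 * int_weight R n =
   k.+2%:R ^+ 2 * `|h| ^+ 2 * Y ^+ k.+2 * (K * int_weight R n).
  by rewrite (real_normK (num_real h)); ring.
by apply: ler_wpM2l => //; exact: mulr_ge0 (mulr_ge0 k20 (sqr_ge0 _)) Yk0.
Qed.

(* The bound is uniform in the exponent N, at the cost of a slightly larger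
   base: it can be summed over N with polynomial weights. *)
Lemma ee_pow_taylor : exists2 K : R, 0 <= K & forall (z d : C) (N : nat),
  cn (ee (z + d) ^+ N - ee z ^+ N - tpi R * d * N%:R * ee z ^+ N) <=
  K * cn d ^+ 2 * N%:R ^+ 2 * (cn (ee z) * expR (2 * pi * cn d)) ^+ N.
Proof.
have [K K0 HK] := cexp_taylor1 R.
exists (K * (2 * pi) ^+ 2); first by rewrite mulr_ge0 ?sqr_ge0.
move=> z d N; rewrite -!eeMn mulrDr eeD.
have -> : ee (N%:R * z) * ee (N%:R * d) - ee (N%:R * z) - tpi R * d * N%:R * ee (N%:R * z) =
   ee (N%:R * z) * (cexp (tpi R * (N%:R * d)) - 1 - tpi R * (N%:R * d)) by rewrite /ee; ring.
rewrite cnormM (eeMn z) cnormX.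
have := HK (tpi R * (N%:R * d)); rewrite !cnormM cnorm_nat tpi_norm => H.
have -> : (cn (ee z) * expR (2 * pi * cn d)) ^+ N =
    cn (ee z) ^+ N * expR (2 * pi * (N%:R * cn d)).
  by rewrite exprMn -expRM_natl; congr (_ * expR _); ring.
apply: le_trans (ler_wpM2l _ H) _; first by rewrite exprn_ge0.
rewrite le_eqVlt; apply/orP; left; apply/eqP; ring.
Qed.

(** Leaves room to enlarge |q| without reaching 1; the witness turns a positive rho into its square
    root. *)
Lemma small_radius (rho : R) : 0 <= rho -> rho < 1 -> exists d : R, 
  [/\ 0 < d, 0 <= rho * expR (2 * pi * d) & rho * expR (2 * pi * d) < 1].
Proof.
move=> r0 r1.
have [->|rn] := eqVneq rho 0; first by exists 1; rewrite !mul0r.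
have rp : 0 < rho by rewrite lt0r rn.
have p2 : 0 < 2 * pi :> R by rewrite mulr_gt0// pi_gt0.
have l0 : ln rho < 0 by rewrite ln_lt0// rp.
exists (- ln rho / 2 / (2 * pi)); split.
- by rewrite !divr_gt0// oppr_gt0.
- by rewrite mulr_ge0// expR_ge0.
rewrite [2 * pi * _]mulrC divfK ?gt_eqF// -{1}(lnK rp) -expRD expR_lt1; lra.
Qed.

Lemma Tser_taylor k z : 0 < im z -> exists d M : R, [/\ 0 < d, 0 <= M & forall h : R,
  `|h| <= d ->
  cn (Tser k (z + (h%:C)%C) - Tser k z - tpi R * (h%:C)%C * Tser k.+1 z) <= M * h ^+ 2].
Proof.
move=> z0; have [K K0 HK] := ee_pow_taylor.
have [d [d0 q0 q1]] := small_radius (normr_ge0 (ee z)) (ee_lt1 z0).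
set q := _ * _ in q0 q1.
have q1' : cn ((q%:C)%C : C) < 1 by rewrite normrZC ger0_norm.
have [B HB] := summable_powers k.+2 q1'.
exists d, (K * B); split=> //; first by rewrite mulr_ge0// (abs_bound_ge0 HB).
move=> h hd; have zh0 : 0 < im (z + (h%:C)%C) by rewrite ImD Im_real addr0.
have S := has_sumB (has_sumB (abs_has_sum (summable_Tser k zh0)) (abs_has_sum (summable_Tser k z0)))
  (has_sumZ (tpi R * (h%:C)%C) (abs_has_sum (summable_Tser k.+1 z0))).
rewrite ?Slat.unlock ?Tser.unlock; apply: (has_sum_le S).
have HB' := abs_boundZ ((K * h ^+ 2)%:C%C : C) HB.
have Kh : 0 <= K * h ^+ 2 by rewrite mulr_ge0// sqr_ge0.
have -> : K * B * h ^+ 2 = cn ((K * h ^+ 2)%:C%C : C) * B by rewrite normrZC ger0_norm//; ring.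
apply: abs_bound_le HB' => m.
have -> : (m ^ k)%:R * ee (z + (h%:C)%C) ^+ m - (m ^ k)%:R * ee z ^+ m -
    tpi R * (h%:C)%C * ((m ^ k.+1)%:R * ee z ^+ m) =
    (m ^ k)%:R * (ee (z + (h%:C)%C) ^+ m - ee z ^+ m - tpi R * (h%:C)%C * m%:R * ee z ^+ m).
  by rewrite expnS natrM; ring.
rewrite !cnormM !cnorm_nat cnormX !normrZC (ger0_norm Kh) (ger0_norm q0).
apply: le_trans (ler_wpM2l (ler0n _ _) (HK z (h%:C)%C m)) _.
rewrite normrZC (real_normK (num_real h)) !expnS !natrM.
have e1 : (cn (ee z) * expR (2 * pi * `|h|)) ^+ m <= q ^+ m.
  rewrite lerXn2r// ?nnegrE ?mulr_ge0 ?expR_ge0//.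
  by rewrite ler_wpM2l// ler_expR ler_wpM2l// mulr_ge0// pi_ge0.
have := ler_wpM2l (mulr_ge0 (ler0n R (m ^ k)) (mulr_ge0 Kh (sqr_ge0 (m%:R : R)))) e1.
set E1 := (_ * expR _) ^+ m; set Q := q ^+ m; lra.
Qed.

(** Used to identify linear coefficients: two expansions of the same function with quadratic error
    have the same one. *)
Lemma eq_of_quadratic_error (X : C) (d M : R) : 0 < d -> 0 <= M ->
  (forall h : R, 0 < h -> h <= d -> h * cn X <= M * h ^+ 2) -> X = 0.
Proof.
move=> d0 M0 H; apply: le0_eqC => e e0.
pose h := Num.min d (e / (M + 1)).
have M1 : 0 < M + 1 by rewrite ltr_wpDl.
have h0 : 0 < h by rewrite lt_min d0 divr_gt0.
have := H h h0; rewrite ge_min lexx => /(_ isT).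
rewrite expr2 mulrCA ler_pM2l// => /le_trans; apply.
have : h <= e / (M + 1) by rewrite ge_min lexx orbT.
rewrite ler_pdivlMr//; nra.
Qed.

Lemma Lipschitz k z : 0 < im z ->
  Slat k.+2 z = (- tpi R) ^+ k.+2 / (k.+1)`!%:R * Tser k.+1 z.
Proof.
elim: k z => [|k IH] z z0; first by rewrite Lipschitz2// sqrrN divr1.
have [M1 M10 H1] := Slat_taylor k z0.
have [d [M2 [d0 M20 H2]]] := Tser_taylor k.+1 z0.
set a := _ / _ in IH.
have k2 := natC_neq0 R k.+1.
(* Difference of the linear coefficients in h of the two sides in weight k + 2; real increments are
   enough to see that it vanishes. *)
suff E : k.+2%:R * Slat k.+3 z + a * tpi R * Tser k.+2 z = 0.
  apply: (mulfI k2); apply/eqP; rewrite -subr_eq0 -[X in _ == X]E; apply/eqP.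
  rewrite factS natrM /a exprS; have f0 : ((k.+1)`!%:R : C) != 0.
    by rewrite -normr_eq0 cnorm_nat pnatr_eq0 -lt0n fact_gt0.
  by field; rewrite f0 -natrD add2n k2.
apply: (@eq_of_quadratic_error _ d (M1 + cn a * M2)) => //.
  by rewrite addr_ge0// mulr_ge0.
move=> h h0 hd; have hn : `|h| <= d by rewrite gtr0_norm.
have -> : h * cn (k.+2%:R * Slat k.+3 z + a * tpi R * Tser k.+2 z) =
  cn ((h%:C)%C * (k.+2%:R * Slat k.+3 z + a * tpi R * Tser k.+2 z)).
  by rewrite cnormM normrZC gtr0_norm.
have zh0 : 0 < im (z + (h%:C)%C) by rewrite ImD Im_real addr0.
have -> : (h%:C)%C * (k.+2%:R * Slat k.+3 z + a * tpi R * Tser k.+2 z) =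
  (Slat k.+2 (z + (h%:C)%C) - Slat k.+2 z + k.+2%:R * (h%:C)%C * Slat k.+3 z) -
  a * (Tser k.+1 (z + (h%:C)%C) - Tser k.+1 z - tpi R * (h%:C)%C * Tser k.+2 z).
  by rewrite !IH//; ring.
apply: le_trans (ler_normB _ _) _; rewrite [leRHS]mulrDl lerD ?H1//.
by rewrite cnormM -[leRHS]mulrA ler_wpM2l// H2.
Qed.

End LipschitzAllWeights.

(** Equals 2 zeta(k) for even k >= 2 and 0 for odd k >= 3. *)
HB.lock Definition int_zeta (R : realType) (k : nat) : Rcomplex R :=
  sum (fun n : int => if n == 0 then 0 else (n%:~R : Rcomplex R) ^- k).

(** * Faulhaber's formula and Euler's recursion for zeta(-j) *)

(* The value at -j of the Riemann zeta function, except that it is 0, not -1/2, at j = 0. *)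
HB.lock Definition zeta_neg (R : realType) (j : nat) : Rcomplex R :=
  if odd j then j`!%:R * int_zeta R j.+1 / (- tpi R) ^+ j.+1 else 0.

Section ZetaValues.
Variable R : realType.
Local Notation C := (Rcomplex R).
Local Notation cn := (@Num.norm
  (Num_RealClosedField__to__Num_POrderedZmodule (reals_Real__to__Num_RealClosedField R))
  (complex_Rcomplex__canonical__Num_SemiNormedZmodule (reals_Real__to__Num_RealClosedField R))).
Local Notation re := (@complex.Re R).
Local Notation im := (@complex.Im R).
Local Notation beta := (zeta_neg R).

(** A limit at 0+ with a linear rate; the explicit rate makes sums, products and uniqueness
    elementary estimates. *)
Definition lim0 (E : R -> C) (l : C) : Prop :=
  exists d M : R, [/\ 0 < d, 0 <= M & forall y, 0 < y -> y <= d -> cn (E y - l) <= M * y].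

Lemma lim0_uniq E l l' : lim0 E l -> lim0 E l' -> l = l'.
Proof.
move=> [d [M [d0 M0 H]]] [d' [M' [d'0 M'0 H']]].
apply/eqP; rewrite -subr_eq0; apply/eqP.
apply: (@eq_of_quadratic_error R _ (Num.min d d') (M + M')).
- by rewrite lt_min d0.
- by rewrite addr_ge0.
move=> h h0; rewrite le_min => /andP[hd hd'].
have -> : l - l' = (E h - l') - (E h - l) by ring.
rewrite expr2 [leRHS]mulrCA ler_pM2l// [leRHS]mulrDl [leRHS]addrC.
apply: le_trans (ler_normB _ _) _; by rewrite lerD ?H ?H'.
Qed.

Lemma lim0_cst l : lim0 (fun _ => l) l.
Proof. by exists 1, 0; split=> // y _ _; rewrite subrr normr0 mul0r. Qed.

Lemma lim0_ext E E' l : (exists2 d, 0 < d & forall y, 0 < y -> y <= d -> E y = E' y) ->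
  lim0 E l -> lim0 E' l.
Proof.
move=> [d d0 H] [d' [M [d'0 M0 H']]]; exists (Num.min d d'), M; split=> //.
  by rewrite lt_min d0.
by move=> y y0; rewrite le_min => /andP[yd yd']; rewrite -H// H'.
Qed.

Lemma lim0D E E' l l' : lim0 E l -> lim0 E' l' -> lim0 (fun y => E y + E' y) (l + l').
Proof.
move=> [d [M [d0 M0 H]]] [d' [M' [d'0 M'0 H']]].
exists (Num.min d d'), (M + M'); split; first by rewrite lt_min d0.
  by rewrite addr_ge0.
move=> y y0; rewrite le_min => /andP[yd yd'].
have -> : E y + E' y - (l + l') = (E y - l) + (E' y - l') by ring.
by rewrite [leRHS]mulrDl (le_trans (ler_normD _ _))// lerD ?H ?H'.
Qed.

Lemma lim0M E E' l l' : lim0 E l -> lim0 E' l' -> lim0 (fun y => E y * E' y) (l * l').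
Proof.
move=> [d [M [d0 M0 H]]] [d' [M' [d'0 M'0 H']]].
exists (Num.min 1 (Num.min d d')), (M * (M' + cn l') + cn l * M'); split.
- by rewrite !lt_min d0 d'0 ltr01.
- by rewrite addr_ge0// mulr_ge0// addr_ge0.
move=> y y0; rewrite !le_min => /and3P[y1 yd yd'].
have -> : E y * E' y - l * l' = (E y - l) * ((E' y - l') + l') + l * (E' y - l') by ring.
rewrite [leRHS]mulrDl; apply: le_trans (ler_normD _ _) _; apply: lerD.
  rewrite cnormM [leRHS]mulrAC; apply: ler_pM => //; first by rewrite H.
  apply: le_trans (ler_normD _ _) _; rewrite lerD2r.
  by apply: le_trans (H' _ y0 yd') _; rewrite ler_piMr.
by rewrite cnormM -[leRHS]mulrA ler_wpM2l// H'.
Qed.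

Lemma lim0Z c E l : lim0 E l -> lim0 (fun y => c * E y) (c * l).
Proof. by apply: lim0M; exact: lim0_cst. Qed.

Lemma lim0_bigop (I : Type) (r : seq I) (P : pred I) (E : I -> R -> C) (l : I -> C) :
  (forall i, lim0 (E i) (l i)) ->
  lim0 (fun y => \sum_(i <- r | P i) E i y) (\sum_(i <- r | P i) l i).
Proof.
move=> H; elim: r => [|i r IH].
  rewrite big_nil; have -> : (fun y : R => \sum_(i <- [::] | P i) E i y) = (fun _ => 0).
    by apply/funext => y; rewrite big_nil.
  exact: lim0_cst.
rewrite big_cons; have -> : (fun y : R => \sum_(i <- i :: r | P i) E i y) =
    (fun y => if P i then E i y + \sum_(i <- r | P i) E i y else \sum_(i <- r | P i) E i y).
  by apply/funext => y; rewrite big_cons.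
by case: (P i) => //; apply: lim0D.
Qed.

Lemma inv_power_sub (a b h : C) k : cn a <= 1 -> cn b <= 1 -> b - a = h * a * b ->
  cn (a ^+ k - b ^+ k) <= k%:R * (cn h * cn a * cn b).
Proof.
move=> a1 b1 hab; elim: k => [|k IH].
  by rewrite !expr0 subrr normr0 mul0r.
have -> : a ^+ k.+1 - b ^+ k.+1 = a * (a ^+ k - b ^+ k) - (b - a) * b ^+ k.
  by rewrite !exprS; ring.
rewrite hab; apply: le_trans (ler_normB _ _) _; rewrite -natr1 [leRHS]mulrDl mul1r.
apply: lerD; first by rewrite cnormM -[leRHS]mul1r ler_pM.
rewrite cnormM cnormX !cnormM ler_piMr ?mulr_ge0//.
by rewrite exprn_ile1.
Qed.

Lemma int_norm_ge1 (n : int) : n != 0 -> 1 <= `|n%:~R : R|.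
Proof. by move=> n0; rewrite -intr_norm ler1z -gtz0_ge1 normr_gt0. Qed.

Lemma int_inv_sqr_le (n : int) : n != 0 -> `|n%:~R : R| ^- 2 <= 2 * int_weight R n.
Proof.
move=> /int_norm_ge1 n1; rewrite /int_weight -[X in X * _]invrK -invfM.
have p : 0 < `|n%:~R : R| by rewrite (lt_le_trans _ n1).
rewrite lef_pV2 ?posrE ?mulr_gt0 ?invr_gt0 ?ltr_pwDl ?sqr_ge0 ?exprn_gt0//.
rewrite -(real_normK (num_real (n%:~R : R))); nra.
Qed.

Lemma summable_int_zeta k : (2 <= k)%N ->
  abs_summable (fun n : int => if n == 0 then 0 else (n%:~R : C) ^- k).
Proof.
case: k => [//|[//|k]] _; apply: (@summable_int_le _ _ 2) => n.
case: eqP => [_|/eqP n0]; first by rewrite normr0 mulr_ge0// ltW// int_weight_gt0.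
apply: le_trans (int_inv_sqr_le n0).
have n1 := int_norm_ge1 n0; have p : 0 < `|n%:~R : R| by rewrite (lt_le_trans _ n1).
rewrite cnormV cnormX cnorm_int lef_pV2 ?posrE ?exprn_gt0//.
by rewrite ler_weXn2l.
Qed.

Lemma int_zeta_odd k : (2 <= k)%N -> odd k -> int_zeta R k = 0.
Proof.
move=> k2 ok; have s := summable_int_zeta k2.
have E : int_zeta R k = - int_zeta R k.
  rewrite int_zeta.unlock -{1}(@sum_bij R _ _ -%R -%R _ (@opprK _) (@opprK _) s).
  rewrite -[RHS]mulN1r -sumZ//; congr sum; apply/funext => n.
  rewrite oppr_eq0; case: eqP => _; first by rewrite mulr0.
  by rewrite rmorphN exprNn -signr_odd ok expr1 mulN1r invrN mulN1r.
have c2 := natC_neq0 R 1; apply: (mulfI c2); rewrite mulr0.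
by rewrite mulr_natl mulr2n {1}E addNr.
Qed.

Definition iy (y : R) : C := Complex 0 y.

Lemma tpi_iy y : - tpi R * iy y = ((2 * pi * y)%:C)%C.
Proof.
by apply/eqP; rewrite eq_complex /= !mulr0 !mulNr mul0r oppr0 sub0r opprK addr0 mulr_natl !eqxx.
Qed.

Lemma ee_iy y : ee (iy y) = ((expR (- (2 * pi * y)))%:C)%C.
Proof.
rewrite /ee /cexp Re_tpiM Im_tpiM /= mulr0 cos0 sin0 mulr1 mulr0; reflexivity.
Qed.

(** The term n = 0 is the pole (iy)^(-k); every other term differs from n^(-k) by at most k
    y/n^2. *)
Lemma Slat_iy_lim k : (2 <= k)%N ->
  lim0 (fun y => Slat k (iy y) - (iy y) ^- k) (int_zeta R k).
Proof.
move=> k2; have [B HB] := summable_int_weight R.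
exists 1, (2 * k%:R * B); split=> //.
  by rewrite mulr_ge0 ?mulr_ge0// (abs_bound_ge0 HB).
move=> y y0 _; have yn : im (iy y) != 0 by rewrite gt_eqF.
have [k' kE] : exists k', k = k'.+2 by case: k k2 => [//|[//|k']] _; exists k'.
have S1 := abs_has_sum (summable_row k' yn); rewrite -kE in S1.
have S2 := abs_has_sum (summable_int_zeta k2).
have S3 : has_sum (fun n : int => if n == 0 then (iy y) ^- k else 0 : C) ((iy y) ^- k).
  have := @has_sum_seq R _ [:: (0 : int)] (fun n : int => if n == 0 then (iy y) ^- k else 0 : C) isT.
  by rewrite big_seq1 eqxx; apply => i; rewrite inE => /negPf ->.
rewrite Slat.unlock int_zeta.unlock; apply: (has_sum_le (has_sumB (has_sumB S1 S3) S2)).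
have HB' := abs_boundZ ((2 * k%:R * y)%:C%C : C) HB.
have P0 : 0 <= 2 * k%:R * y by rewrite !mulr_ge0// ltW.
have -> : 2 * k%:R * B * y = cn ((2 * k%:R * y)%:C%C : C) * B.
  by rewrite normrZC ger0_norm//; ring.
apply: abs_bound_le HB' => n.
rewrite cnormM !normrZC (gtr0_norm (int_weight_gt0 _ _)) (ger0_norm P0).
case: eqP => [->|/eqP n0].
  by rewrite addr0 subrr sub0r normrN normr0 mulr_ge0// ltW// int_weight_gt0.
have n1 := int_norm_ge1 n0.
have p : 0 < `|n%:~R : R| by rewrite (lt_le_trans _ n1).
have nC : (n%:~R : C) != 0 by rewrite -normr_gt0 cnorm_int.
have low : `|n%:~R : R| <= cn (iy y + n%:~R).
  by apply: le_trans (ler_normRe _); rewrite ReD intC Re_real add0r.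
have zn : iy y + n%:~R != 0 by rewrite -normr_gt0 (lt_le_trans p).
rewrite subr0 -!exprVn.
have a1 : cn (iy y + n%:~R)^-1 <= `|n%:~R : R|^-1.
  by rewrite cnormV lef_pV2 ?posrE// (lt_le_trans p).
have b1 : cn (n%:~R)^-1 = `|n%:~R : R|^-1 by rewrite cnormV cnorm_int.
have i1 : `|n%:~R : R|^-1 <= 1 by rewrite invf_le1.
apply: le_trans (@inv_power_sub _ _ (iy y) k (le_trans a1 i1) _ _) _.
- by rewrite b1.
- by field; rewrite zn nC.
have yE : cn (iy y) = y.
  by rewrite /iy cnormE expr0n /= add0r sqrtr_sqr gtr0_norm.
rewrite yE b1.
have := int_inv_sqr_le n0; rewrite -exprVn => w.
have : cn (iy y + n%:~R)^-1 * `|n%:~R : R|^-1 <= `|n%:~R : R|^-1 ^+ 2.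
  by rewrite expr2 ler_wpM2r// invr_ge0.
move/le_trans => /(_ _ w) h.
have := ler_wpM2l (mulr_ge0 (ler0n R k) (ltW y0)) h.
lra.
Qed.

Lemma zeta_neg_even j : ~~ odd j -> beta j = 0.
Proof. by move=> oj; rewrite zeta_neg.unlock (negPf oj). Qed.

(* Abel regularization of the divergent sum of the m^j. *)
Lemma Tser_lim j : lim0 (fun y => Tser j.+1 (iy y) - (j.+1)`!%:R * ((2 * pi * y)%:C)%C ^- j.+2)
  (beta j.+1).
Proof.
have tn : - tpi R != 0 by rewrite oppr_eq0 tpi_neq0.
have fn : ((j.+1)`!%:R : C) != 0.
  by rewrite -normr_eq0 cnorm_nat pnatr_eq0 -lt0n fact_gt0.
have bE : beta j.+1 = (j.+1)`!%:R / (- tpi R) ^+ j.+2 * int_zeta R j.+2.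
  rewrite zeta_neg.unlock; case: ifPn => o; first by ring.
  by rewrite int_zeta_odd ?mulr0.
rewrite bE; apply: lim0_ext (lim0Z _ (@Slat_iy_lim j.+2 isT)).
exists 1 => // y y0 _; rewrite Lipschitz// -tpi_iy exprMn.
have yn : iy y != 0.
  by rewrite eq_complex /= negb_and (gt_eqF y0) orbT.
have := expf_neq0 j.+2 tn; have := expf_neq0 j.+2 yn.
set T := (- tpi R) ^+ j.+2; set Y := iy y ^+ j.+2 => Yn Tn.
by field; rewrite fn Yn Tn.
Qed.

End ZetaValues.

(** * Abel summation and the expansions at y = 0 *)

Section Faulhaber.
Variable R : realType.
Local Notation C := (Rcomplex R).
Local Notation cn := (@Num.norm
  (Num_RealClosedField__to__Num_POrderedZmodule (reals_Real__to__Num_RealClosedField R))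
  (complex_Rcomplex__canonical__Num_SemiNormedZmodule (reals_Real__to__Num_RealClosedField R))).
Local Notation re := (@complex.Re R).
Local Notation im := (@complex.Im R).
Local Notation beta := (zeta_neg R).
Local Notation tau2 y := ((2 * pi * y)%:C%C : C).

(** The true value zeta(-j), including zeta(0) = -1/2, which [beta] omits. *)
Definition zeta_at_neg j : C := if j == 0 then - 2^-1 else beta j.

Lemma lim0_real (f : R -> R) (l M d : R) : 0 < d -> 0 <= M ->
  (forall y, 0 < y -> y <= d -> `|f y - l| <= M * y) ->
  lim0 (fun y => (f y)%:C%C : C) (l%:C%C).
Proof.
move=> d0 M0 H; exists d, M; split=> // y y0 yd.
by rewrite -(rmorphB (real_complex R)) normrZC H.
Qed.

Lemma two_pi_gt0 : 0 < 2 * pi :> R. Proof. by rewrite mulr_gt0// pi_gt0. Qed.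

Lemma ee_iy_lim n : lim0 (fun y : R => ee (iy y) ^+ n : C) 1.
Proof.
have base : lim0 (fun y => ee (iy y) : C) 1.
  apply: lim0_ext; last first.
    apply: (@lim0_real (fun y => expR (- (2 * pi * y))) 1 (expR 1 * (2 * pi)) (2 * pi)^-1).
    - by rewrite invr_gt0 two_pi_gt0.
    - by rewrite mulr_ge0 ?expR_ge0// ltW// two_pi_gt0.
    move=> y y0 yd; have y1 : `|- (2 * pi * y)| <= 1.
      rewrite normrN ger0_norm; last by rewrite mulr_ge0// ltW// two_pi_gt0.
      by rewrite -ler_pdivlMl ?two_pi_gt0// mulr1.
    have [H _ _] := expR_taylor y1; apply: le_trans H _.
    by rewrite normrN ger0_norm ?mulrA// mulr_ge0// ltW// two_pi_gt0.
  by exists 1 => // y _ _; rewrite ee_iy.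
elim: n => [|n IH]; first exact: lim0_cst.
have := lim0M base IH; rewrite mulr1; apply: lim0_ext.
by exists 1 => // y _ _; rewrite exprS.
Qed.

(** The Lipschitz formula starts at weight 2, so this case comes from the geometric series: the
    function is v/(1 - v) - 1/u with u = 2 pi y and v = e^(-u). The radius [d] guarantees 1 - v >=
    u/2. *)
Lemma Tser0_lim : lim0 (fun y => Tser 0 (iy y) - 1 - (tau2 y)^-1) (- 2^-1).
Proof.
have p0 := two_pi_gt0.
pose K : R := expR 1.
have K0 : 0 < K by exact: expR_gt0.
pose f (y : R) := expR (- (2 * pi * y)) / (1 - expR (- (2 * pi * y))) - (2 * pi * y)^-1.
pose d := (2 * (1 + K))^-1 / (2 * pi).
have d0 : 0 < d by rewrite divr_gt0// invr_gt0 mulr_gt0// addr_gt0.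
have half : (- 2^-1 : C) = ((- 2^-1)%:C)%C by rewrite (rmorphN (real_complex R)) /= realCV -natC.
rewrite half; apply: lim0_ext; last first.
  apply: (@lim0_real f (- 2^-1) ((2^-1 + 3 * K) * (2 * pi)) d) => //.
    by rewrite mulr_ge0 ?(ltW p0)// addr_ge0// mulr_ge0// ltW.
  move=> y y0 yd; rewrite /f; set u := 2 * pi * y.
  have u0 : 0 < u by rewrite mulr_gt0.
  have ud : u * (1 + K) <= 2^-1.
    have : u <= (2 * (1 + K))^-1.
      by rewrite /u mulrC -ler_pdivlMr.
    by rewrite invfM ler_pdivlMr// addr_gt0.
  have u1 : `|- u| <= 1 by rewrite normrN gtr0_norm//; nra.
  have [_ E1 E2] := expR_taylor u1.
  rewrite normrN (gtr0_norm u0) -/K in E1 E2.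
  set v := expR (- u) in E1 E2 *.
  pose r := v - 1 - - u - (- u) ^+ 2 / 2.
  have vE : v = 1 - u + u ^+ 2 / 2 + r by rewrite /r; field.
  have low : u / 2 <= 1 - v.
    move: E1; rewrite ler_norml => /andP[_]; nra.
  have v1 : 0 < 1 - v by apply: lt_le_trans low; rewrite divr_gt0.
  have -> : v / (1 - v) - u^-1 - - 2^-1 = (u ^+ 3 / 2 + u * r + 2 * r) / (2 * u * (1 - v)).
    have -> : u ^+ 3 / 2 + u * r + 2 * r = u * (1 + v) - 2 * (1 - v) by rewrite [in RHS]vE; field.
    have aux (u' v' : R) : u' != 0 -> 1 - v' != 0 -> v' / (1 - v') - u'^-1 - - 2^-1 =
        (u' * (1 + v') - 2 * (1 - v')) / (2 * u' * (1 - v')).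
      by move=> un vn; field; rewrite ?un ?vn.
    by rewrite aux// gt_eqF.
  have den : 0 < 2 * u * (1 - v) := mulr_gt0 (mulr_gt0 (ltr0Sn R 1) u0) v1.
  rewrite normrM normfV (gtr0_norm den) ler_pdivrMr//.
  apply: (@le_trans _ _ (u ^+ 3 * (2^-1 + 3 * K))).
    apply: le_trans (ler_normD _ _) _; rewrite [leRHS]mulrDr.
    have r3 : `|r| <= K * u ^+ 3 by exact: E2.
    have n3 : 0 <= u ^+ 3 by rewrite exprn_ge0// ltW.
    have -> : u ^+ 3 * 2^-1 + u ^+ 3 * (3 * K) = (u ^+ 3 / 2 + K * u ^+ 3) + 2 * (K * u ^+ 3) by ring.
    apply: lerD; last by rewrite normrM gtr0_norm// ler_wpM2l.
    apply: le_trans (ler_normD _ _) _; rewrite ger0_norm ?divr_ge0// lerD2l.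
    rewrite normrM (gtr0_norm u0) -[leRHS]mul1r ler_pM// ?(ltW u0)//.
    by move: u1; rewrite normrN gtr0_norm.
  have -> : (2^-1 + 3 * K) * (2 * pi) * y * (2 * u * (1 - v)) =
     u * (2^-1 + 3 * K) * (2 * u * (1 - v)) by rewrite /u; ring.
  have Kp : 0 <= 2^-1 + 3 * K by rewrite addr_ge0// mulr_ge0// ltW.
  have -> : u ^+ 3 * (2^-1 + 3 * K) = u * (2^-1 + 3 * K) * u ^+ 2 by ring.
  apply: (ler_wpM2l (mulr_ge0 (ltW u0) Kp)).
  have -> : u ^+ 2 = 2 * u * (u / 2) by rewrite -mulrA mulrCA [2 * (u / 2)]mulrCA divff// mulr1 expr2.
  exact: (ler_wpM2l (mulr_ge0 (ler0n R 2) (ltW u0))).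
exists d => // y y0 yd; have yi : 0 < im (iy y) by [].
have -> : Tser 0 (iy y) = (1 - ee (iy y))^-1.
  rewrite -geometric_sum ?ee_lt1// Tser.unlock; congr sum.
  by apply/funext => m; rewrite expn0 mul1r.
have u1 := sub1_neq0 (ee_lt1 yi).
rewrite ee_iy in u1 *; rewrite /f.
set v := expR _ in u1 *.
rewrite (rmorphB (real_complex R)) (rmorphM (real_complex R)) /= !realCV rmorphB /=.
congr (_ - _); have c1 : ((1%:C)%C : C) = 1 by [].
by rewrite c1; field; rewrite u1.
Qed.

Lemma is_derive_divided_power n (x : R) :
  is_derive x (1 : R) (fun t : R => t ^+ n.+1 / (n.+1)`!%:R) (x ^+ n / n`!%:R).
Proof.
have H := @is_deriveX _ _ (fun t : R => t) n.+1 x 1 1 (is_derive_id x (1:R)).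
have H' := @is_deriveZ _ _ _ _ ((n.+1)`!%:R^-1) x 1 _ H.
have E : ((n.+1)`!%:R^-1 \*: ((fun t : R => t) ^+ n.+1)) = (fun t : R => t ^+ n.+1 / (n.+1)`!%:R).
  by apply/funext => t /=; rewrite !fctE /GRing.scale /= mulrC.
rewrite -E; apply: (is_derive_eq H').
have f0 : (n`!%:R : R) != 0 by rewrite pnatr_eq0 -lt0n fact_gt0.
have s0 : (n.+1%:R : R) != 0 by rewrite pnatr_eq0.
rewrite /GRing.scale /= factS natrM.
move: f0 s0; move: (n`!%:R : R) (n.+1%:R : R) => F s f0 s0.
by field; rewrite f0 s0.
Qed.

(** For the truncated exponential P, (e^(-x) P(x))' = -e^(-x) x^a/a!; hence the expression bounded
    here has derivative (1 - e^(-x)) x^a/a!, of order a + 1 at 0. *)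
Lemma exp_partial_sum (a : nat) : exists2 K : R, 0 <= K & forall x : R, `|x| <= 1 ->
  `|expR (- x) * (\sum_(i < a.+1) x ^+ i / i`!%:R) - 1 + x ^+ a.+1 / (a.+1)`!%:R| <= K * `|x| ^+ a.+2.
Proof.
pose P b (x : R) := \sum_(i < b) x ^+ i / i`!%:R.
have dP b (x : R) : is_derive x (1 : R) (P b.+1) (P b x).
  elim: b => [|b IH].
    have -> : P 1 = fun=> 1 by apply/funext => t; rewrite /P big_ord1 expr0 divr1.
    by rewrite /P big_ord0; exact: is_derive_cst.
  have PS c : P c.+1 = fun t => P c t + t ^+ c / c`!%:R.
    by apply/funext => t; rewrite /P big_ord_recr.
  rewrite (PS b.+1); have -> : P b.+1 x = P b x + x ^+ b / b`!%:R by rewrite PS.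
  exact: is_deriveD IH (is_derive_divided_power b x).
exists (expR 1 / a`!%:R); first by rewrite divr_ge0// expR_ge0.
apply: (@ivt_bound R _ (fun x => x ^+ a / a`!%:R * (1 - expR (- x)))) => [x||x x1].
- have dE : is_derive x (1 : R) (fun x => expR (- x) : R) (- expR (- x)).
    by apply: is_derive_eq; rewrite /GRing.scale /=; ring.
  have dQ := is_derive_divided_power a x.
  have dM := is_deriveM dE (dP a x).
  apply: (is_derive_eq (is_deriveD (is_deriveB dM (is_derive_cst (1 : R) x (1 : R))) dQ)).
  rewrite /GRing.scale /= subr0 /P big_ord_recr /=; ring.
- rewrite oppr0 expR0 mul1r big_ord_recl big1 => [|i _]; last by rewrite /= exprS !mul0r.
  by rewrite expr0 divr1 addr0 subrr exprS !mul0r addr0.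
- rewrite 2!normrM normrX normfV normr_nat [X in _ <= _ * X]exprSr.
  have x1' : `|- x| <= 1 by rewrite normrN.
  have [H _ _] := expR_taylor x1'; rewrite normrN in H.
  rewrite distrC; have := ler_wpM2l (divr_ge0 (exprn_ge0 a (normr_ge0 x)) (ler0n R a`!)) H.
  by move/le_trans; apply; rewrite le_eqVlt; apply/orP; left; apply/eqP; ring.
Qed.

End Faulhaber.

Section FaulhaberFormula.
Variable R : realType.
Local Notation C := (Rcomplex R).
Local Notation cn := (@Num.norm
  (Num_RealClosedField__to__Num_POrderedZmodule (reals_Real__to__Num_RealClosedField R))
  (complex_Rcomplex__canonical__Num_SemiNormedZmodule (reals_Real__to__Num_RealClosedField R))).
Local Notation re := (@complex.Re R).
Local Notation im := (@complex.Im R).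
Local Notation beta := (zeta_neg R).
Local Notation zeta := (zeta_at_neg R).
Local Notation tau2 y := ((2 * pi * y)%:C%C : C).

Lemma realCX (r : R) n : (((r ^+ n)%:C)%C : C) = ((r%:C)%C : C) ^+ n.
Proof. by rewrite (rmorphXn (real_complex R)). Qed.

Lemma sum_nat_shiftn n (f : nat -> C) : abs_summable f ->
  sum f = \sum_(i < n) f i + sum (fun m => f (n + m)%N).
Proof.
elim: n f => [|n IH] f fs.
  by rewrite big_ord0 add0r.
rewrite sum_nat_shift// IH; last by apply: (@abs_summable_reindex _ _ _ S f) => // ? ? [].
by rewrite big_ord_recl addrA.
Qed.

(** Takes away the term m = 0, which is nonzero for j = 0 only, and leaves a sum over m >= 1. *)
Definition Tser_pos j y : C := Tser j (iy y) - (j == 0)%:R.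

Lemma Tser_posE j y : 0 < y ->
  has_sum (fun m : nat => m.+1%:R ^+ j * ee (iy y) ^+ m.+1 : C) (Tser_pos j y).
Proof.
move=> y0; have yi : 0 < im (iy y) by [].
have s := summable_Tser j yi.
have s' : abs_summable (fun m : nat => (m.+1 ^ j)%:R * ee (iy y) ^+ m.+1 : C).
  by apply: (@abs_summable_reindex _ _ _ S _) s => // ? ? [].
have -> : Tser_pos j y = sum (fun m : nat => (m.+1 ^ j)%:R * ee (iy y) ^+ m.+1).
  rewrite /Tser_pos Tser.unlock sum_nat_shift// expr0 mulr1.
  have -> : (0 ^ j = (j == 0))%N by case: j {s s'} => [|j] //; rewrite exp0n.
  by rewrite addrAC subrr add0r.
by apply: eq_has_sum (abs_has_sum s') => m; rewrite natrX.
Qed.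

Lemma Tser_pos_lim j :
  lim0 (fun y => Tser_pos j y - j`!%:R * tau2 y ^- j.+1) (zeta j).
Proof.
case: j => [|j].
  apply: lim0_ext (@Tser0_lim R); exists 1 => // y _ _.
  by rewrite /Tser_pos eqxx fact0 expr1 mul1r.
apply: lim0_ext (@Tser_lim R j); exists 1 => // y _ _.
by rewrite /Tser_pos subr0.
Qed.

(** The sum of (n + m)^a v^(n + m) over m >= 1, computed by the binomial theorem on one side and as
    a tail on the other. *)
Lemma Tser_pos_shift a n y : 0 < y ->
  ee (iy y) ^+ n * (\sum_(j < a.+1) 'C(a, j)%:R * n%:R ^+ (a - j) * Tser_pos j y) =
  Tser_pos a y - \sum_(k < n) k.+1%:R ^+ a * ee (iy y) ^+ k.+1.
Proof.
move=> y0; set v := ee (iy y).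
have sA : abs_summable (fun m : nat => m.+1%:R ^+ a * v ^+ m.+1).
  have := @abs_summable_reindex R nat nat S (fun m : nat => (m ^ a)%:R * v ^+ m)
    succn_inj (@summable_Tser R a (iy y) y0).
  by apply: abs_summable_le => m /=; rewrite natrX.
have -> : Tser_pos a y = sum (fun m : nat => m.+1%:R ^+ a * v ^+ m.+1).
  exact/esym/sumP/Tser_posE.
rewrite (sum_nat_shiftn n sA) addrC addrA addNr add0r.
have H : has_sum (fun m : nat => v ^+ n * \sum_(j < a.+1) 'C(a, j)%:R * n%:R ^+ (a - j) *
   (m.+1%:R ^+ j * v ^+ m.+1))
  (v ^+ n * (\sum_(j < a.+1) 'C(a, j)%:R * n%:R ^+ (a - j) * Tser_pos j y)).
  by apply/has_sumZ/has_sum_bigop => j _; apply/has_sumZ/Tser_posE.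
rewrite -(sumP H); congr sum; apply/funext => m.
have -> : (n + m).+1%:R = n%:R + m.+1%:R :> C by rewrite -natrD addnS.
rewrite exprDn -addnS exprD mulrCA; congr (_ * _).
rewrite mulr_suml; apply: eq_bigr => j _.
by rewrite -mulr_natl; ring.
Qed.

(** With u = 2 pi y the polar parts add up to a! u^(-a-1) times the truncated exponential of n u.
    Multiplied by e^(-n u), that exponential is 1 - (n u)^(a+1)/(a+1)! to leading order, which gives
    the limit. *)
Lemma pole_lim a n :
  lim0 (fun y => ee (iy y) ^+ n *
      (\sum_(j < a.+1) 'C(a, j)%:R * n%:R ^+ (a - j) * (j`!%:R * tau2 y ^- j.+1)) -
      a`!%:R * tau2 y ^- a.+1)
    (- (n%:R ^+ a.+1 / a.+1%:R)).
Proof.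
have p0 := two_pi_gt0 R; have [K K0 HK] := exp_partial_sum R a.
have af : (a`!%:R : R) != 0 by rewrite pnatr_eq0 -lt0n fact_gt0.
have a1 : (a.+1%:R : R) != 0 by rewrite pnatr_eq0.
pose f (y : R) : R := a`!%:R / (2 * pi * y) ^+ a.+1 *
  (expR (- (n%:R * (2 * pi * y))) * (\sum_(i < a.+1) (n%:R * (2 * pi * y)) ^+ i / i`!%:R) - 1).
(* Ensures n u <= 1, the range of [exp_partial_sum]; n + 1 replaces n to allow n = 0. *)
pose d : R := n.+1%:R^-1 / (2 * pi).
have d0 : 0 < d by rewrite divr_gt0// invr_gt0 ltr0n.
have lC : (- (n%:R ^+ a.+1 / a.+1%:R) : C) = ((- (n%:R ^+ a.+1 / a.+1%:R))%:C)%C.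
  by rewrite (rmorphN (real_complex R)) (rmorphM (real_complex R)) /= realCV realCX -!natC.
rewrite lC; apply: lim0_ext; last first.
  apply: (@lim0_real R f _ (a`!%:R * K * n%:R ^+ a.+2 * (2 * pi)) d) => //.
    exact: mulr_ge0 (mulr_ge0 (mulr_ge0 (ler0n R _) K0) (exprn_ge0 _ (ler0n R _))) (ltW p0).
  move=> y y0 yd; rewrite /f; have [u uE] : exists u, u = 2 * pi * y by exists (2 * pi * y).
  rewrite -uE; have u0 : 0 < u by rewrite uE mulr_gt0.
  have nu0 : 0 <= n%:R * u := mulr_ge0 (ler0n R n) (ltW u0).
  have nu1 : `|n%:R * u| <= 1.
    rewrite (ger0_norm nu0).
    have : u <= n.+1%:R^-1 by rewrite uE mulrC -ler_pdivlMr.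
    move=> h; apply: (@le_trans _ _ (n.+1%:R * u)).
      by rewrite ler_wpM2r ?(ltW u0)// ler_nat.
    by rewrite mulrC -ler_pdivlMr ?ltr0n// mul1r.
  have := HK _ nu1; set X := _ - 1; set P := (n%:R * u) ^+ a.+1 / (a.+1)`!%:R.
  have -> : a`!%:R / u ^+ a.+1 * X - - (n%:R ^+ a.+1 / a.+1%:R) =
     a`!%:R / u ^+ a.+1 * (X + P).
    rewrite /P factS natrM exprMn [RHS]mulrDr opprK; congr (_ + _).
    have := expf_neq0 a.+1 (lt0r_neq0 u0).
    move: (u ^+ a.+1) af a1 (n%:R ^+ a.+1 : R) => w; move: (a`!%:R : R) (a.+1%:R : R) => F s f0 s0 N w0.
    by field; rewrite ?f0 ?s0 ?w0.
  have au0 : 0 <= a`!%:R / u ^+ a.+1 := divr_ge0 (ler0n R _) (exprn_ge0 a.+1 (ltW u0)).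
  rewrite (ger0_norm nu0) => h; rewrite normrM (ger0_norm au0).
  apply: le_trans (ler_wpM2l au0 h) _.
  have -> : a`!%:R / u ^+ a.+1 * (K * (n%:R * u) ^+ a.+2) = a`!%:R * K * n%:R ^+ a.+2 * u.
    have aux (F w N K' u' : R) : w != 0 -> F / w * (K' * (N * (u' * w))) = F * K' * N * u'.
      by move=> w0; field.
    by rewrite exprMn (exprS u a.+1) aux// expf_neq0// gt_eqF.
  by rewrite uE le_eqVlt; apply/orP; left; apply/eqP; ring.
exists 1 => // y y0 _; rewrite /f; have [u uE] : exists u, u = 2 * pi * y by exists (2 * pi * y).
rewrite -uE; have u0 : u != 0 by rewrite uE gt_eqF// mulr_gt0.
have uC : ((u%:C)%C : C) != 0 by rewrite -normr_eq0 normrZC normr_eq0.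
rewrite (rmorphM (real_complex R)) rmorphB rmorphM rmorphM rmorph_sum /= realCV realCX -natC.
have -> : ((1%:C)%C : C) = 1 by [].
have -> : ((expR (- (n%:R * u)))%:C)%C = ee (iy y) ^+ n.
  by rewrite ee_iy -realCX -expRM_natl mulrN uE.
rewrite mulrBr mulr1; congr (_ - _); rewrite mulrCA; congr (_ * _).
rewrite [in RHS](reindex_inj rev_ord_inj) /= mulr_sumr; apply: eq_bigr => i _.
have ia : (i <= a)%N by rewrite -ltnS.
rewrite subSS (rmorphM (real_complex R)) /= realCV realCX (rmorphM (real_complex R)) /= -!natC subKn//.
have fi : (i`!%:R : C) != 0 by rewrite -normr_eq0 cnorm_nat pnatr_eq0 -lt0n fact_gt0.
have -> : ('C(a, a - i)%:R * n%:R ^+ i * ((a - i)`!%:R * ((u%:C)%C : C) ^- (a - i).+1)) =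
    ('C(a, a - i) * (a - i)`!)%:R * n%:R ^+ i * ((u%:C)%C : C) ^- (a - i).+1.
  by rewrite natrM; ring.
have -> : ('C(a, a - i) * (a - i)`!)%:R = a`!%:R / i`!%:R :> C.
  apply: (mulIf fi); rewrite divfK// -natrM; congr _%:R.
  by rewrite bin_sub// -mulnA [((a - i)`! * _)%N]mulnC bin_fact.
have -> : ((u%:C)%C : C) ^+ a.+1 = ((u%:C)%C : C) ^+ (a - i).+1 * ((u%:C)%C : C) ^+ i.
  by rewrite -exprD addSn subnK.
rewrite exprMn; move: (expf_neq0 (a - i).+1 uC) (expf_neq0 i uC).
move: (((u%:C)%C : C) ^+ (a - i).+1) (((u%:C)%C : C) ^+ i) fi => w1 w2.
move: (a`!%:R : C) (i`!%:R : C) (n%:R ^+ i : C) => A I N I0 w10 w20.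
by field; rewrite ?I0 ?w10 ?w20.
Qed.

(** Limit of [Tser_pos_shift] as y tends to 0, with the polar parts subtracted on both sides: each
    series becomes zeta(-j), and the polar parts leave n^(a+1)/(a+1). *)
Theorem Faulhaber a n :
  \sum_(j < a.+1) 'C(a, j)%:R * n%:R ^+ (a - j) * zeta j =
  zeta a - \sum_(k < n) k.+1%:R ^+ a + n%:R ^+ a.+1 / a.+1%:R.
Proof.
have H1 : lim0 (fun y => ee (iy y) ^+ n *
   (\sum_(j < a.+1) 'C(a, j)%:R * n%:R ^+ (a - j) * (Tser_pos j y - j`!%:R * tau2 y ^- j.+1)))
   (1 * \sum_(j < a.+1) 'C(a, j)%:R * n%:R ^+ (a - j) * zeta j).
  apply: lim0M; first exact: ee_iy_lim.
  by apply: lim0_bigop => j; apply/lim0Z/Tser_pos_lim.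
have H2 := lim0D H1 (pole_lim a n).
have H3 : lim0 (fun y => \sum_(k < n) k.+1%:R ^+ a * ee (iy y) ^+ k.+1 : C)
    (\sum_(k < n) k.+1%:R ^+ a * 1).
  by apply: lim0_bigop => k; apply/lim0Z/ee_iy_lim.
have H4 := lim0D (Tser_pos_lim a) (lim0Z (-1) H3).
have : 1 * (\sum_(j < a.+1) 'C(a, j)%:R * n%:R ^+ (a - j) * zeta j) +
    - (n%:R ^+ a.+1 / a.+1%:R) = zeta a + -1 * \sum_(k < n) k.+1%:R ^+ a * 1.
  apply: lim0_uniq H2 _; apply: lim0_ext H4; exists 1 => // y y0 _.
  have -> : Tser_pos a y = ee (iy y) ^+ n * (\sum_(j < a.+1) 'C(a, j)%:R * n%:R ^+ (a - j) * Tser_pos j y)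
     + \sum_(k < n) k.+1%:R ^+ a * ee (iy y) ^+ k.+1.
    by rewrite Tser_pos_shift// subrK.
  have -> : \sum_(j < a.+1) 'C(a, j)%:R * n%:R ^+ (a - j) * (Tser_pos j y - j`!%:R * tau2 y ^- j.+1)
    = \sum_(j < a.+1) 'C(a, j)%:R * n%:R ^+ (a - j) * Tser_pos j y -
      \sum_(j < a.+1) 'C(a, j)%:R * n%:R ^+ (a - j) * (j`!%:R * tau2 y ^- j.+1).
    by rewrite -sumrB; apply: eq_bigr => j _; ring.
  by ring.
under [X in _ + -1 * X]eq_bigr do rewrite mulr1.
by rewrite mul1r mulN1r => /eqP; rewrite subr_eq => /eqP.
Qed.

(** Dropping zeta(0) = -1/2 on the left, with N = n + 1, adds N^a/2 there; this halves the last term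
    of the power sum. *)
Lemma Faulhaber_odd a n :
  \sum_(j < a.+1) 'C(a, j)%:R * n.+1%:R ^+ (a - j) * beta j =
  zeta a - n.+1%:R ^+ a / 2 - \sum_(k < n) k.+1%:R ^+ a + n.+1%:R ^+ a.+1 / a.+1%:R.
Proof.
have c2 := natC_neq0 R 1.
have := Faulhaber a n.+1; rewrite big_ord_recl bin0 mul1r subn0 /zeta_at_neg eqxx.
rewrite [X in _ - X]big_ord_recr /= => H.
rewrite big_ord_recl bin0 mul1r subn0 (@zeta_neg_even R 0)// mulr0 add0r.
set S := \sum_(i < a) _.
rewrite (_ : \sum_(i < a) _ = S) in H; last exact: eq_bigr.
move: H; clearbody S.
set z := if _ then _ else _; set T := \sum_(k < n) _.
set N := n.+1%:R ^+ a; set Q := _ / _ => H.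
have -> : S = (N * - 2^-1 + S) + N / 2 by field.
by rewrite H; field.
Qed.

End FaulhaberFormula.

(** * Euler's recursion through truncated generating functions *)

Section EulerIdentity.
Variable R : realType.
Local Notation C := (Rcomplex R).
Local Notation beta := (zeta_neg R).

Lemma dvdXn_coef (F : fieldType) n (p : {poly F}) :
  dvdp 'X^n p <-> forall i, (i < n)%N -> p`_i = 0.
Proof.
split=> [/dvdpP[q ->] i ilt|H]; first by rewrite coefMXn ilt.
rewrite -(poly_take_drop n p).
have -> : take_poly n p = 0.
  by apply/polyP => i; rewrite coef_take_poly coef0; case: ifP => // /H.
by rewrite add0r dvdp_mull.
Qed.

Lemma dvdXn_deriv (F : fieldType) n (p : {poly F}) : dvdp 'X^(n.+1) p -> dvdp 'X^n p^`().
Proof.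
move=> /dvdXn_coef H; apply/dvdXn_coef => i ilt.
by rewrite coef_deriv H ?mul0rn.
Qed.

Lemma factC_neq0 n : (n`!%:R : C) != 0.
Proof. by rewrite -normr_eq0 cnorm_nat pnatr_eq0 -lt0n fact_gt0. Qed.

Lemma binC_fact n m : (m <= n)%N -> 'C(n, m)%:R = n`!%:R / (m`!%:R * (n - m)`!%:R) :> C.
Proof.
move=> mn; have h : (m`!%:R * (n - m)`!%:R : C) != 0 by rewrite mulf_neq0 ?factC_neq0.
by apply: (mulIf h); rewrite divfK// -!natrM bin_fact.
Qed.

(** [Faulhaber_odd] at argument 1, where the terms of index a on both sides cancel. *)
Lemma beta_recursion a : (0 < a)%N ->
  \sum_(j < a) 'C(a, j)%:R * beta j = a.+1%:R^-1 - 2^-1.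
Proof.
case: a => // a _; have := Faulhaber_odd R a.+1 0.
rewrite big_ord_recr /= binn subnn expr0 !mulr1 mul1r big_ord0 subr0.
rewrite /zeta_at_neg /= !expr1n !mul1r.
under eq_bigr do rewrite expr1n mulr1.
set S := \sum_(j < _) _; set b := beta _; set x := _^-1; set y := _^-1 => H.
have -> : S = (S + b) - b by ring.
by rewrite H; ring.
Qed.

(** For E = e^X the relation T = 0 is the generating form of [beta_recursion], and [T'] is the
    derivative of [T]. The right side is built from E' - E, T and T', all of high order at X = 0,
    which forces the Riccati expression on the left to be of high order too. *)
Lemma Riccati_identity (A : comNzRingType) (X E E' B B' : A) :
  let c := 1 - X * B in
  let T := 2 * (E - 1) * c - X * (E + 1) in
  let T' := 2 * E' * c - 2 * (E - 1) * (B + X * B') - (E + 1) - X * E' in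
  (E - 1) * (X ^+ 2 + 8 * X * B - 4 * X ^+ 2 * B ^+ 2 + 4 * X ^+ 2 * B') =
  (E' - E) * (4 * X * c - 2 * X ^+ 2) - 2 * c * T - 2 * X * T' + 2 * T + X * T.
Proof. by move=> c T T'; rewrite /T' /T /c; ring. Qed.

Lemma deriv_Riccati (F : fieldType) (P Q : {poly F}) :
  (2 * (P - 1) * (1 - 'X * Q) - 'X * (P + 1))^`() =
  2 * P^`() * (1 - 'X * Q) - 2 * (P - 1) * (Q + 'X * Q^`()) - (P + 1) - 'X * P^`().
Proof.
have two (p : {poly F}) : 2 * p = 2 *: p by rewrite scaler_nat mulr_natl.
have d1 : (1 : {poly F})^`() = 0 by rewrite -polyC1 derivC.
rewrite two !(poly.derivE, d1) -!two.
by move: (P^`()) (Q^`()) => P' Q'; ring.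
Qed.

(* Coefficientwise, (e^z - 1)(1 - z beta(z)) = z (e^z + 1) / 2; differentiating
   it shows that (e^z - 1) annihilates the Riccati equation of (coth (z/2)) / 2. *)
Lemma Euler_zeta b : (0 < b)%N ->
  \sum_(j < b.+1) 'C(b, j)%:R * beta j * beta (b - j) = b.+3%:R / b.+1%:R * beta b.+1.
Proof.
(* One order is lost in differentiating [T] and one in dividing by X, which still leaves coefficient
   b + 2 of [kappa] equal to 0. *)
move=> b0; pose K := b.+4.+1.
pose E : {poly C} := \poly_(i < K.+1) (i`!%:R)^-1.
pose B : {poly C} := \poly_(i < K.+1) (beta i / i`!%:R).
pose c := 1 - 'X * B.
pose T := 2 * (E - 1) * c - 'X * (E + 1).
have E0 : E`_0 = 1 by rewrite coef_poly fact0 invr1.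
have E1B a : (0 < a)%N -> (a < K)%N ->
    ((E - 1) * B)`_a = (a`!%:R)^-1 * (a.+1%:R^-1 - 2^-1).
  move=> a0 aK; rewrite coefMr big_ord_recr /= subnn coefB E0 coef1 subrr mul0r addr0.
  rewrite -beta_recursion// mulr_sumr; apply: eq_bigr => j _.
  have ja : (j < K.+1)%N by apply: ltn_trans (ltn_ord j) (ltnW _).
  rewrite coefB coef1 subn_eq0 leqNgt ltn_ord subr0 !coef_poly ja.
  have -> : (a - j < K.+1)%N by rewrite (leq_ltn_trans (leq_subr _ _))// ltnW.
  rewrite binC_fact; last exact: ltnW.
  have := factC_neq0 a; have := factC_neq0 j; have := factC_neq0 (a - j).
  move: (a`!%:R : C) (j`!%:R : C) ((a - j)`!%:R : C) => x y z z0 y0 x0.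
  by field; rewrite ?x0 ?y0 ?z0.
have E1B0 : ((E - 1) * B)`_0 = 0 by rewrite coefM big_ord1 coefB E0 coef1 subrr mul0r.
have two (p : {poly C}) : 2 * p = 2 *: p by rewrite scaler_nat mulr_natl.
have HT : dvdp 'X^K T.
  apply/dvdXn_coef => i iK.
  have -> : T = 2 *: ((E - 1) - 'X * ((E - 1) * B)) - 'X * (E + 1).
    by rewrite -two /T /c; ring.
  rewrite coefB coefZ coefB !coefXM coefB coef1.
  case: i iK => [|a] iK /=; first by rewrite E0 subrr !subr0 mulr0.
  rewrite subr0 coefD coef1 !coef_poly.
  have -> : (a.+1 < K.+1)%N by apply: ltnW.
  have -> : (a < K.+1)%N by apply: ltnW; apply: ltnW.
  have c2 := natC_neq0 R 1.
  case: a iK => [|a] iK.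
    by rewrite E1B0 fact0 (factS 0) fact0 muln1 invr1 subr0 mulr1 eqxx /=; ring.
  rewrite E1B//; last exact: ltnW.
  rewrite /= addr0 (factS a.+1) natrM.
  have := factC_neq0 a.+1; have := natC_neq0 R a.+1.
  move: ((a.+1)`!%:R : C) (a.+2%:R : C) => x y y0 x0.
  by field; rewrite ?x0 ?y0 ?c2.
have HT' : dvdp 'X^(b.+4) T^`() by apply: dvdXn_deriv.
have HE : dvdp 'X^(b.+4) (E^`() - E).
  apply/dvdXn_coef => i iK; rewrite coefB coef_deriv -mulr_natl !coef_poly.
  have iK1 : (i.+1 < K.+1)%N by rewrite ltnS; apply: ltnW.
  rewrite iK1 (ltnW iK1) factS natrM.
  have := factC_neq0 i; have := natC_neq0 R i.
  move: (i`!%:R : C) (i.+1%:R : C) => x y y0 x0.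
  by field; rewrite ?x0 ?y0.
pose kappa : {poly C} := 'X ^+ 2 + 8 * 'X * B - 4 * 'X ^+ 2 * B ^+ 2 +
    4 * 'X ^+ 2 * B^`().
have T'E : T^`() = 2 * E^`() * c - 2 * (E - 1) * (B + 'X * B^`()) - (E + 1) - 'X * E^`().
  exact: deriv_Riccati.
have main : (E - 1) * kappa = (E^`() - E) * (4 * 'X * c - 2 * 'X ^+ 2) - 2 * c * T
     - 2 * 'X * T^`() + 2 * T + 'X * T.
  by rewrite T'E -Riccati_identity.
have wK : dvdp 'X^(b.+4) ('X^K : {poly C}) by rewrite dvdp_exp2l.
have HT3 := dvdp_trans wK HT.
have dk : dvdp 'X^(b.+4) ((E - 1) * kappa).
  rewrite main; apply: dvdp_add; last exact: dvdp_mull HT3.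
  apply: dvdp_add; last exact: dvdp_mull HT3.
  apply: dvdp_sub; last exact: dvdp_mull HT'.
  by apply: dvdp_sub; [exact: dvdp_mulr|exact: dvdp_mull HT3].
have [U UE] : exists U, E - 1 = 'X * U.
  have E10 : (E - 1)`_0 = 0 by rewrite coefB E0 coef1 subrr.
  exists (drop_poly 1 (E - 1)); rewrite -{1}(poly_take_drop 1 (E - 1)) mulrC expr1.
  suff -> : take_poly 1 (E - 1) = 0 by rewrite add0r.
  apply/polyP => i; rewrite coef_take_poly coef0; case: i => [|i] //=; exact: E10.
have U0 : ~~ root U 0.
  have := congr1 (fun p : {poly C} => p`_1) UE; rewrite coefXM coefB coef1 subr0 coef_poly /=.
  by rewrite (factS 0) fact0 muln1 invr1 rootE -horner_coef0 => <-; exact: oner_neq0.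
have {dk}dk : 'X^(b.+4) %| 'X * (U * kappa) by rewrite mulrA -UE.
have {dk}dk : 'X^(b.+3) %| U * kappa.
  by move: dk; rewrite exprS dvdp_mul2l// polyX_eq0.
have cop : coprimep ('X^(b.+3) : {poly C}) U.
  by rewrite coprimep_expl//; have := coprimep_XsubC U 0; rewrite subr0 coprimep_sym => ->.
have {dk}dk : 'X^(b.+3) %| kappa by rewrite -(Gauss_dvdpr _ cop).
have /dvdXn_coef/(_ b.+2 (leqnn _)) := dk.
have num n (p : {poly C}) : n%:R * p = n%:R *: p by rewrite scaler_nat mulr_natl.
have -> : kappa = 'X^2 + 8 *: ('X^1 * B) - 4 *: ('X^2 * (B * B)) + 4 *: ('X^2 * B^`()).
  by rewrite -!num expr1 /kappa; ring.
rewrite coefD coefB coefD !coefZ !coefXnM coefXn coef_deriv /=.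
rewrite (_ : b.+2 - 1 = b.+1)%N ?subn1// (_ : b.+2 - 2 = b)%N ?subn2//.
(* The summand X^2 of [kappa] is not seen in this coefficient, because b > 0. *)
rewrite (_ : (b.+2 == 2)%N = false) ?eqSS ?gtn_eqF// add0r.
rewrite coefM coef_poly (_ : (b.+1 < K.+1)%N); last by rewrite /K !ltnS; lia.
set s := \sum_(j < b.+1) _ * _.
have -> : \sum_(j < b.+1) 'C(b, j)%:R * beta j * beta (b - j) = b`!%:R * s.
  rewrite /s mulr_sumr; apply: eq_bigr => j _.
  have jb : (j <= b)%N by rewrite -ltnS.
  rewrite binC_fact// !coef_poly.
  have -> : (j < K.+1)%N by rewrite /K; lia.
  have -> : (b - j < K.+1)%N by rewrite /K; lia.
  have := factC_neq0 j; have := factC_neq0 (b - j).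
  move: (j`!%:R : C) ((b - j)`!%:R : C) => x y y0 x0.
  by field; rewrite ?x0 ?y0.
rewrite -mulr_natl factS natrM => H.
have -> : s = (b.+1%:R + 2) * (beta b.+1 / (b.+1%:R * b`!%:R)).
  have c4 := natC_neq0 R 3; apply: (mulfI c4); apply/eqP; rewrite -subr_eq0 -oppr_eq0.
  by rewrite -H; apply/eqP; ring.
have -> : b.+3%:R = b.+1%:R + 2 :> C by rewrite -natrD addn2.
have := factC_neq0 b; have := natC_neq0 R b.
move: (b`!%:R : C) (b.+1%:R : C) => x y y0 x0.
by field; rewrite ?x0 ?y0.
Qed.

End EulerIdentity.

(** * q-series of the Eisenstein series *)

(** For mn nonzero this is half of sgn(m) + sgn(n), hence symmetric in m and n. *)
Definition int_eps (m n : int) : int := if 0 < m * n then sgz m else 0.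

Definition qterm (R : realType) (a b : nat) (t : Rcomplex R) (mn : int * int) : Rcomplex R :=
  (int_eps mn.1 mn.2)%:~R * mn.1%:~R ^+ b * mn.2%:~R ^+ a * ee t ^+ absz (mn.1 * mn.2).

HB.lock Definition qsum (R : realType) (a b : nat) (t : Rcomplex R) : Rcomplex R :=
  sum (qterm a b t).

Section QSeries.
Variable R : realType.
Local Notation C := (Rcomplex R).
Local Notation cn := (@Num.norm
  (Num_RealClosedField__to__Num_POrderedZmodule (reals_Real__to__Num_RealClosedField R))
  (complex_Rcomplex__canonical__Num_SemiNormedZmodule (reals_Real__to__Num_RealClosedField R))).
Local Notation re := (@complex.Re R).
Local Notation im := (@complex.Im R).
Local Notation beta := (zeta_neg R).
Implicit Types t : C.

(** Majorant for the terms and for their expansion errors in t; the free base r can be taken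
    slightly above |q|. *)
Definition qmajor a b (r : R) (mn : int * int) : R :=
  if mn.1 * mn.2 == 0 then 0 else
  (absz mn.1)%:R ^+ b * (absz mn.2)%:R ^+ a * r ^+ absz (mn.1 * mn.2).

Lemma summable_int_powers k (r : R) : 0 <= r -> r < 1 ->
  abs_summable (fun m : int => (((absz m)%:R ^+ k * r ^+ absz m)%:C)%C : C).
Proof.
move=> r0 r1; have u1 : cn ((r%:C)%C : C) < 1 by rewrite normrZC ger0_norm.
have E m : (((m%:R ^+ k * r ^+ m)%:C)%C : C) = (m ^ k)%:R * ((r%:C)%C : C) ^+ m.
  by rewrite (rmorphM (real_complex R)) !(rmorphXn (real_complex R)) /= -natC natrX.
have H := summable_powers k u1.
apply: abs_summable_int.
  by apply: abs_summable_le H => m /=; rewrite E.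
apply: abs_summable_le (@abs_summable_reindex _ _ _ S _ succn_inj H) => m /=.
by rewrite E.
Qed.

Lemma summable_qmajor a b (r : R) : 0 <= r -> r < 1 ->
  abs_summable (fun mn => ((qmajor a b r mn)%:C)%C : C).
Proof.
move=> r0 r1; pose s := Num.sqrt r.
have s0 : 0 <= s by exact: sqrtr_ge0.
have s1 : s < 1 by rewrite -[1]sqrtr1 ltr_sqrt.
have := abs_summableM (summable_int_powers b s0 s1) (summable_int_powers a s0 s1).
apply: abs_summable_le => -[m n] /=; rewrite cnormM !normrZC /qmajor /=.
have p (k : nat) (x : int) : 0 <= (absz x)%:R ^+ k * s ^+ absz x by rewrite mulr_ge0// exprn_ge0.
rewrite (ger0_norm (p b m)) (ger0_norm (p a n)).
case: ifPn => [_|]; first by rewrite normr0 mulr_ge0.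
rewrite mulf_eq0 negb_or => /andP[m0 n0].
rewrite ger0_norm; last by rewrite mulr_ge0 ?exprn_ge0// mulr_ge0// exprn_ge0.
rewrite mulrACA ler_wpM2l ?mulr_ge0 ?exprn_ge0//.
have -> : r ^+ absz (m * n) = s ^+ (2 * absz (m * n)) by rewrite exprM sqr_sqrtr.
rewrite -exprD ler_wiXn2l ?(ltW s1)// abszM.
move: m0 n0; rewrite -!absz_gt0; nia.
Qed.

Lemma int_eps_norm (m n : int) : `|(int_eps m n)%:~R : R| <= (m * n != 0)%:R.
Proof.
rewrite /int_eps; case: ifP => h; last by rewrite normr0.
have -> : m * n != 0 by rewrite gt_eqF.
by rewrite -intr_norm; case: sgzP h => //; rewrite mul0r.
Qed.

Lemma qterm_le a b t mn : cn (qterm a b t mn) <= qmajor a b (cn (ee t)) mn.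
Proof.
case: mn => m n; rewrite /qterm /qmajor /= !cnormM !cnormX !cnorm_int.
have := int_eps_norm m n; case: ifPn => mn0 /= e1.
  have -> : `|(int_eps m n)%:~R : R| = 0 by apply/eqP; rewrite eq_le e1 normr_ge0.
  by rewrite !mul0r.
have absR (x : int) : `|x%:~R : R| = (absz x)%:R by rewrite -intr_norm -abszE.
by rewrite !absR in e1 *; rewrite -!mulrA ler_piMl.
Qed.

Lemma summable_qterm a b t : 0 < im t -> abs_summable (qterm a b t).
Proof.
move=> t0; apply: abs_summable_le (summable_qmajor a b (normr_ge0 _) (ee_lt1 t0)) => mn.
apply: le_trans (qterm_le a b t mn) _.
by rewrite normrZC ler_norm.
Qed.

Lemma int_epsC (m n : int) : int_eps m n = int_eps n m.
Proof.
rewrite /int_eps mulrC; case: ifP => // h.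
case: (ltrgtP 0 m) => m0; last by exfalso; move: h; rewrite -m0 mulr0 ltxx.
  by rewrite !gtr0_sgz//; nia.
by rewrite !ltr0_sgz//; nia.
Qed.

Lemma qsumC a b t : 0 < im t -> qsum a b t = qsum b a t.
Proof.
move=> t0; rewrite qsum.unlock.
rewrite -(@sum_bij R _ _ (fun mn : int * int => (mn.2, mn.1)) (fun mn => (mn.2, mn.1)) (qterm a b t)).
- by congr sum; apply/funext => -[m n]; rewrite /qterm /= int_epsC [(n * m)%R]mulrC; ring.
- by case.
- by case.
- exact: summable_qterm.
Qed.

Lemma qsum_even a b t : 0 < im t -> ~~ odd (a + b) -> qsum a b t = 0.
Proof.
move=> t0 ab; have s := summable_qterm a b t0.
have E : qsum a b t = - qsum a b t.
  rewrite qsum.unlock -{1}(@sum_bij R _ _ (fun mn : int * int => (- mn.1, - mn.2)) (fun mn => (- mn.1, - mn.2)) (qterm a b t)) //.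
  - rewrite -mulN1r -sumZ//; congr sum; apply/funext => -[m n]; rewrite /qterm /= mulrNN.
    have -> : int_eps (- m) (- n) = - int_eps m n.
      by rewrite /int_eps mulrNN; case: ifP => // _; rewrite ?sgzN ?oppr0.
    have h : (-1) ^+ b * (-1) ^+ a = 1 :> C by rewrite -exprD addnC -signr_odd (negPf ab).
    rewrite !rmorphN /= (exprNn (m%:~R : C)) (exprNn (n%:~R : C)).
    have -> : - (int_eps m n)%:~R * ((-1) ^+ b * m%:~R ^+ b) * ((-1) ^+ a * n%:~R ^+ a) *
       ee t ^+ absz (m * n) = ((-1) ^+ b * (-1) ^+ a) * (- 1 * ((int_eps m n)%:~R * m%:~R ^+ b *
       n%:~R ^+ a * ee t ^+ absz (m * n))) by ring.
    by rewrite h mul1r.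
  - by move=> [m n] /=; rewrite !opprK.
  - by move=> [m n] /=; rewrite !opprK.
have c2 := natC_neq0 R 1; apply: (mulfI c2); rewrite mulr0.
by rewrite mulr_natl mulr2n {1}E addNr.
Qed.

Lemma int_eps_pos (m : nat) (n : int) : int_eps (Posz m.+1) n = Posz (0 < n)%R.
Proof. by rewrite /int_eps pmulr_rgt0//; case: (0 < n). Qed.

Lemma int_eps_neg (m : nat) (n : int) : int_eps (Negz m) n = - Posz (n < 0)%R.
Proof. by rewrite /int_eps nmulr_rgt0//; case: (n < 0); rewrite ?oppr0. Qed.

(** For odd k the terms with m, n < 0 equal those at |m|, |n|, so each row is a series in q^|m|. *)
Lemma qterm_row k t (m : int) : 0 < im t -> m != 0 -> odd k ->
  sum (fun n => qterm k 0 t (m, n)) = Tser k ((absz m)%:R * t).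
Proof.
move=> t0 m0 ok; have k0 : (0 < k)%N by case: k ok.
have s := abs_summable_row m (summable_qterm k 0 t0).
have eN N : ee ((absz m)%:R * t) ^+ N = ee t ^+ (absz m * N) by rewrite eeMn exprM.
have sT : abs_summable (fun n : nat => (n ^ k)%:R * ee ((absz m)%:R * t) ^+ n : C).
  apply: summable_Tser; rewrite natC Im_realM mulr_gt0// ltr0n absz_gt0//.
rewrite (sum_int s) Tser.unlock; case: m m0 {s} eN sT => [[//|m]|m] _ eN sT.
  rewrite [X in _ + X](_ : _ = 0) ?addr0.
    congr sum; apply/funext => n; rewrite /qterm abszM /= int_eps_pos expr0 mulr1 eN.
    rewrite natrX; case: n => [|n]; first by rewrite !(expr0n, eqn0Ngt, k0) /= ?(mulr0, mul0r).
    by rewrite ltz_nat mul1r.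
  apply/sumP; apply: eq_has_sum (@has_sum0 R nat) => n.
  by rewrite /qterm /= int_eps_pos !mul0r.
rewrite [X in X + _](_ : _ = 0) ?add0r; last first.
  apply/sumP; apply: eq_has_sum (@has_sum0 R nat) => n.
  by rewrite /qterm /= int_eps_neg /= oppr0 !mul0r.
rewrite [RHS]sum_nat_shift// exp0n// mul0r add0r; congr sum; apply/funext => n.
rewrite /qterm abszM /= int_eps_neg expr0 mulr1 eN !NegzE /=.
rewrite !rmorphN /= exprNn -signr_odd ok expr1 mulN1r mulrNN mul1r.
by rewrite natrX.
Qed.

End QSeries.

Definition tau (R : realType) (p : Rcomplex R * Rcomplex R) : Rcomplex R := p.2 / p.1.

(* [hol a b] is the holomorphic analogue of [g a b], in which [e_2] replaces [e_2^*]. *)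
HB.lock Definition hol (R : realType) (a b : nat) (p : Rcomplex R * Rcomplex R) : Rcomplex R :=
  (tpi R / p.1) ^+ (a + b).+1 *
  (qsum a b (tau p) + (a == 0)%:R * zeta_neg R b + (b == 0)%:R * zeta_neg R a).

Definition slope (R : realType) (p : Rcomplex R * Rcomplex R) : Rcomplex R :=
  (pi / area p) *: ((conjc p.1 : Rcomplex R) / p.1).

(** * Fourier expansion of the lattice sums *)

Section EisensteinQSeries.
Variable R : realType.
Local Notation C := (Rcomplex R).
Local Notation cn := (@Num.norm
  (Num_RealClosedField__to__Num_POrderedZmodule (reals_Real__to__Num_RealClosedField R))
  (complex_Rcomplex__canonical__Num_SemiNormedZmodule (reals_Real__to__Num_RealClosedField R))).
Local Notation re := (@complex.Re R).
Local Notation im := (@complex.Im R).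
Local Notation beta := (zeta_neg R).
Implicit Types (t : C) (p : C * C).

Lemma mulC_conj (z : C) : z * conjc z = ((cn z ^+ 2)%:C)%C.
Proof.
rewrite sqr_cnorm; case: z => a b.
by apply/eqP; rewrite eq_complex /=; apply/andP; split; apply/eqP; ring.
Qed.

Lemma oriented_neq0 p : oriented_basis p -> p.1 != 0.
Proof.
rewrite /oriented_basis /area; apply: contraTneq => ->.
by rewrite [conjc 0]raddf0 mul0r ltxx.
Qed.

Lemma im_tau p : p.1 != 0 -> im (tau p) = area p / cn p.1 ^+ 2.
Proof.
move=> p0; have n0 : cn p.1 ^+ 2 != 0 by rewrite expf_neq0// normr_eq0.
have -> : tau p = (((cn p.1 ^+ 2)^-1)%:C)%C * (conjc p.1 * p.2 : C).
  have E := mulC_conj p.1; apply: (mulfI p0); rewrite /tau mulrC divfK//.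
  rewrite mulrCA [p.1 * _]mulrA E mulrA -(rmorphM (real_complex R)) /= mulVf// mul1r.
  by [].
by rewrite Im_realM mulrC.
Qed.

Lemma im_tau_gt0 p : oriented_basis p -> 0 < im (tau p).
Proof.
move=> op; have p0 := oriented_neq0 op.
by rewrite im_tau// divr_gt0// exprn_gt0// normr_gt0.
Qed.

Lemma lattice_vector p (m n : int) : p.1 != 0 ->
  p.2 *~ m + p.1 *~ n = p.1 * (m%:~R * tau p + n%:~R).
Proof.
move=> p0; rewrite -(mulrzr p.2) -(mulrzr p.1 n) /tau; by field.
Qed.

Lemma Im_intM (m : int) t : im (m%:~R * t) = m%:~R * im t.
Proof. by rewrite intC Im_realM. Qed.

Lemma Re_intM (m : int) t : re (m%:~R * t) = m%:~R * re t.
Proof. by rewrite intC Re_realM. Qed.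

Lemma lattice_indep t (m n : int) : 0 < im t -> m%:~R * t + n%:~R = 0 -> m = 0 /\ n = 0.
Proof.
move=> t0 E; have m0 : m = 0.
  have := congr1 im E; rewrite ImD Im_intM intC Im_real addr0 => /eqP.
  by rewrite mulf_eq0 (gt_eqF t0) orbF intr_eq0 => /eqP.
split=> //; move: E; rewrite m0 mul0r add0r => /eqP.
by rewrite -normr_eq0 cnorm_int normr_eq0 intr_eq0 => /eqP.
Qed.

Lemma oppX_even (x : C) k : odd k -> (- x) ^+ k.+1 = x ^+ k.+1.
Proof. by move=> ok; rewrite exprNn -signr_odd oddS ok expr0 mul1r. Qed.

Lemma Slat_neg k t : im t != 0 -> odd k -> Slat k.+1 (- t) = Slat k.+1 t.
Proof.
case: k => [//|k] t0 ok; have s := summable_row k t0.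
rewrite !Slat.unlock -[RHS](@sum_bij R _ _ -%R -%R _ (@opprK _) (@opprK _) s).
congr sum; apply/funext => n; rewrite rmorphN /=.
have -> : - t + n%:~R = - (t - n%:~R) by rewrite opprB addrC.
by rewrite oppX_even.
Qed.

(** Indexed as in [eisenstein2]: the first index is the coefficient of omega_2, the second, summed
    first, that of omega_1. *)
Definition lat_term k p (mn : int * int) : C :=
  if (mn.1 == 0) && (mn.2 == 0) then 0 else (p.2 *~ mn.1 + p.1 *~ mn.2) ^- k.

Lemma lat_row k p (m : int) : oriented_basis p -> odd k ->
  sum (fun n => lat_term k.+1 p (m, n)) =
  p.1 ^- k.+1 * ((if m == 0 then int_zeta R k.+1 else 0) +
    tpi R ^+ k.+1 / k`!%:R * sum (fun n => qterm k 0 (tau p) (m, n))).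
Proof.
move=> op ok; have p0 := oriented_neq0 op; have t0 := im_tau_gt0 op.
have [k' kE] : exists k', k = k'.+1 by case: k ok => [//|k'] _; exists k'.
case: eqP => [->|/eqP m0].
  rewrite (_ : sum (fun n => qterm k 0 (tau p) (0, n)) = 0); last first.
    apply/sumP; apply: eq_has_sum (@has_sum0 R int) => n.
    by rewrite /qterm /= /int_eps mul0r ltxx !mul0r.
  rewrite mulr0 addr0 int_zeta.unlock -sumZ; last by apply: summable_int_zeta; rewrite kE.
  congr sum; apply/funext => n; rewrite /lat_term /=; case: eqP => n0; first by rewrite mulr0.
  by rewrite mulr0z add0r -mulrzr exprMn invfM.
rewrite add0r qterm_row//.
have i1 : 0 < im ((absz m)%:R * tau p).
  by rewrite natC Im_realM mulr_gt0// ltr0n absz_gt0.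
have -> : tpi R ^+ k.+1 / k`!%:R * Tser k ((absz m)%:R * tau p) = Slat k.+1 ((absz m)%:R * tau p).
  by rewrite kE Lipschitz// -kE oppX_even.
have -> : Slat k.+1 ((absz m)%:R * tau p) = Slat k.+1 (m%:~R * tau p).
  case: m m0 i1 => m m0 i1; first by [].
  rewrite NegzE rmorphN mulNr; apply/esym/Slat_neg => //.
  exact: lt0r_neq0 i1.
have mt : im (m%:~R * tau p) != 0 by rewrite Im_intM mulf_neq0 ?intr_eq0// gt_eqF.
rewrite Slat.unlock -sumZ; last by rewrite kE; apply: summable_row.
congr sum; apply/funext => n; rewrite /lat_term /= (negPf m0) /=.
by rewrite lattice_vector// exprMn invfM.
Qed.

(** Only row sums enter, each given by the Lipschitz formula, and the resulting q-series is
    absolutely summable. This covers weight 2, where the double lattice family is not summable. *)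
Lemma lat_sum k p : oriented_basis p -> odd k ->
  sum (fun m => sum (fun n => lat_term k.+1 p (m, n))) = hol 0 k p / k`!%:R.
Proof.
move=> op ok; have p0 := oriented_neq0 op; have t0 := im_tau_gt0 op.
have [_ F] := fubini (summable_qterm k 0 t0).
have S0 : has_sum (fun m : int => if m == 0 then int_zeta R k.+1 else 0 : C) (int_zeta R k.+1).
  have := @has_sum_seq R _ [:: (0 : int)] (fun m : int => if m == 0 then int_zeta R k.+1 else 0 : C) isT.
  by rewrite big_seq1 eqxx; apply => i; rewrite inE => /negPf ->.
have S := has_sumZ (p.1 ^- k.+1) (has_sumD S0 (has_sumZ (tpi R ^+ k.+1 / k`!%:R) F)).
have -> : (fun m => sum (fun n => lat_term k.+1 p (m, n))) =
  (fun m => p.1 ^- k.+1 * ((if m == 0 then int_zeta R k.+1 else 0) +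
    tpi R ^+ k.+1 / k`!%:R * sum (fun n => qterm k 0 (tau p) (m, n)))).
  by apply/funext => m; rewrite lat_row.
rewrite (sumP S) hol.unlock qsumC// qsum.unlock add0n eqxx mul1r.
have -> : (k == 0)%N = false by case: k ok {S S0 F}.
rewrite mul0r addr0 zeta_neg.unlock ok oppX_even// expr_div_n.
have := factC_neq0 R k; have := expf_neq0 k.+1 (tpi_neq0 R); have := expf_neq0 k.+1 p0.
move: (k`!%:R : C) (tpi R ^+ k.+1) (p.1 ^+ k.+1) (int_zeta R k.+1) => f w x z x0 w0 f0.
by field; rewrite ?x0 ?w0 ?f0.
Qed.

Lemma lattice_norm_ge t : 0 < im t -> exists2 K : R, 0 < K & forall m n : int,
  m%:~R ^+ 2 + n%:~R ^+ 2 <= K * cn (m%:~R * t + n%:~R) ^+ 2.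
Proof.
move=> t0; exists (2 + (2 * re t ^+ 2 + 1) / im t ^+ 2).
  by rewrite ltr_pwDl// divr_ge0 ?sqr_ge0// addr_ge0// mulr_ge0// sqr_ge0.
move=> m n; rewrite sqr_cnorm ReD ImD Re_intM Im_intM intC Re_real Im_real addr0.
set x := re t; set y := im t; move: (m%:~R : R) (n%:~R : R) => M N.
have y2 : y ^+ 2 != 0 by rewrite expf_neq0// gt_eqF.
set q := (2 * x ^+ 2 + 1) / y ^+ 2.
have q0 : 0 <= q by rewrite divr_ge0 ?sqr_ge0// addr_ge0// mulr_ge0// sqr_ge0.
have qy : q * (M * y) ^+ 2 = (2 * x ^+ 2 + 1) * M ^+ 2.
  by rewrite /q exprMn; field; rewrite gt_eqF.
have h1 := mulr_ge0 q0 (sqr_ge0 (M * x + N)).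
have h2 := sqr_ge0 (2 * M * x + N); have h3 := sqr_ge0 (M * y).
rewrite mulrDl !mulrDr qy; nra.
Qed.

Lemma summable_lat_term k p : oriented_basis p -> abs_summable (lat_term k.+4 p).
Proof.
move=> op; have p0 := oriented_neq0 op; have t0 := im_tau_gt0 op.
have [K K0 HK] := lattice_norm_ge t0.
(* With N = |m tau + n|, k of the k + 4 factors 1/N are bounded by sqrt K; the other four use (1 +
   m^2)(1 + n^2) <= 4 (m^2 + n^2)^2 for (m, n) nonzero. *)
pose A : R := cn p.1 ^- k.+4 * (Num.sqrt K ^+ k * (4 * K ^+ 2)).
have A0 : 0 <= A.
  by rewrite mulr_ge0 ?invr_ge0 ?exprn_ge0// mulr_ge0 ?exprn_ge0 ?sqrtr_ge0// mulr_ge0// sqr_ge0.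
have := abs_summableZ ((A%:C)%C : C) (abs_summableM (summable_int_weight R) (summable_int_weight R)).
apply: abs_summable_le => -[m n] /=.
rewrite !cnormM !normrZC (ger0_norm A0) !(gtr0_norm (int_weight_gt0 _ _)).
have w0 : 0 <= int_weight R m * int_weight R n by rewrite mulr_ge0// ltW// int_weight_gt0.
rewrite /lat_term /=; case: ifPn => [_|mn0]; first by rewrite normr0 mulr_ge0.
rewrite lattice_vector// exprMn invfM cnormM cnormV cnormX -/A /A -mulrA ler_wpM2l ?invr_ge0 ?exprn_ge0//.
set z := _ + _; set N := cn z.
have S1 : 1 <= m%:~R ^+ 2 + n%:~R ^+ 2 :> R.
  rewrite -!rmorphXn -rmorphD /= ler1z; move: mn0; rewrite negb_and; nia.
have KN := HK m n; rewrite -/z -/N in KN.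
have N2 : 0 < N ^+ 2.
  have : 0 < K * N ^+ 2 by apply: lt_le_trans KN; apply: lt_le_trans S1.
  by rewrite pmulr_rgt0.
have N0 : 0 < N by rewrite lt0r normr_ge0 andbT; apply: contraTneq N2 => ->; rewrite expr0n ltxx.
have low : N^-1 <= Num.sqrt K.
  have NV0 : 0 <= N^-1 by rewrite invr_ge0 (ltW N0).
  rewrite -(@ler_pXn2r _ 2)// ?nnegrE ?sqrtr_ge0// sqr_sqrtr ?(ltW K0)// exprVn.
  by rewrite -[N ^- 2]mul1r ler_pdivrMr// (le_trans S1).
rewrite cnormV cnormX -/N -addn4 exprD invfM -!exprVn -!mulrA; apply: ler_pM.
- by rewrite exprn_ge0// invr_ge0 ltW.
- by rewrite exprn_ge0// invr_ge0 ltW.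
- by rewrite lerXn2r// nnegrE ?invr_ge0 ?sqrtr_ge0// ltW.
rewrite exprVn /int_weight -invfM.
set W := (1 + _) * (1 + _); have W0 : 0 < W by rewrite /W mulr_gt0// ltr_pwDl// sqr_ge0.
have -> : 4 * (K * (K * W^-1)) = (4 * K ^+ 2) / W by ring.
rewrite ler_pdivlMr// mulrC ler_pdivrMr; last by rewrite exprn_gt0.
rewrite /W.
have S2 := ler_pM ler01 ler01 S1 S1.
have KN2 : (m%:~R ^+ 2 + n%:~R ^+ 2) ^+ 2 <= (K * N ^+ 2) ^+ 2.
  apply: lerXn2r => //; rewrite nnegrE; first by rewrite addr_ge0 ?sqr_ge0.
  exact: mulr_ge0 (ltW K0) (sqr_ge0 N).
rewrite exprMn -exprM in KN2.
move: S1 KN2; rewrite [(2 * 2)%N]/=; have := sqr_ge0 (m%:~R : R); have := sqr_ge0 (n%:~R : R).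
move: (m%:~R ^+ 2 : R) (n%:~R ^+ 2 : R) => u v v0 u0 S1 KN2.
have : 0 <= (u - v) ^+ 2 by exact: sqr_ge0.
nra.
Qed.

Lemma eisensteinE k p : oriented_basis p ->
  eisenstein k.+4 p = sum (fun m => sum (fun n => lat_term k.+4 p (m, n))).
Proof.
move=> op; have p0 := oriented_neq0 op; have t0 := im_tau_gt0 op.
have s := summable_lat_term k op.
have [_ /sumP->] := fubini s.
pose h (mn : int * int) : C := p.2 *~ mn.1 + p.1 *~ mn.2.
apply/sumP; apply: (@has_sum_reindex _ _ _ h).
- move=> [m n] [m' n'] /eqP; rewrite /h /= !lattice_vector// -subr_eq0 -mulrBr mulf_eq0 (negPf p0) /=.
  move=> /eqP E; have [|/eqP h1 /eqP h2] := @lattice_indep (tau p) (m - m') (n - n') t0.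
    by rewrite -E !rmorphB /=; ring.
  by move: h1 h2; rewrite !subr_eq0 => /eqP -> /eqP ->.
- move=> w; case: ifP; rewrite ?eqxx// => /set_mem [[m [n ->]] _] _.
  by exists (n, m); rewrite /h /= addrC.
apply: eq_has_sum (abs_has_sum s) => -[m n] /=; rewrite /lat_term /= -/(h (m, n)).
case: ifPn => [/andP[/eqP-> /eqP->]|mn0].
  rewrite /h /= !mulr0z addr0; case: ifP => // /set_mem[_ /=]; by case.
rewrite ifT//; apply/mem_set; split; first by exists n, m; rewrite /h /= addrC.
move=> /= hE; have : p.1 * (m%:~R * tau p + n%:~R) == 0 by rewrite -lattice_vector// -/(h (m, n)) hE.
rewrite mulf_eq0 (negPf p0) => /eqP/(lattice_indep t0)[m0 n0].
by rewrite m0 n0 !eqxx in mn0.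
Qed.

Lemma eisenstein_starE k p : oriented_basis p -> odd k ->
  eisenstein_star k.+1 p = hol 0 k p / k`!%:R - (k == 1)%:R * slope p.
Proof.
move=> op ok; rewrite -lat_sum// /eisenstein_star eqSS.
case: k ok => [//|[|[//|k]]] ok /=; last by rewrite mul0r subr0 eisensteinE.
by rewrite mul1r.
Qed.

End EisensteinQSeries.

(** * Derivation W and nonholomorphic functions *)

Section WirtingerCalculus.
Variable R : realType.
Local Notation C := (Rcomplex R).
Local Notation cn := (@Num.norm
  (Num_RealClosedField__to__Num_POrderedZmodule (reals_Real__to__Num_RealClosedField R))
  (complex_Rcomplex__canonical__Num_SemiNormedZmodule (reals_Real__to__Num_RealClosedField R))).
Local Notation re := (@complex.Re R).
Local Notation im := (@complex.Im R).
Implicit Types (p d : C * C) (F G : C * C -> C).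

(** A real-linear form on C^2 with its holomorphic coefficients [a], [b] separated from the
    antiholomorphic ones; [a] and [b] are the Wirtinger derivatives that W uses. *)
Definition wlin (a a' b b' : C) d : C :=
  a * d.1 + a' * (conjc d.1 : C) + b * d.2 + b' * (conjc d.2 : C).

Definition size2 d : R := cn d.1 + cn d.2.

(** A quadratic remainder is stronger than differentiability and passes to products and compositions
    with explicit constants. *)
Definition wdiff F p a a' b b' : Prop := exists r M : R, [/\ 0 < r, 0 <= M &
  forall d, size2 d <= r -> cn (F (p + d) - F p - wlin a a' b b' d) <= M * size2 d ^+ 2].

(** Certifies an expansion together with the value; the operator [W] is total and by itself says
    nothing about differentiability. *)
Definition has_W F p (w : C) : Prop := exists a a' b b', wdiff F p a a' b b' /\
  w = - (pi / area p) *: ((conjc p.1 : C) * a + (conjc p.2 : C) * b).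

Lemma size2_ge0 d : 0 <= size2 d. Proof. by rewrite addr_ge0. Qed.

Lemma wlin_le a a' b b' : exists2 L : R, 0 <= L & forall d, cn (wlin a a' b b' d) <= L * size2 d.
Proof.
exists (cn a + cn a' + cn b + cn b'); first by rewrite !addr_ge0.
move=> d; rewrite /wlin /size2.
have x1 := normr_ge0 d.1; have x2 := normr_ge0 d.2.
have h1 : cn (a * d.1) <= cn a * (cn d.1 + cn d.2) by rewrite cnormM ler_wpM2l// lerDl.
have h2 : cn (a' * (conjc d.1 : C)) <= cn a' * (cn d.1 + cn d.2).
  by rewrite cnormM cnorm_conj ler_wpM2l// lerDl.
have h3 : cn (b * d.2) <= cn b * (cn d.1 + cn d.2) by rewrite cnormM ler_wpM2l// lerDr.
have h4 : cn (b' * (conjc d.2 : C)) <= cn b' * (cn d.1 + cn d.2).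
  by rewrite cnormM cnorm_conj ler_wpM2l// lerDr.
rewrite !mulrDl; do 3 apply: le_trans (ler_normD _ _) (lerD _ _) => //; exact: h1.
Qed.

Lemma derive_quadratic F p v (L : C) (r M : R) : 0 < r -> 0 <= M ->
  (forall h : R, `|h| <= r -> cn (F (p + h *: v) - F p - h *: L) <= M * h ^+ 2) ->
  'D_v F p = L.
Proof.
move=> r0 M0 H; rewrite /derive; apply: cvg_lim; first exact: norm_hausdorff.
apply/cvgrPdist_le => /= e e0.
have M1 : 0 < M + 1 by rewrite ltr_wpDl.
exists (Num.min r (e / (M + 1))) => /=; first by rewrite lt_min r0 divr_gt0.
move=> h /=; rewrite sub0r normrN lt_min => /andP[hr he] h0.
have hp : 0 < `|h| by rewrite normr_gt0.
have := H h (ltW hr); rewrite [h *: v + p]addrC.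
set D := F _ - F p => HD.
have -> : L - h^-1 *: D = - (h^-1 *: (D - h *: L)).
  by rewrite [h^-1 *: (D - _)]scalerBr scalerA mulVf// scale1r opprB.
rewrite normrN normrZ normfV ler_pdivrMl//.
apply: le_trans HD _; rewrite -(real_normK (num_real h)) expr2 mulrCA ler_pM2l//.
move: he; rewrite ltr_pdivlMr//; nra.
Qed.

Lemma wdiff_derive F p a a' b b' v : wdiff F p a a' b b' ->
  'D_v F p = wlin a a' b b' v.
Proof.
move=> [r [M [r0 M0 H]]].
have s1 : 0 < size2 v + 1 by rewrite ltr_wpDl// size2_ge0.
apply: (@derive_quadratic F p v _ (r / (size2 v + 1)) (M * size2 v ^+ 2)).
- by rewrite divr_gt0.
- by rewrite mulr_ge0// sqr_ge0.
move=> h hr.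
have sE : size2 (h *: v) = `|h| * size2 v by rewrite /size2 /= !cnorm_scale mulrDr.
have -> : h *: wlin a a' b b' v = wlin a a' b b' (h *: v).
  have cj (x : C) : (conjc (h *: x) : C) = h *: (conjc x : C) by case: x => u w; simpc.
  by rewrite /wlin /= !cj !scaleCE; ring.
have := H (h *: v); rewrite sE => {}H.
rewrite (_ : M * size2 v ^+ 2 * h ^+ 2 = M * (`|h| * size2 v) ^+ 2); last first.
  by rewrite exprMn (real_normK (num_real h)); ring.
apply: H; apply: (@le_trans _ _ (r / (size2 v + 1) * (size2 v + 1))); last by rewrite divfK// gt_eqF.
by apply: ler_pM => //; rewrite ?size2_ge0// lerDl.
Qed.

(** The antiholomorphic coefficients cancel in d/dx - i d/dy, because i^2 = -1. *)
Lemma has_W_W F p w : has_W F p w -> W F p = w.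
Proof.
move=> [a [a' [b [b' [H ->]]]]]; rewrite /W /wirtinger1 /wirtinger2.
rewrite !(wdiff_derive _ H).
have wE x y : wlin a a' b b' (x, y) = a * x + a' * (conjc x : C) + b * y + b' * (conjc y : C) by [].
have conj0 : (conjc (0 : C) : C) = 0 by exact: (raddf0 (@conjc R)).
have conj1 : (conjc (1 : C) : C) = 1 by exact: (rmorph1 (@conjc R)).
have conji : (conjc (imC R) : C) = - imC R.
  by apply/eqP; rewrite eq_complex /= oppr0 !eqxx.
have ii : imC R * imC R = -1.
  by apply/eqP; rewrite eq_complex /= !mul0r !mulr0 mul1r sub0r addr0 oppr0 !eqxx.
have half (x : C) : 2^-1 *: (x + x) = x.
  rewrite scalerDr -scalerDl (_ : 2^-1 + 2^-1 = 1 :> R) ?scale1r//; by field.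
rewrite !wE conj0 conj1 conji !mulr0 !mulr1 !addr0 !add0r; congr (_ *: (_ * _ + _ * _)).
  rewrite -[RHS]half; congr (_ *: _).
  have -> : a + a' - imC R * (a * imC R + a' * - imC R) = a + a' - (imC R * imC R) * a + (imC R * imC R) * a' by ring.
  by rewrite ii; ring.
rewrite -[RHS]half; congr (_ *: _).
have -> : b + b' - imC R * (b * imC R + b' * - imC R) = b + b' - (imC R * imC R) * b + (imC R * imC R) * b' by ring.
by rewrite ii; ring.
Qed.

Lemma has_W_cst (c : C) p : has_W (fun _ => c) p 0.
Proof.
exists 0, 0, 0, 0; split; last by rewrite !mulr0 addr0 scaler0.
exists 1, 0; split=> // d _.
by rewrite /wlin !mul0r !addr0 !subr0 subrr normr0.
Qed.

Lemma wdiff_lin a a' b b' p : wdiff (wlin a a' b b') p a a' b b'.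
Proof.
exists 1, 0; split=> // d _.
have -> : wlin a a' b b' (p + d) - wlin a a' b b' p - wlin a a' b b' d = 0.
  rewrite /wlin /= (raddfD (@conjc R)) (raddfD (@conjc R)) /=; ring.
by rewrite normr0 mul0r.
Qed.

Lemma has_W_lin a a' b b' p : has_W (wlin a a' b b') p
  (- (pi / area p) *: ((conjc p.1 : C) * a + (conjc p.2 : C) * b)).
Proof. by exists a, a', b, b'; split=> //; exact: wdiff_lin. Qed.

Lemma wlinD a a' b b' c c' e e' d : wlin a a' b b' d + wlin c c' e e' d =
  wlin (a + c) (a' + c') (b + e) (b' + e') d.
Proof. by rewrite /wlin; ring. Qed.

Lemma wlinZ (x : C) a a' b b' d : x * wlin a a' b b' d =
  wlin (x * a) (x * a') (x * b) (x * b') d.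
Proof. by rewrite /wlin; ring. Qed.

Lemma has_WD F G p u v : has_W F p u -> has_W G p v ->
  has_W (fun q => F q + G q) p (u + v).
Proof.
move=> [a [a' [b [b' [[r [M [r0 M0 H]]] ->]]]]] [c [c' [e [e' [[r' [M' [r'0 M'0 H']]] ->]]]]].
exists (a + c), (a' + c'), (b + e), (b' + e'); split; last first.
  by rewrite -scalerDr; congr (_ *: _); ring.
exists (Num.min r r'), (M + M'); split; first by rewrite lt_min r0.
  by rewrite addr_ge0.
move=> d; rewrite le_min => /andP[h h'].
rewrite -wlinD [leRHS]mulrDl.
set x := wlin _ _ _ _ _; set y := wlin _ _ _ _ _.
have -> : F (p + d) + G (p + d) - (F p + G p) - (x + y) =
  (F (p + d) - F p - x) + (G (p + d) - G p - y) by ring.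
by apply: le_trans (ler_normD _ _) _; rewrite lerD ?H ?H'.
Qed.

Lemma has_WM F G p u v : has_W F p u -> has_W G p v ->
  has_W (fun q => F q * G q) p (F p * v + u * G p).
Proof.
move=> [a [a' [b [b' [[r [M [r0 M0 H]]] ->]]]]] [c [c' [e [e' [[r' [M' [r'0 M'0 H']]] ->]]]]].
exists (F p * c + G p * a), (F p * c' + G p * a'), (F p * e + G p * b), (F p * e' + G p * b').
split; last first.
  by rewrite !scaleCE; ring.
have [L L0 HL] := wlin_le a a' b b'; have [L' L'0 HL'] := wlin_le c c' e e'.
pose s := Num.min 1 (Num.min r r').
exists s, (M * (cn (G p) + L' + M') + cn (F p) * M' + L * (L' + M')); split.
- by rewrite !lt_min r0 r'0 ltr01.
- by rewrite !addr_ge0 ?mulr_ge0 ?addr_ge0.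
move=> d; rewrite !le_min => /and3P[h1 hr hr'].
rewrite -wlinD -!wlinZ.
have := H d hr; have := H' d hr'; have := HL d; have := HL' d.
set x := wlin a a' b b' d; set y := wlin c c' e e' d; set z := size2 d in h1 *.
have z0 : 0 <= z by exact: size2_ge0.
set f := F (p + d) - F p - x; set g := G (p + d) - G p - y => yL xL gM fM.
have -> : F (p + d) * G (p + d) - F p * G p - (F p * y + G p * x) =
  f * (G p + y + g) + F p * g + x * (y + g) by rewrite /f /g; ring.
have z2 : z ^+ 2 <= z by rewrite expr2 ler_piMr.
have gz : cn g <= M' * z by apply: le_trans gM _; rewrite ler_wpM2l.
have yg : cn (y + g) <= (L' + M') * z.
  by apply: le_trans (ler_normD _ _) _; rewrite [leRHS]mulrDl lerD.
have Gyg : cn (G p + y + g) <= cn (G p) + L' + M'.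
  rewrite -addrA -[leRHS]addrA; apply: le_trans (ler_normD _ _) _; rewrite lerD2l.
  by apply: le_trans yg _; rewrite ler_piMr// addr_ge0.
rewrite [leRHS]mulrDl; apply: le_trans (ler_normD _ _) _; apply: lerD; last first.
  rewrite cnormM; apply: le_trans (ler_pM _ _ xL yg) _ => //.
  by rewrite le_eqVlt; apply/orP; left; apply/eqP; ring.
rewrite [leRHS]mulrDl; apply: le_trans (ler_normD _ _) _; apply: lerD.
  by rewrite cnormM [leRHS]mulrAC; exact: ler_pM.
by rewrite cnormM -[leRHS]mulrA ler_wpM2l.
Qed.

Definition holo (f : C -> C) (z f' : C) : Prop := exists r M : R, [/\ 0 < r, 0 <= M &
  forall e : C, cn e <= r -> cn (f (z + e) - f z - f' * e) <= M * cn e ^+ 2].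

Lemma has_W_comp f f' F p u : holo f (F p) f' -> has_W F p u ->
  has_W (fun q => f (F q)) p (f' * u).
Proof.
move=> [r [M [r0 M0 H]]] [a [a' [b [b' [[r' [M' [r'0 M'0 H']]] ->]]]]].
exists (f' * a), (f' * a'), (f' * b), (f' * b'); split; last by rewrite !scaleCE; ring.
have [L L0 HL] := wlin_le a a' b b'.
have LM0 : 0 <= L + M' by rewrite addr_ge0.
have LM1 : 0 < L + M' + 1 by rewrite ltr_wpDl.
exists (Num.min 1 (Num.min r' (r / (L + M' + 1)))), (M * (L + M') ^+ 2 + cn f' * M'); split.
- by rewrite !lt_min ltr01 r'0 divr_gt0.
- by rewrite addr_ge0 ?mulr_ge0 ?sqr_ge0.
move=> d; rewrite !le_min => /and3P[h1 hr' hr]; rewrite -wlinZ.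
have := H' d hr'; have := HL d.
set x := wlin a a' b b' d; set z := size2 d in h1 hr *.
have z0 : 0 <= z by exact: size2_ge0.
set g := F (p + d) - F p - x => xL gM.
pose eta := x + g.
have etaE : F (p + d) = F p + eta by rewrite /eta /g; ring.
have z2 : z ^+ 2 <= z by rewrite expr2 ler_piMr.
have eta_le : cn eta <= (L + M') * z.
  apply: le_trans (ler_normD _ _) _; rewrite [leRHS]mulrDl lerD//.
  by apply: le_trans gM _; rewrite ler_wpM2l.
have eta_r : cn eta <= r.
  apply: le_trans eta_le _; apply: (@le_trans _ _ ((L + M' + 1) * z)).
    by rewrite ler_wpM2r// lerDl.
  by rewrite mulrC -ler_pdivlMr.
rewrite etaE.
have -> : f (F p + eta) - f (F p) - f' * x = (f (F p + eta) - f (F p) - f' * eta) + f' * g.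
  by rewrite /eta; ring.
rewrite [leRHS]mulrDl; apply: le_trans (ler_normD _ _) _; apply: lerD.
  apply: le_trans (H _ eta_r) _; rewrite -[leRHS]mulrA ler_wpM2l// -exprMn.
  by rewrite lerXn2r// nnegrE// mulr_ge0.
by rewrite cnormM -[leRHS]mulrA ler_wpM2l.
Qed.

Lemma holo_inv (z : C) : z != 0 -> holo (fun x => x^-1) z (- z ^- 2).
Proof.
move=> z0; have nz : 0 < cn z by rewrite normr_gt0.
exists (cn z / 2), (2 * cn z ^- 3); split.
- by rewrite divr_gt0.
- by rewrite mulr_ge0// invr_ge0 exprn_ge0.
move=> d hd; have low : cn z / 2 <= cn (z + d).
  rewrite (_ : z + d = z - - d); last by rewrite opprK.
  by apply: le_trans (lerB_dist _ _); rewrite normrN; lra.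
have zd0 : z + d != 0 by rewrite -normr_gt0 (lt_le_trans _ low)// divr_gt0.
have -> : (z + d)^-1 - z^-1 - - z ^- 2 * d = d ^+ 2 * (z ^- 2 * (z + d)^-1).
  by field; rewrite ?z0 ?zd0.
rewrite !cnormM !cnormV !cnormX mulrC ler_wpM2r ?sqr_ge0//.
have -> : 2 * cn z ^- 3 = cn z ^- 2 * (2 / cn z).
  by field; rewrite gt_eqF.
rewrite ler_wpM2l ?invr_ge0 ?sqr_ge0//.
rewrite -[2 / _]invf_div lef_pV2// posrE; last by rewrite divr_gt0.
by rewrite (lt_le_trans _ low)// divr_gt0.
Qed.

Lemma has_WX F p u n : has_W F p u -> has_W (fun q => F q ^+ n) p (n%:R * F p ^+ n.-1 * u).
Proof.
move=> H; elim: n => [|n IH]; first by rewrite !mul0r; exact: has_W_cst.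
have := has_WM H IH; congr (has_W _ _ _).
  by apply/funext => q; rewrite exprS.
rewrite /= -natr1; case: n {IH} => [|n] /=; first by rewrite !expr0; ring.
by rewrite -natr1 !exprS; ring.
Qed.

Lemma has_W_bigop (I : Type) (r : seq I) (F : I -> C * C -> C) p (u : I -> C) :
  (forall i, has_W (F i) p (u i)) ->
  has_W (fun q => \sum_(i <- r) F i q) p (\sum_(i <- r) u i).
Proof.
move=> H; elim: r => [|i r IH].
  rewrite big_nil; have := has_W_cst 0 p; congr (has_W _ _ _).
  by apply/funext => q; rewrite big_nil.
rewrite big_cons; have := has_WD (H i) IH; congr (has_W _ _ _).
by apply/funext => q; rewrite big_cons.
Qed.

Lemma oriented_open p : oriented_basis p -> exists2 r : R, 0 < r &
  forall d, size2 d <= r -> oriented_basis (p + d).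
Proof.
rewrite /oriented_basis => op; pose B := size2 p + 1.
have B0 : 0 < B by rewrite ltr_wpDl// size2_ge0.
exists (Num.min 1 (area p / (2 * B + 1))).
  by rewrite lt_min ltr01 divr_gt0// ltr_wpDl// mulr_ge0// ltW.
move=> d; rewrite le_min => /andP[d1 dB].
have -> : area (p + d) = area p + im ((conjc p.1 : C) * d.2 + (conjc d.1 : C) * p.2 + (conjc d.1 : C) * d.2).
  by rewrite /area /= (raddfD (@conjc R)) mulrDl !mulrDr !ImD; ring.
have : cn ((conjc p.1 : C) * d.2 + (conjc d.1 : C) * p.2 + (conjc d.1 : C) * d.2) <= 2 * B * size2 d.
  apply: le_trans (ler_normD _ _) _; apply: le_trans (lerD (ler_normD _ _) (lexx _)) _.
  rewrite !cnormM !cnorm_conj /B /size2 in d1 *.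
  have := normr_ge0 p.1; have := normr_ge0 p.2; have := normr_ge0 d.1; have := normr_ge0 d.2.
  move: (cn p.1) (cn p.2) (cn d.1) (cn d.2) d1 => x y z w; nra.
move=> h; set X := _ + _ in h *; have := le_trans (ler_normIm X) h.
rewrite ler_norml => /andP[h1 _].
move: dB; rewrite ler_pdivlMr; last by rewrite ltr_wpDl// mulr_ge0// ltW.
have := size2_ge0 d; nra.
Qed.

(** Formulas for g hold at oriented bases only; openness of this set is what allows them to be
    differentiated. *)
Lemma has_W_ext F G p u : oriented_basis p -> (forall q, oriented_basis q -> F q = G q) ->
  has_W F p u -> has_W G p u.
Proof.
move=> op FG [a [a' [b [b' [[r [M [r0 M0 H]]] ->]]]]].
exists a, a', b, b'; split=> //.
have [s s0 Hs] := oriented_open op.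
exists (Num.min r s), M; split=> //; first by rewrite lt_min r0.
by move=> d; rewrite le_min => /andP[h1 h2]; rewrite -!FG ?H//; exact: Hs.
Qed.

End WirtingerCalculus.

(** * The transform and its behaviour under raising both indices *)

Section Twist.
Variable A : comNzRingType.

(* If F(z, w) = 1/z + 1/w - sum_{a, b} h_{a,b} w^a z^b / (a! b!), then exp(t z w) F(z, w)
   is the corresponding generating function of [twist t h]. *)
Definition twist (t : A) (h : nat -> nat -> A) (a b : nat) : A :=
  \sum_(k < a.+1) ('C(a, k) * 'C(b, k) * k`!)%:R * t ^+ k * h (a - k)%N (b - k)%N -
  ((a == b.+1) || (b == a.+1))%:R * (minn a b)`!%:R * t ^+ (minn a b).+1.

Lemma twist_wide (t : A) h a b n : (a <= n)%N ->
  twist t h a b =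
  \sum_(k < n.+1) ('C(a, k) * 'C(b, k) * k`!)%:R * t ^+ k * h (a - k)%N (b - k)%N -
  ((a == b.+1) || (b == a.+1))%:R * (minn a b)`!%:R * t ^+ (minn a b).+1.
Proof.
move=> an; rewrite /twist; congr (_ - _).
pose F k := ('C(a, k) * 'C(b, k) * k`!)%:R * t ^+ k * h (a - k)%N (b - k)%N.
rewrite -(big_mkord xpredT F) -[RHS](big_mkord xpredT F).
rewrite [RHS](@big_cat_nat _ _ _ a.+1)//= [X in _ = _ + X]big_nat_cond [X in _ = _ + X]big1 ?addr0//.
by move=> k /andP[/andP[ak _] _]; rewrite /F bin_small ?mul0n ?mul0r.
Qed.

Lemma twistC (t : A) h a b : (forall a b, h a b = h b a) -> twist t h a b = twist t h b a.
Proof.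
move=> hC; rewrite (twist_wide _ _ _ (leq_addr b a)) (twist_wide _ _ _ (leq_addl a b)).
rewrite orbC minnC; congr (_ - _); apply: eq_bigr => k _.
by rewrite hC [('C(a, k) * _)%N]mulnC.
Qed.

Lemma twist0l (t : A) h b : twist t h 0 b = h 0%N b - (b == 1)%:R * t.
Proof.
rewrite /twist big_ord1 !bin0 fact0 !mul1n !subn0 expr0 !mul1r min0n fact0 expr1 mulr1.
by case: b => [|[|b]].
Qed.

(** In the last factor, (a - k) + (b - k) + 1 is the weight of h_{a-k,b-k}, and the remaining k is
    the exponent brought down from t^k. *)
Lemma twist_coefS a b k :
  ('C(a.+1, k.+1) * 'C(b.+1, k.+1) * (k.+1)`! =
   'C(a, k.+1) * 'C(b, k.+1) * (k.+1)`! + 'C(a, k) * 'C(b, k) * k`! * ((a - k) + (b - k) + k.+1))%N.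
Proof.
rewrite !binS factS; have := mul_bin_left a k; have := mul_bin_left b k.
move: 'C(a, k.+1) 'C(b, k.+1) 'C(a, k) 'C(b, k) (a - k)%N (b - k)%N k`! => x y x' y' u v f h1 h2.
have -> : ((x + x') * (y + y') * (k.+1 * f) = x * y * (k.+1 * f) +
  (x' * (k.+1 * y) + (k.+1 * x) * y' + k.+1 * x' * y') * f)%N by ring.
by rewrite h1 h2; ring.
Qed.

(** The right side is what a derivation with W t = t^2 and W h_{i,j} = h_{i+1,j+1} + (i + j + 1) t
    h_{i,j} makes of [twist t h a b]. *)
Lemma twist_SS (t : A) h a b :
  twist t h a.+1 b.+1 =
  \sum_(k < a.+1) ('C(a, k) * 'C(b, k) * k`!)%:R * (k%:R * t ^+ k.+1 * h (a - k)%N (b - k)%N +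
     t ^+ k * (h (a - k).+1 (b - k).+1 + ((a - k) + (b - k)).+1%:R * t * h (a - k)%N (b - k)%N)) -
  ((a == b.+1) || (b == a.+1))%:R * (minn a b)`!%:R * ((minn a b).+1%:R * t ^+ (minn a b).+2).
Proof.
rewrite /twist minnSS !eqSS; congr (_ - _); last first.
  by rewrite factS natrM; ring.
rewrite big_ord_recl /= !bin0 fact0 expr0 !mul1r !subn0.
under eq_bigr => k _ do rewrite /bump /= add1n twist_coefS natrD !subSS 2!mulrDl.
rewrite big_split /=.
have -> : \sum_(k < a.+1) ('C(a, k) * 'C(b, k) * k`!)%:R * (k%:R * t ^+ k.+1 * h (a - k)%N (b - k)%N +
     t ^+ k * (h (a - k).+1 (b - k).+1 + ((a - k) + (b - k)).+1%:R * t * h (a - k)%N (b - k)%N)) =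
   \sum_(k < a.+1) ('C(a, k) * 'C(b, k) * k`!)%:R * t ^+ k * h (a - k).+1 (b - k).+1 +
   \sum_(k < a.+1) ('C(a, k) * 'C(b, k) * k`! * ((a - k) + (b - k) + k.+1))%:R * t ^+ k.+1 * h (a - k)%N (b - k)%N.
  rewrite -big_split /=; apply: eq_bigr => k _.
  move: (h (a - k).+1 _) (h (a - k)%N _) => x y.
  move: (nat_of_ord k) ('C(a, k) * 'C(b, k) * k`!)%N (a - k + (b - k))%N => j N M.
  by rewrite natrM natrD -!natr1 !exprS; ring.
rewrite addrA; congr (_ + _).
rewrite [RHS]big_ord_recl /= !bin0 fact0 expr0 !mul1r !subn0; congr (_ + _).
rewrite big_ord_recr /= bin_small// !mul0n !mul0r addr0; apply: eq_bigr => k _.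
rewrite /bump /= add1n; have [kb|bk] := ltnP k b; last by rewrite (bin_small (n := b))// muln0 mul0n !mul0r.
by rewrite !subnSK.
Qed.

End Twist.

(** * W on tau, on the slope and on the holomorphic functions *)

Section HolomorphicDerivatives.
Variable R : realType.
Local Notation C := (Rcomplex R).
Local Notation cn := (@Num.norm
  (Num_RealClosedField__to__Num_POrderedZmodule (reals_Real__to__Num_RealClosedField R))
  (complex_Rcomplex__canonical__Num_SemiNormedZmodule (reals_Real__to__Num_RealClosedField R))).
Local Notation re := (@complex.Re R).
Local Notation im := (@complex.Im R).
Local Notation beta := (zeta_neg R).
Implicit Types (p : C * C) (t : C).

Lemma int_eps_abs (m n : int) : (int_eps m n)%:~R * (absz (m * n))%:R =
  (int_eps m n)%:~R * m%:~R * n%:~R :> C.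
Proof.
rewrite /int_eps; case: ifP => h; last by rewrite !mul0r.
by rewrite -mulrA -rmorphM /= -{2}(gtz0_abs h).
Qed.

(** Termwise differentiation of q^|mn| brings down 2 pi i |mn|, and |mn| = mn wherever [int_eps] is
    nonzero. The bound Im t / 2 on the increment keeps t + e in the upper half-plane. *)
Lemma qsum_holo a b t : 0 < im t -> holo (qsum a b) t (tpi R * qsum a.+1 b.+1 t).
Proof.
move=> t0; have [K K0 HK] := ee_pow_taylor R.
have [d [d0 q0 q1]] := small_radius (normr_ge0 (ee t)) (ee_lt1 t0).
set q := _ * _ in q0 q1.
have [B HB] := summable_qmajor a.+2 b.+2 q0 q1.
exists (Num.min d (im t / 2)), (K * B); split.
- by rewrite lt_min d0 divr_gt0.
- by rewrite mulr_ge0// (abs_bound_ge0 HB).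
move=> e; rewrite le_min => /andP[ed et].
have te0 : 0 < im (t + e).
  have := le_trans (ler_normIm e) et; rewrite ImD ler_norml => /andP[]; lra.
have S := has_sumB (has_sumB (abs_has_sum (summable_qterm a b te0)) (abs_has_sum (summable_qterm a b t0)))
  (has_sumZ (tpi R * e) (abs_has_sum (summable_qterm a.+1 b.+1 t0))).
rewrite !qsum.unlock mulrAC; apply: (has_sum_le S).
have HB' := abs_boundZ ((K * cn e ^+ 2)%:C%C : C) HB.
have Ke : 0 <= K * cn e ^+ 2 by rewrite mulr_ge0// sqr_ge0.
have -> : K * B * cn e ^+ 2 = cn ((K * cn e ^+ 2)%:C%C : C) * B by rewrite normrZC ger0_norm//; ring.
apply: abs_bound_le HB' => -[m n].
rewrite cnormM !normrZC (ger0_norm Ke) /qterm /=.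
have -> : (int_eps m n)%:~R * m%:~R ^+ b * n%:~R ^+ a * ee (t + e) ^+ absz (m * n) -
    (int_eps m n)%:~R * m%:~R ^+ b * n%:~R ^+ a * ee t ^+ absz (m * n) -
    tpi R * e * ((int_eps m n)%:~R * m%:~R ^+ b.+1 * n%:~R ^+ a.+1 * ee t ^+ absz (m * n)) =
  ((int_eps m n)%:~R * m%:~R ^+ b * n%:~R ^+ a) * (ee (t + e) ^+ absz (m * n) - ee t ^+ absz (m * n)
    - tpi R * e * (absz (m * n))%:R * ee t ^+ absz (m * n)).
  have -> : (int_eps m n)%:~R * m%:~R ^+ b.+1 * n%:~R ^+ a.+1 =
     (int_eps m n)%:~R * (absz (m * n))%:R * m%:~R ^+ b * n%:~R ^+ a :> C.
    by rewrite int_eps_abs !exprS; ring.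
  by ring.
rewrite cnormM /qmajor /= !cnormM !cnormX !cnorm_int.
have e1 := int_eps_norm R m n; case: ifPn e1 => mn0 /= e1.
  have -> : `|(int_eps m n)%:~R : R| = 0 by apply/eqP; rewrite eq_le e1 normr_ge0.
  by rewrite !mul0r normr0 mulr0.
have absR (x : int) : `|x%:~R : R| = (absz x)%:R by rewrite -intr_norm -abszE.
rewrite !absR in e1 *.
set E := cn (_ - _ - _).
have EK : E <= K * cn e ^+ 2 * (absz (m * n))%:R ^+ 2 * q ^+ absz (m * n).
  apply: le_trans (HK t e (absz (m * n))) _; apply: ler_wpM2l.
    by rewrite mulr_ge0// sqr_ge0.
  have X0 : 0 <= cn (ee t) * expR (2 * pi * cn e) :> R := mulr_ge0 (normr_ge0 _) (expR_ge0 _).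
  have Xq : cn (ee t) * expR (2 * pi * cn e) <= q.
    by rewrite ler_wpM2l// ler_expR ler_wpM2l// mulr_ge0// pi_ge0.
  exact: (lerXn2r _ X0 (le_trans X0 Xq) Xq).
have P0 : 0 <= (absz m)%:R ^+ b * (absz n)%:R ^+ a :> R by rewrite mulr_ge0 ?exprn_ge0.
apply: (@le_trans _ _ ((absz m)%:R ^+ b * (absz n)%:R ^+ a * E)).
  have E0 : 0 <= E by exact: normr_ge0.
  by rewrite -!mulrA; apply: ler_piMl => //; rewrite mulrA; exact: (mulr_ge0 P0 E0).
apply: le_trans (ler_wpM2l P0 EK) _.
rewrite [X in _ <= _ * X]ger0_norm; last by apply: mulr_ge0; [apply: mulr_ge0; exact: exprn_ge0|exact: exprn_ge0].
rewrite abszM natrM le_eqVlt; apply/orP; left; apply/eqP.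
move: (absz m)%:R (absz n)%:R (q ^+ _) (cn e) => x y z w; rewrite -(addn2 a) -(addn2 b) !exprD; ring.
Qed.

Lemma has_W_fst p : has_W (fun q : C * C => q.1) p (- (pi / area p) *: (conjc p.1 : C)).
Proof.
have := has_W_lin 1 0 0 0 p; rewrite mulr1 mulr0 addr0; congr (has_W _ _ _).
by apply/funext => q; rewrite /wlin mul1r !mul0r !addr0.
Qed.

Lemma has_W_snd p : has_W (fun q : C * C => q.2) p (- (pi / area p) *: (conjc p.2 : C)).
Proof.
have := has_W_lin 0 0 1 0 p; rewrite mulr1 mulr0 add0r; congr (has_W _ _ _).
by apply/funext => q; rewrite /wlin mul1r !mul0r !addr0 add0r.
Qed.

Lemma has_W_cfst p : has_W (fun q : C * C => conjc q.1 : C) p 0.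
Proof.
have := has_W_lin 0 1 0 0 p; rewrite !mulr0 addr0 scaler0; congr (has_W _ _ _).
by apply/funext => q; rewrite /wlin mul1r !mul0r !addr0 add0r.
Qed.

Lemma has_W_csnd p : has_W (fun q : C * C => conjc q.2 : C) p 0.
Proof.
have := has_W_lin 0 0 0 1 p; rewrite !mulr0 addr0 scaler0; congr (has_W _ _ _).
by apply/funext => q; rewrite /wlin mul1r !mul0r !add0r.
Qed.

(** Expresses the real area through coordinates and their conjugates, to which the rules for W
    apply. *)
Lemma areaC p : ((area p)%:C)%C = (2 * imC R)^-1 * ((conjc p.1 : C) * p.2 - p.1 * (conjc p.2 : C)).
Proof.
have i0 : imC R != 0 by rewrite eq_complex /= negb_and oner_eq0 orbT.
have c2 := natC_neq0 R 1; have ci : 2 * imC R != 0 by rewrite mulf_neq0.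
apply: (mulfI ci); rewrite mulrA divff// mul1r /area.
case: p => -[a b] [c d]; rewrite natC /imC.
by apply/eqP; rewrite eq_complex /=; apply/andP; split; apply/eqP; ring.
Qed.

Lemma oriented_area_neq0 p : oriented_basis p -> ((area p)%:C)%C != 0 :> C.
Proof. by move=> op; rewrite -normr_eq0 normrZC normr_eq0 gt_eqF. Qed.

Lemma has_W_eq F p (u v : C) : u = v -> has_W F p u -> has_W F p v.
Proof. by move->. Qed.

Lemma has_W_area p : has_W (fun q : C * C => ((area q)%:C)%C : C) p 0.
Proof.
have H := has_WM (has_W_cst (2 * imC R)^-1 p) (has_WD (has_WM (has_W_cfst p) (has_W_snd p))
  (has_WM (has_W_cst (-1) p) (has_WM (has_W_fst p) (has_W_csnd p)))).
have E : (fun q : C * C => ((area q)%:C)%C : C) =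
   (fun q => (2 * imC R)^-1 * ((conjc q.1 : C) * q.2 + -1 * (q.1 * (conjc q.2 : C)))).
  by apply/funext => q; rewrite areaC mulN1r.
rewrite E; apply: has_W_eq H; rewrite !scaleCE; ring.
Qed.

Lemma slopeE p : slope p = ((pi : R)%:C)%C * (((area p)%:C)%C : C)^-1 * (conjc p.1 : C) * p.1^-1.
Proof. by rewrite /slope scaleCE (rmorphM (real_complex R)) /= realCV mulrA. Qed.

Lemma has_W_inv F p u : F p != 0 -> has_W F p u -> has_W (fun q => (F q)^-1) p (- F p ^- 2 * u).
Proof. by move=> F0; apply: has_W_comp; exact: holo_inv. Qed.

Lemma has_W_slope p : oriented_basis p -> has_W (@slope R) p (slope p ^+ 2).
Proof.
move=> op; have p0 := oriented_neq0 op; have A0 := oriented_area_neq0 op.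
have H := has_WM (has_WM (has_WM (has_W_cst ((pi : R)%:C)%C p) (has_W_inv A0 (has_W_area p)))
  (has_W_cfst p)) (has_W_inv p0 (has_W_fst p)).
rewrite [X in has_W X](_ : @slope R = fun q => ((pi : R)%:C)%C * (((area q)%:C)%C : C)^-1 * (conjc q.1 : C) * q.1^-1);
  last by apply/funext => q; rewrite slopeE.
apply: has_W_eq H; rewrite slopeE scaleCE (rmorphN (real_complex R)) (rmorphM (real_complex R)) /= realCV.
move: (((pi : R)%:C)%C : C) (((area p)%:C)%C : C) (conjc p.1 : C) (p.1) p0 A0 => P A c w w0 A0.
by field; rewrite ?w0 ?A0.
Qed.

(** The numerator conj(omega_1) omega_2 - omega_1 conj(omega_2) is 2i a(L), which cancels the 1/a(L)
    in W. *)
Lemma has_W_tau p : oriented_basis p -> has_W (@tau R) p (tpi R / p.1 ^+ 2).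
Proof.
move=> op; have p0 := oriented_neq0 op; have A0 := oriented_area_neq0 op.
have H := has_WM (has_W_snd p) (has_W_inv p0 (has_W_fst p)).
apply: has_W_eq H; rewrite !scaleCE (rmorphN (real_complex R)) (rmorphM (real_complex R)) /= realCV.
have i0 : imC R != 0 by rewrite eq_complex /= negb_and oner_eq0 orbT.
have c2 := natC_neq0 R 1; have ci : 2 * imC R != 0 by rewrite mulf_neq0.
have tE : tpi R = ((pi : R)%:C)%C * (2 * imC R).
  by rewrite /tpi /imC natC; apply/eqP; rewrite eq_complex /=; apply/andP; split; apply/eqP; ring.
have AE : 2 * imC R * ((area p)%:C)%C = (conjc p.1 : C) * p.2 - p.1 * (conjc p.2 : C).
  by rewrite areaC mulrA divff// mul1r.
rewrite tE; move: (((pi : R)%:C)%C : C) => P.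
have -> : P * (2 * imC R) / p.1 ^+ 2 = P * (((area p)%:C)%C : C)^-1 * (2 * imC R * ((area p)%:C)%C) / p.1 ^+ 2.
  by field; rewrite ?p0 ?A0.
rewrite AE; move: (((area p)%:C)%C : C) (conjc p.1 : C) (conjc p.2 : C) (p.1) p0 A0 => A c c' w w0 A0.
by field; rewrite ?w0 ?A0.
Qed.

Lemma has_W_hol a b p : oriented_basis p ->
  has_W (hol a b) p (hol a.+1 b.+1 p + (a + b).+1%:R * slope p * hol a b p).
Proof.
move=> op; have p0 := oriented_neq0 op; have t0 := im_tau_gt0 op.
pose c : C := (a == 0)%:R * beta b + (b == 0)%:R * beta a.
have H1 := has_WX (a + b).+1 (has_WM (has_W_cst (tpi R) p) (has_W_inv p0 (has_W_fst p))).
have H2 := has_WD (has_W_comp (qsum_holo a b t0) (has_W_tau op)) (has_W_cst c p).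
have H := has_WM H1 H2.
rewrite [X in has_W X](_ : @hol R a b = (fun q => (tpi R * q.1^-1) ^+ (a + b).+1 * (qsum a b (tau q) + c))); last first.
  by apply/funext => q; rewrite hol.unlock addrA.
apply: has_W_eq H; rewrite !hol.unlock slopeE scaleCE (rmorphN (real_complex R)) (rmorphM (real_complex R)) /= realCV.
rewrite !mul0r !addr0 addrA -/c addSn addnS.
clear H1 H2.
move: (qsum a b _) (qsum a.+1 b.+1 _) c (a + b)%N => q q' c' n.
move: (((area p)%:C)%C : C) (((pi : R)%:C)%C : C) (conjc p.1 : C) (p.1) p0 (oriented_area_neq0 op) => A P d w w0 A0.
rewrite !exprS; move: ((tpi R / w) ^+ n) => Z.
by field; rewrite ?w0 ?A0.
Qed.

End HolomorphicDerivatives.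

(** * The functions g as transforms, and their behaviour under the shear *)

Section Twisted.
Variable R : realType.
Local Notation C := (Rcomplex R).
Local Notation cn := (@Num.norm
  (Num_RealClosedField__to__Num_POrderedZmodule (reals_Real__to__Num_RealClosedField R))
  (complex_Rcomplex__canonical__Num_SemiNormedZmodule (reals_Real__to__Num_RealClosedField R))).
Implicit Types (p q : C * C).

Lemma holC a b p : oriented_basis p -> hol a b p = hol b a p.
Proof.
move=> op; rewrite !hol.unlock (qsumC a b (im_tau_gt0 op)) addnC; congr (_ * _).
by rewrite -!addrA [X in _ + X]addrC.
Qed.

Lemma hol_even a b p : oriented_basis p -> ~~ odd (a + b) -> hol a b p = 0.
Proof.
move=> op ab; rewrite hol.unlock qsum_even ?im_tau_gt0// add0r.
suff H i j : ~~ odd (i + j) -> (i == 0)%:R * zeta_neg R j = 0.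
  by rewrite H// H 1?addnC// addr0 mulr0.
by case: i => [|i] ij; rewrite ?mul0r// zeta_neg_even// mulr0.
Qed.

Lemma has_W_twist a b p : oriented_basis p ->
  has_W (fun q => twist (slope q) (fun i j => hol i j q) a b) p
    (twist (slope p) (fun i j => hol i j p) a.+1 b.+1).
Proof.
move=> op; have s1 := has_W_slope op.
have H1 := has_W_bigop (index_enum 'I_a.+1) (fun k => has_WM
  (has_WM (has_W_cst (('C(a, k) * 'C(b, k) * k`!)%:R : C) p) (has_WX k s1))
  (has_W_hol (a - k)%N (b - k)%N op)).
have H2 := has_WM (has_W_cst (- (((a == b.+1) || (b == a.+1))%:R * (minn a b)`!%:R) : C) p)
  (has_WX (minn a b).+1 s1).
have := has_WD H1 H2; rewrite [X in has_W X]/=.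
rewrite [X in has_W X](_ : _ = fun q => twist (slope q) (fun i j => hol i j q) a b); last first.
  by apply/funext => q; rewrite /twist mulNr.
apply: has_W_eq; rewrite twist_SS !mul0r !addr0; congr (_ + _); last first.
  rewrite mulNr; congr (- (_ * _)); rewrite succnK !exprS; ring.
apply: eq_bigr => k _ /=; rewrite mul0r addr0.
move: (hol (a - k).+1 _ _) (hol (a - k) _ _) (a - k + (b - k)).+1 ('C(a, k) * 'C(b, k) * k`!)%N => x y M N.
by case: (nat_of_ord k) => [|j]; rewrite ?succnK ?exprS; ring.
Qed.

(** Induction on min(a, b), one application of W per step. At the start, the correction -s in e_2^*
    is the Kronecker term of [twist] at indices (0, 1). *)
Lemma g_twist a b p : oriented_basis p -> odd (a + b) ->
  g a b p = twist (slope p) (fun i j => hol i j p) a b.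
Proof.
suff H d i q : oriented_basis q -> odd d -> d`!%:R * iter i (@W R) (@eisenstein_star R d.+1) q =
    twist (slope q) (fun i j => hol i j q) i (i + d).
  move=> op ab; rewrite /g ab; case: (leqP a b) => [le|/ltnW le].
    by rewrite H// ?subnKC// oddB// addbC -oddD.
  rewrite (@twistC _ (slope p) (fun i j => hol i j p)); last by move=> i j; exact: holC.
  by rewrite H// ?subnKC// oddB// -oddD.
move=> oq od; elim: i q oq => [|i IH] q oq.
  rewrite /= twist0l add0n eisenstein_starE// mulrBr mulrC divfK ?factC_neq0//.
  by congr (_ - _); case: eqP => [->|_]; rewrite ?fact0 ?mul1r// !mul0r mulr0.
rewrite iterS addSn.
have f0 := factC_neq0 R d.
have H := has_WM (has_W_cst ((d`!%:R)^-1 : C) q) (has_W_twist i (i + d) oq).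
have H' : has_W (iter i (@W R) (@eisenstein_star R d.+1)) q _ := has_W_ext oq
  (fun x ox => etrans (congr1 ( *%R _) (esym (IH x ox))) (mulKf f0 _)) H.
by rewrite (has_W_W H') mul0r addr0 mulVKf.
Qed.

Lemma g_even a b p : ~~ odd (a + b) -> g a b p = 0.
Proof. by move=> ab; rewrite /g (negPf ab). Qed.

Lemma gC a b p : g a b p = g b a p.
Proof. by rewrite /g addnC minnC maxnC. Qed.

Lemma has_W_g a b p : oriented_basis p -> odd (a + b) -> has_W (g a b) p (g a.+1 b.+1 p).
Proof.
move=> op ab; rewrite g_twist// ?addSn ?addnS/= ?negbK//.
apply: has_W_ext op _ (has_W_twist a b op) => q oq; by rewrite g_twist.
Qed.

Definition shear p : C * C := (p.1 + p.2, p.2).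

Lemma shear_area p : area (shear p) = area p.
Proof.
by case: p => -[a b] [c d]; rewrite /area /shear /=; ring.
Qed.

Lemma shear_oriented p : oriented_basis p -> oriented_basis (shear p).
Proof. by rewrite /oriented_basis shear_area. Qed.

(* W is equivariant under SL_2(Z). *)
Lemma has_W_shear F p w : has_W F (shear p) w -> has_W (F \o shear) p w.
Proof.
move=> [a [a' [b [b' [[r [M [r0 M0 H]]] ->]]]]].
exists a, a', (a + b), (a' + b'); split; last first.
  rewrite shear_area; congr (_ *: _); rewrite /shear /= (raddfD (@conjc R)) /=; ring.
exists (r / 2), (M * 4); split; [by rewrite divr_gt0|by rewrite mulr_ge0|] => d hd.
have E : shear (p + d) = shear p + shear d.
  by rewrite /shear /= addrACA.
have sd : size2 (shear d) <= 2 * size2 d.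
  rewrite /size2 /shear /=; have := ler_normD d.1 d.2; have := normr_ge0 d.1; lra.
have := H (shear d); rewrite -E => H'.
have -> : wlin a a' (a + b) (a' + b') d = wlin a a' b b' (shear d).
  rewrite /wlin /shear /= (raddfD (@conjc R)) /=; ring.
apply: le_trans (H' _) _; first by apply: le_trans sd _; lra.
rewrite -mulrA; apply: ler_wpM2l => //.
have -> : 4 * size2 d ^+ 2 = (2 * size2 d) ^+ 2 by ring.
by apply: lerXn2r; rewrite ?nnegrE ?size2_ge0// mulr_ge0 ?size2_ge0.
Qed.

(** W commutes with the shear, so invariance of g_{0,d} propagates to its iterated images under
    W. *)
Lemma g_shear_iter a d p : odd d -> (forall q, oriented_basis q -> g 0 d (shear q) = g 0 d q) ->
  oriented_basis p -> g a (a + d) (shear p) = g a (a + d) p.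
Proof.
move=> od H; elim: a p => [|a IH] p op; first exact: H.
have oa : odd (a + (a + d)) by rewrite addnA oddD addnn odd_double.
have H1 := has_W_shear (has_W_g (shear_oriented op) oa).
have H2 : has_W (g a (a + d)) p _ := has_W_ext op IH H1.
by rewrite addSn -(has_W_W H2) (has_W_W (has_W_g op oa)).
Qed.

End Twisted.

(** * Identity (i) for the holomorphic functions *)

Lemma int_eps_sgz (m n : int) : m * n != 0 -> 2 * int_eps m n = sgz m + sgz n.
Proof.
rewrite mulf_eq0 negb_or /int_eps -sgz_gt0 sgzM => /andP[m0 n0].
by case: (sgzP m) m0 => // m0 _; case: (sgzP n) n0.
Qed.

Lemma int_eps0 (m n : int) : m * n = 0 -> int_eps m n = 0.
Proof. by rewrite /int_eps => ->; rewrite ltxx. Qed.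

(* The forms are A = E - C, B, C, D = F - B, E, F; this is
   (sE + sD)(sA + sB) = (sB - sC)(sE + sF) + (sC + sD)(sA + sF) for their signs. *)
Lemma eps_identity (B C E F : int) : B != 0 -> C != 0 -> E != 0 -> F != 0 -> E - C != 0 -> F - B != 0 ->
  int_eps (F - B) E * int_eps B (E - C) =
  int_eps B (- C) * int_eps F E + int_eps C (F - B) * int_eps F (E - C).
Proof.
move=> B0 C0 E0 F0 A0 D0; apply: (@mulfI _ 4) => //.
rewrite mulrDr.
have M x y z w : 4 * (int_eps x y * int_eps z w) = (2 * int_eps x y) * (2 * int_eps z w) by ring.
rewrite !M !int_eps_sgz ?mulf_neq0 ?oppr_eq0// sgzN.
case: (sgzP B) B0 => // hB _; case: (sgzP C) C0 => // hC _; case: (sgzP E) E0 => // hE _;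
case: (sgzP F) F0 => // hF _; case: (sgzP (E - C)) A0 => // hA _; case: (sgzP (F - B)) D0 => // hD _;
by [|lia].
Qed.

(** Collapses the sum over the splittings of an index into a power of x + y; this is how each sum in
    (i) becomes a single monomial in linear forms. *)
Lemma binomial_product (A : comNzRingType) (x y : A) n i j :
  \sum_(k < n.+1) 'C(n, k)%:R * (x ^+ (n - k + i) * y ^+ (k + j)) = x ^+ i * y ^+ j * (x + y) ^+ n.
Proof.
rewrite exprDn mulr_sumr; apply: eq_bigr => k _.
by rewrite !exprD -mulr_natl; ring.
Qed.

Section Reciprocity.
Variable A : comNzRingType.
Implicit Types G : nat -> nat -> A.

Definition reciprocity1 G a b c d e f : A :=
  \sum_(a1 < a.+1) \sum_(d1 < d.+1)
    (-1) ^+ (c + d1 + 1) * 'C(a, a1)%:R * 'C(d, d1)%:R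
    * G (a - a1 + c)%N (b + d1)%N * G (a1 + e)%N (d - d1 + f)%N.

Definition reciprocity2 G a b c d e f : A :=
  \sum_(b1 < b.+1) \sum_(e1 < e.+1)
    (-1) ^+ (b - b1 + 1) * 'C(b, b1)%:R * 'C(e, e1)%:R
    * G (b - b1 + d)%N (c + e1)%N * G (a + (e - e1))%N (b1 + f)%N.

Definition reciprocity3 G a b c d e f : A :=
  \sum_(c1 < c.+1) \sum_(f1 < f.+1)
    (-1) ^+ c1 * 'C(c, c1)%:R * 'C(f, f1)%:R
    * G (c - c1 + e)%N (d + f1)%N * G (a + c1)%N (b + (f - f1))%N.

Definition reciprocity G a b c d e f : A :=
  reciprocity1 G a b c d e f + reciprocity2 G a b c d e f + reciprocity3 G a b c d e f.

Lemma sum_product n m (F : nat -> A) (H : nat -> A) (s : A) (K : 'I_n.+1 -> 'I_m.+1 -> A) :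
  (forall k l, K k l = s * (F k * H l)) ->
  \sum_(k < n.+1) \sum_(l < m.+1) K k l = s * ((\sum_(k < n.+1) F k) * (\sum_(l < m.+1) H l)).
Proof.
move=> HK; rewrite big_distrlr /= mulr_sumr; apply: eq_bigr => k _; rewrite mulr_sumr.
by apply: eq_bigr => l _; rewrite HK.
Qed.

End Reciprocity.

Section ReciprocityForms.
Variable R : realType.
Local Notation C := (Rcomplex R).
Local Notation im := (@complex.Im R).
Implicit Types t : C.

Lemma has_sum_bij (I K : choiceType) (h : I -> K) (h' : K -> I) (f : K -> C) l :
  cancel h h' -> cancel h' h -> has_sum f l -> has_sum (f \o h) l.
Proof.
move=> hK h'K H; apply: (@has_sum_reindex _ _ _ h' (f \o h)); first exact: can_inj h'K.
  by move=> k _; exists (h k); rewrite hK.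
by apply: eq_has_sum H => k /=; rewrite h'K.
Qed.

Lemma has_sum_qterm2 t i j i' j' : 0 < im t ->
  has_sum (fun u : (int * int) * (int * int) => qterm i j t u.1 * qterm i' j' t u.2)
    (qsum i j t * qsum i' j' t).
Proof. by move=> t0; rewrite qsum.unlock; apply: sumM; exact: summable_qterm. Qed.

(** Both products m n are positive where the coefficient is nonzero, so the absolute values in the
    exponents add up. *)
Lemma qterm2E t i j i' j' (m1 n1 m2 n2 : int) :
  qterm i j t (m1, n1) * qterm i' j' t (m2, n2) =
  (int_eps m1 n1 * int_eps m2 n2)%:~R * ee t ^+ absz (m1 * n1 + m2 * n2) *
  (m1%:~R ^+ j * n1%:~R ^+ i * (m2%:~R ^+ j' * n2%:~R ^+ i')).
Proof.
rewrite /qterm /=; have [e1|e1] := boolP (0 < m1 * n1); last first.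
  by rewrite /int_eps (negPf e1) !mul0r.
have [e2|e2] := boolP (0 < m2 * n2); last by rewrite /int_eps (negPf e2) !(mulr0, mul0r).
have -> : absz (m1 * n1 + m2 * n2) = (absz (m1 * n1)%R + absz (m2 * n2)%R)%N by lia.
by rewrite exprD intrM; ring.
Qed.

Lemma has_sum_qterm2_comb t n m (cf : nat -> nat -> C) (i j i' j' : nat -> nat -> nat) : 0 < im t ->
  has_sum (fun u : (int * int) * (int * int) =>
      \sum_(k < n.+1) \sum_(l < m.+1)
        cf k l * qterm (i k l) (j k l) t u.1 * qterm (i' k l) (j' k l) t u.2)
    (\sum_(k < n.+1) \sum_(l < m.+1) cf k l * qsum (i k l) (j k l) t * qsum (i' k l) (j' k l) t).
Proof.
move=> t0; apply: has_sum_bigop => k _; apply: has_sum_bigop => l _.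
rewrite -mulrA; apply: eq_has_sum (has_sumZ (cf k l) (has_sum_qterm2 _ _ _ _ t0)) => u.
by rewrite mulrA.
Qed.

Section Fixed.
Variables (a b c d e f : nat) (t : C).
Hypothesis t0 : 0 < im t.

(** The forms A = E - C, B, C, D = F - B, E, F, each raised to the index with the same letter. The
    three sums of (i) share this monomial and the exponent |EF - BC|. *)
Let monomial (B C0 E F : int) : C :=
  (E - C0)%:~R ^+ a * B%:~R ^+ b * C0%:~R ^+ c * (F - B)%:~R ^+ d * E%:~R ^+ e * F%:~R ^+ f.

Let term (B C0 E F : int) (s : int) : C :=
  s%:~R * ee t ^+ absz (E * F - B * C0)%R * monomial B C0 E F.

Local Notation Z4 := ((int * int) * (int * int))%type.

(** The two factors are taken at (m, n) = (B, -C) and (F, E); the binomial sums over [a1] and [d1]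
    produce the forms E - C and F - B. *)
Lemma has_sum_reciprocity1 :
  has_sum (fun w : Z4 => term w.1.1 w.1.2 w.2.1 w.2.2
     (- (int_eps w.1.1 (- w.1.2) * int_eps w.2.2 w.2.1)))
   (reciprocity1 (fun i j => qsum i j t) a b c d e f).
Proof.
have H := has_sum_qterm2_comb a d (fun k l => (-1) ^+ (c + l + 1) * 'C(a, k)%:R * 'C(d, l)%:R)
  (fun k l => (a - k + c)%N) (fun k l => (b + l)%N) (fun k l => (k + e)%N) (fun k l => (d - l + f)%N) t0.
pose h (w : Z4) : Z4 := ((w.1.1, - w.1.2), (w.2.2, w.2.1)).
have hK : cancel h h by move=> [[B C0] [E F]]; rewrite /h /= opprK.
apply: eq_has_sum (has_sum_bij hK hK H) => -[[B C0] [E F]] /=.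
rewrite (sum_product (s := - (int_eps B (- C0) * int_eps F E)%:~R * ee t ^+ absz (E * F - B * C0)%R * (-1) ^+ (b + c))
  (F := fun k => 'C(a, k)%:R * ((- C0)%:~R ^+ (a - k + c) * E%:~R ^+ (k + e)))
  (H := fun l => 'C(d, l)%:R * (F%:~R ^+ (d - l + f) * (- B)%:~R ^+ (l + b)))).
  rewrite !binomial_product /term /monomial -!intrD [- C0 + E]addrC !rmorphN /= [(- B%:~R) ^+ b]exprNn [(- C0%:~R) ^+ c]exprNn.
  rewrite exprD; move: (sqrr_sign C b) (sqrr_sign C c); move: ((-1) ^+ b : C) ((-1) ^+ c : C) => x y hx hy.
  transitivity (- (int_eps B (- C0) * int_eps F E)%:~R * ee t ^+ absz (E * F - B * C0)%R * x ^+ 2 * y ^+ 2 *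
    (C0%:~R ^+ c * E%:~R ^+ e * (E - C0)%:~R ^+ a * (F%:~R ^+ f * B%:~R ^+ b * (F - B)%:~R ^+ d))); first by ring.
  by rewrite hx hy; ring.
move=> k l; rewrite -mulrA qterm2E.
have -> : B * - C0 + F * E = E * F - B * C0 by ring.
have -> : (-1) ^+ (c + l + 1) = - ((-1) ^+ (b + c) * (-1) ^+ (l + b)) :> C.
  rewrite -exprD (_ : (b + c + (l + b) = c + l + b.*2)%N); last by rewrite -addnn; ring.
  by rewrite addn1 exprS mulN1r [in RHS]exprD -[b.*2]muln2 mulnC exprM sqrrN expr1n expr1n mulr1.
rewrite (mulrNz 1 B) [(- B%:~R) ^+ _]exprNn [(b + l)%N]addnC; ring.
Qed.

(** The pairs are (C, F - B) and (F, E - C); the binomial sums produce B and E. *)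
Lemma has_sum_reciprocity2 :
  has_sum (fun w : Z4 => term w.1.1 w.1.2 w.2.1 w.2.2
     (- (int_eps w.1.2 (w.2.2 - w.1.1) * int_eps w.2.2 (w.2.1 - w.1.2))))
   (reciprocity2 (fun i j => qsum i j t) a b c d e f).
Proof.
have H := has_sum_qterm2_comb b e (fun k l => (-1) ^+ (b - k + 1) * 'C(b, k)%:R * 'C(e, l)%:R)
  (fun k l => (b - k + d)%N) (fun k l => (c + l)%N) (fun k l => (a + (e - l))%N) (fun k l => (k + f)%N) t0.
pose h (w : Z4) : Z4 := ((w.1.2, w.2.2 - w.1.1), (w.2.2, w.2.1 - w.1.2)).
pose h' (u : Z4) : Z4 := ((u.2.1 - u.1.2, u.1.1), (u.2.2 + u.1.1, u.2.1)).
have hK : cancel h h' by move=> [[B C0] [E F]]; rewrite /h /h' /= subKr subrK.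
have h'K : cancel h' h by move=> [[B C0] [E F]]; rewrite /h /h' /= subKr addrK.
apply: eq_has_sum (has_sum_bij hK h'K H) => -[[B C0] [E F]] /=.
rewrite (sum_product (s := - (int_eps C0 (F - B) * int_eps F (E - C0))%:~R * ee t ^+ absz (E * F - B * C0)%R * (-1) ^+ d)
  (F := fun k => 'C(b, k)%:R * ((- (F - B))%:~R ^+ (b - k + d) * F%:~R ^+ (k + f)))
  (H := fun l => 'C(e, l)%:R * ((E - C0)%:~R ^+ (e - l + a) * C0%:~R ^+ (l + c)))).
  rewrite !binomial_product /term /monomial -!intrD [- (F - B) + F]addrC subKr subrK (mulrNz 1 (F - B)) [(- (F - B)%:~R) ^+ d]exprNn.
  move: (sqrr_sign C d); move: ((-1) ^+ d : C) => x hx.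
  transitivity (- (int_eps C0 (F - B) * int_eps F (E - C0))%:~R * ee t ^+ absz (E * F - B * C0)%R * x ^+ 2 *
    ((F - B)%:~R ^+ d * F%:~R ^+ f * B%:~R ^+ b * ((E - C0)%:~R ^+ a * C0%:~R ^+ c * E%:~R ^+ e))); first by ring.
  by rewrite hx; ring.
move=> k l; rewrite -mulrA qterm2E.
have -> : C0 * (F - B) + F * (E - C0) = E * F - B * C0 by ring.
have -> : (-1) ^+ (b - k + 1) = - ((-1) ^+ d * (-1) ^+ (b - k + d)) :> C.
  by rewrite addn1 exprS mulN1r -exprD addnC -addnA addnn exprD -[d.*2]muln2 mulnC exprM sqrrN expr1n expr1n mulr1.
rewrite (mulrNz 1 (F - B)) [(- (F - B)%:~R) ^+ _]exprNn [(c + l)%N]addnC [(a + _)%N]addnC; ring.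
Qed.

(** The pairs are (F - B, E) and (B, E - C); the binomial sums produce C and F. *)
Lemma has_sum_reciprocity3 :
  has_sum (fun w : Z4 => term w.1.1 w.1.2 w.2.1 w.2.2
     (int_eps (w.2.2 - w.1.1) w.2.1 * int_eps w.1.1 (w.2.1 - w.1.2)))
   (reciprocity3 (fun i j => qsum i j t) a b c d e f).
Proof.
have H := has_sum_qterm2_comb c f (fun k l => (-1) ^+ k * 'C(c, k)%:R * 'C(f, l)%:R)
  (fun k l => (c - k + e)%N) (fun k l => (d + l)%N) (fun k l => (a + k)%N) (fun k l => (b + (f - l))%N) t0.
pose h (w : Z4) : Z4 := ((w.2.2 - w.1.1, w.2.1), (w.1.1, w.2.1 - w.1.2)).
pose h' (u : Z4) : Z4 := ((u.2.1, u.1.2 - u.2.2), (u.1.2, u.1.1 + u.2.1)).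
have hK : cancel h h' by move=> [[B C0] [E F]]; rewrite /h /h' /= subKr subrK.
have h'K : cancel h' h by move=> [[B C0] [E F]]; rewrite /h /h' /= subKr addrK.
apply: eq_has_sum (has_sum_bij hK h'K H) => -[[B C0] [E F]] /=.
rewrite (sum_product (s := (int_eps (F - B) E * int_eps B (E - C0))%:~R * ee t ^+ absz (E * F - B * C0)%R * (-1) ^+ a)
  (F := fun k => 'C(c, k)%:R * (E%:~R ^+ (c - k + e) * (- (E - C0))%:~R ^+ (k + a)))
  (H := fun l => 'C(f, l)%:R * (B%:~R ^+ (f - l + b) * (F - B)%:~R ^+ (l + d)))).
  rewrite !binomial_product /term /monomial -!intrD subKr [B + _]addrC subrK (mulrNz 1 (E - C0)) [(- (E - C0)%:~R) ^+ a]exprNn.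
  move: (sqrr_sign C a); move: ((-1) ^+ a : C) => x hx.
  transitivity ((int_eps (F - B) E * int_eps B (E - C0))%:~R * ee t ^+ absz (E * F - B * C0)%R * x ^+ 2 *
    (E%:~R ^+ e * (E - C0)%:~R ^+ a * C0%:~R ^+ c * (B%:~R ^+ b * (F - B)%:~R ^+ d * F%:~R ^+ f))); first by ring.
  by rewrite hx; ring.
move=> k l; rewrite -mulrA qterm2E.
have -> : (F - B) * E + B * (E - C0) = E * F - B * C0 by ring.
have -> : (-1) ^+ k = (-1) ^+ a * (-1) ^+ (k + a) :> C.
  by rewrite -exprD addnCA addnn exprD -[a.*2]muln2 mulnC exprM sqrrN expr1n expr1n mulr1.
rewrite (mulrNz 1 (E - C0)) [(- (E - C0)%:~R) ^+ _]exprNn [(d + l)%N]addnC [(a + _)%N]addnC [(b + _)%N]addnC; ring.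
Qed.

Lemma reciprocity_qsum : (0 < a)%N -> (0 < b)%N -> (0 < c)%N -> (0 < d)%N -> (0 < e)%N -> (0 < f)%N ->
  reciprocity (fun i j => qsum i j t) a b c d e f = 0.
Proof.
move=> a0 b0 c0 d0 e0 f0.
have H := has_sumD (has_sumD has_sum_reciprocity1 has_sum_reciprocity2) has_sum_reciprocity3.
apply: (has_sum_uniq H); apply: eq_has_sum; last exact: has_sum0.
move=> -[[B C0] [E F]] /=; apply/esym.
rewrite /term -!mulrDl -!intrD.
(* Where the monomial vanishes nothing is left to show; elsewhere the exponents, being positive,
   force all six forms to be nonzero, as [eps_identity] requires. *)
have [M0|M0] := eqVneq (monomial B C0 E F) 0; first by rewrite M0 mulr0.
have nz n (x : int) : (0 < n)%N -> (x%:~R : C) ^+ n != 0 -> x != 0.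
  by move=> n0; apply: contra_neq => ->; rewrite expr0n gtn_eqF.
move: M0; rewrite /monomial !mulf_eq0 !negb_or => /andP[/andP[/andP[/andP[/andP[A0 B0] C0'] D0] E0] F0].
rewrite eps_identity ?(nz _ _ _ A0) ?(nz _ _ _ B0) ?(nz _ _ _ C0') ?(nz _ _ _ D0) ?(nz _ _ _ E0) ?(nz _ _ _ F0)//.
by rewrite (_ : _ + _ = 0) ?mul0r//; ring.
Qed.

End Fixed.

End ReciprocityForms.

(** * Identity (ii) *)

Definition dterm (R : realType) i j (t : Rcomplex R) (mn : nat * nat) : Rcomplex R :=
  mn.1.+1%:R ^+ i * mn.2.+1%:R ^+ j * ee t ^+ (mn.1.+1 * mn.2.+1).

HB.lock Definition dsum (R : realType) i j (t : Rcomplex R) : Rcomplex R := sum (dterm i j t).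

Definition vterm (R : realType) i j k (t : Rcomplex R) (mn : nat * nat) : Rcomplex R :=
  mn.1.+1%:R ^+ i * mn.2.+1%:R ^+ j * (\sum_(l < mn.2) l.+1%:R ^+ k) * ee t ^+ (mn.1.+1 * mn.2.+1).

(** [vterm] with its inner sum opened: u + 1 < u + v + 2 parametrizes the pairs of positive integers
    in increasing order. *)
Definition tterm (R : realType) i j k (t : Rcomplex R) (w : nat * (nat * nat)) : Rcomplex R :=
  w.1.+1%:R ^+ i * (w.2.1 + w.2.2).+2%:R ^+ j * w.2.1.+1%:R ^+ k
  * ee t ^+ (w.1.+1 * (w.2.1 + w.2.2).+2).

HB.lock Definition vsum (R : realType) i j k (t : Rcomplex R) : Rcomplex R := sum (tterm i j k t).

(** * Sums over positive indices *)

Section PositiveSums.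
Variable R : realType.
Local Notation C := (Rcomplex R).
Local Notation cn := (@Num.norm
  (Num_RealClosedField__to__Num_POrderedZmodule (reals_Real__to__Num_RealClosedField R))
  (complex_Rcomplex__canonical__Num_SemiNormedZmodule (reals_Real__to__Num_RealClosedField R))).
Local Notation im := (@complex.Im R).
Implicit Types t : C.

(** On the support, [s] exchanges [P] with its complement, so the part where [P] holds carries half
    of the sum. *)
Lemma has_sum_even (I : choiceType) (s : I -> I) (P : pred I) (f : I -> C) l :
  involutive s -> (forall i, f (s i) = f i) -> (forall i, f i != 0 -> P (s i) = ~~ P i) ->
  has_sum (fun i => (P i)%:R * f i) l -> has_sum f (2 * l).
Proof.
move=> sK fs Ps H; have H2 := has_sum_bij sK sK H.
rewrite mulr_natl mulr2n; apply: eq_has_sum (has_sumD H H2) => i /=.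
rewrite fs; have [->|fi] := eqVneq (f i) 0; first by rewrite !mulr0 addr0.
by rewrite Ps//; case: (P i); rewrite /= mul1r mul0r ?addr0 ?add0r.
Qed.

Lemma has_sum_odd (I : choiceType) (s : I -> I) (f : I -> C) :
  involutive s -> (forall i, f (s i) = - f i) -> abs_summable f -> has_sum f 0.
Proof.
move=> sK fs /abs_has_sum H; have H2 := has_sum_bij sK sK H.
have H3 : has_sum f (- sum f) by apply: eq_has_sum (has_sumN H2) => i; rewrite /= fs opprK.
have E := has_sum_uniq H H3.
suff E0 : sum f = 0 by move: H; rewrite E0.
have : 2%:R * sum f = 0 by rewrite mulr_natl mulr2n {1}E addNr.
by move/eqP; rewrite mulf_eq0 (negPf (natC_neq0 R 1)) => /eqP.
Qed.

Lemma qterm_pos i j t m n : qterm i j t (Posz m.+1, Posz n.+1) = dterm j i t (m, n).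
Proof. by rewrite /qterm int_eps_pos /= mul1r. Qed.

Lemma summable_dterm i j t : 0 < im t -> abs_summable (dterm i j t).
Proof.
move=> t0; have I : injective (fun mn : nat * nat => (Posz mn.1.+1, Posz mn.2.+1)).
  by move=> [m n] [m' n'] [-> ->].
have := abs_summable_reindex I (summable_qterm j i t0); congr (abs_summable _).
by apply/funext => -[m n]; rewrite /= qterm_pos.
Qed.

Lemma has_sum_dterm i j t : 0 < im t -> has_sum (dterm i j t) (dsum i j t).
Proof. by move=> t0; rewrite dsum.unlock; exact: abs_has_sum (summable_dterm i j t0). Qed.

Lemma dsumC i j t : 0 < im t -> dsum i j t = dsum j i t.
Proof.
move=> t0; pose s (mn : nat * nat) := (mn.2, mn.1).
have sK : cancel s s by case.
apply: has_sum_uniq (has_sum_dterm j i t0).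
apply: eq_has_sum (has_sum_bij sK sK (has_sum_dterm i j t0)) => -[m n].
by rewrite /dterm /= mulnC [_ ^+ i * _]mulrC.
Qed.

Lemma qsum_dsum a b t : 0 < im t -> odd (a + b) -> qsum a b t = 2 * dsum b a t.
Proof.
move=> t0 ab; rewrite qsum.unlock; apply/sumP.
apply: (@has_sum_even _ (fun w : int * int => (- w.1, - w.2)) (fun w => 0 < w.1)).
- by move=> [m n] /=; rewrite !opprK.
- move=> [m n]; rewrite /qterm /= mulrNN /int_eps mulrNN sgzN.
  rewrite !(mulrNz 1) [(- _) ^+ b]exprNn [(- _) ^+ a]exprNn.
  have s1 : (-1) ^+ b * (-1) ^+ a = -1 :> C by rewrite -exprD addnC -signr_odd ab expr1.
  case: ifP => _; last by rewrite !mul0r.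
  rewrite mulrNz; transitivity (- (sgz m)%:~R * ((-1) ^+ b * (-1) ^+ a) * m%:~R ^+ b * n%:~R ^+ a * ee t ^+ absz (m * n) :> C).
    by ring.
  by rewrite s1 mulrNN mulr1.
- move=> [m n]; rewrite /qterm /= oppr_gt0 -leNgt le_eqVlt => h.
  suff -> : m == 0 = false by [].
  by apply: contra_neqF h => /eqP ->; rewrite int_eps0 ?mul0r.
have I : injective (fun mn : nat * nat => (Posz mn.1.+1, Posz mn.2.+1)).
  by move=> [m n] [m' n'] [-> ->].
apply: (has_sum_reindex I).
  move=> [m n] /=; have [m0|m0] := boolP (0 < m); last by rewrite mul0r eqxx.
  have [n0 _|n0] := boolP (0 < n).
    by case: m m0 => // -[//|m] _; case: n n0 => // -[//|n] _; exists (m, n).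
  by rewrite /qterm /int_eps /= pmulr_rgt0// (negPf n0) !mul0r mulr0 eqxx.
by apply: eq_has_sum (has_sum_dterm b a t0) => -[m n] /=; rewrite mul1r qterm_pos.
Qed.

Lemma summable_tterm i j k t : 0 < im t -> abs_summable (tterm i j k t).
Proof.
move=> t0.
have I : injective (fun w : nat * (nat * nat) => ((Posz w.1.+1, Posz w.2.1.+1), (Posz w.1.+1, Posz w.2.2.+1))).
  by move=> [m [u v]] [m' [u' v']] [-> -> _ ->].
(* Comparison with a product of two terms having the same m, by u + v + 2 <= 2 (u + 1)(v + 1). *)
have S := abs_summableZ ((2 ^ j)%:R : C) (abs_summable_reindex I (abs_summableM (summable_qterm (j + k) i t0) (summable_qterm j 0 t0))).
apply: abs_summable_le S => -[m [u v]] /=.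
rewrite !qterm_pos /tterm /dterm /= expr0 mul1r.
have -> : (2 ^ j)%:R * (m.+1%:R ^+ i * u.+1%:R ^+ (j + k) * ee t ^+ (m.+1 * u.+1) * (v.+1%:R ^+ j * ee t ^+ (m.+1 * v.+1))) =
   (2 ^ j * (m.+1 ^ i * u.+1 ^ (j + k)) * v.+1 ^ j)%:R * ee t ^+ (m.+1 * (u + v).+2).
  have -> : (m.+1 * (u + v).+2 = m.+1 * u.+1 + m.+1 * v.+1)%N by lia.
  by rewrite (exprD (ee t)) !natrM !natrX; move: (ee t ^+ _) (ee t ^+ _) (u.+1%:R ^+ _) => *; ring.
have -> : m.+1%:R ^+ i * (u + v).+2%:R ^+ j * u.+1%:R ^+ k = (m.+1 ^ i * (u + v).+2 ^ j * u.+1 ^ k)%:R :> C.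
  by rewrite !natrM !natrX.
rewrite ![cn (_ * _)]cnormM !cnorm_nat; apply: ler_wpM2r => //.
have le2 : ((u + v).+2 <= 2 * u.+1 * v.+1)%N by nia.
have H2 : ((u + v).+2 ^ j <= 2 ^ j * u.+1 ^ j * v.+1 ^ j)%N.
  by rewrite -!expnMn; case: (posnP j) => [->//|j0]; rewrite leq_exp2r.
have -> : (2 ^ j * (m.+1 ^ i * u.+1 ^ (j + k)) * v.+1 ^ j =
  m.+1 ^ i * u.+1 ^ k * (2 ^ j * u.+1 ^ j * v.+1 ^ j))%N by rewrite expnD; ring.
by rewrite ler_nat mulnAC leq_mul2l H2 orbT.
Qed.

Lemma has_sum_tterm i j k t : 0 < im t -> has_sum (tterm i j k t) (vsum i j k t).
Proof. by move=> t0; rewrite vsum.unlock; exact: abs_has_sum (summable_tterm i j k t0). Qed.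

Lemma has_sum_vterm i j k t : 0 < im t -> has_sum (vterm i j k t) (vsum i j k t).
Proof.
move=> t0; pose f (w : (nat * nat) * nat) : C := if (w.2 < w.1.2)%N then
  w.1.1.+1%:R ^+ i * w.1.2.+1%:R ^+ j * w.2.+1%:R ^+ k * ee t ^+ (w.1.1.+1 * w.1.2.+1) else 0.
pose h (w : nat * (nat * nat)) := ((w.1, (w.2.1 + w.2.2).+1), w.2.1).
have hI : injective h.
  by move=> [m [u v]] [m' [u' v']]; rewrite /h /= => -[-> e ue]; rewrite ue in e *; rewrite (addnI e).
have hS w : f w != 0 -> exists v, w = h v.
  case: w => -[m n] l; rewrite /f /=; case: ifP => [ln _|]; last by rewrite eqxx.
  by exists (m, (l, (n - l.+1)%N)); rewrite /h /= -addSn subnKC.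
have fh : f \o h = tterm i j k t.
  by apply/funext => -[m [u v]]; rewrite /f /h /tterm /= ltnS leq_addr.
have S : abs_summable f by apply: (abs_summable_ext hI hS); rewrite fh; exact: summable_tterm.
have [_ H] := fubini S.
have -> : vsum i j k t = sum f.
  by apply/esym/sumP/(has_sum_reindex hI hS); rewrite fh; exact: has_sum_tterm.
apply: eq_has_sum H => -[m n]; apply: sumP.
have -> : vterm i j k t (m, n) = \sum_(l <- iota 0 n) f ((m, n), l).
  rewrite /vterm /= mulr_sumr mulr_suml -(big_mkord xpredT (fun l => _ * l.+1%:R ^+ k * _)) /index_iota subn0 !big_seq.
  by apply: eq_bigr => l; rewrite mem_iota /f /= => ->.
by apply: has_sum_seq (iota_uniq _ _) _ => l; rewrite mem_iota /f /= => /negPf ->.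
Qed.

Lemma vsum0 i j t : 0 < im t -> vsum i j 0 t = dsum i j.+1 t - dsum i j t.
Proof.
move=> t0; apply: has_sum_uniq (has_sum_vterm i j 0 t0) _.
apply: eq_has_sum (has_sumB (has_sum_dterm i j.+1 t0) (has_sum_dterm i j t0)) => -[m n].
rewrite /dterm /vterm /=; under eq_bigr do rewrite expr0.
by rewrite sumr_const card_ord exprS -natr1; ring.
Qed.

End PositiveSums.

Lemma int_eps_neq0 (m n : int) : int_eps m n != 0 -> (0 < m /\ 0 < n) \/ (m < 0 /\ n < 0).
Proof.
rewrite /int_eps; case: ifP => // h _; case: (sgzP m) h => [->|hm|hm]; first by rewrite mul0r ltxx.
  by rewrite pmulr_rgt0//; left.
by rewrite nmulr_rgt0//; right.
Qed.

Lemma int_epsE (m n : int) : int_eps m n = if 0 < sgz m * sgz n then sgz m else 0.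
Proof. by rewrite /int_eps -sgz_gt0 sgzM. Qed.

(* With x = M - X and y = N - Y: the first product on the right is odd under
   (X, Y) -> (-X, -Y) and disappears on summation; the other terms live on hyperplanes. *)
Lemma quadratic_eps_identity (M N X Y : int) : 0 < N ->
  int_eps (M - X) Y * int_eps M (N - Y) - int_eps X (N - Y) * int_eps (M - X) N =
  int_eps M N * int_eps (- X) Y
  + (X == 0)%:R * (int_eps M Y * int_eps M (N - Y))
  - (Y == 0)%:R * (int_eps X N * int_eps (M - X) N)
  - (M - X == 0)%:R * (int_eps M N * int_eps (- X) Y)
  - (N - Y == 0)%:R * (int_eps M N * int_eps (- X) Y)
  - (M == 0)%:R * (int_eps X (N - Y) * int_eps (M - X) N).
Proof.
move=> N0; rewrite !int_epsE sgzN -(sgz_eq0 X) -(sgz_eq0 Y) -(sgz_eq0 M) -(sgz_eq0 (M - X)) -(sgz_eq0 (N - Y)) (gtr0_sgz N0).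
by case: (sgzP M) => hM; case: (sgzP X) => hX; case: (sgzP (M - X)) => hx; try (exfalso; lia);
 case: (sgzP Y) => hY; case: (sgzP (N - Y)) => hy; try (exfalso; lia); rewrite /= ?ltr01 ?ltxx.
Qed.

(** * The products of q-series in identity (ii) *)

Section QuadraticPart.
Variable R : realType.
Local Notation C := (Rcomplex R).
Local Notation im := (@complex.Im R).
Variables (t : C) (a b : nat).
Hypothesis t0 : 0 < im t.

Local Notation Z4 := ((int * int) * (int * int))%type.

Let f (w : Z4) : C :=
  w.1.1%:~R ^+ b * w.1.2%:~R ^+ a * ee t ^+ absz (w.1.1 * w.1.2 - w.2.1 * w.2.2)%R.

Let half (c : int -> int -> int -> int -> int) (w : Z4) : C :=
  (0 < w.1.2)%R%:R * ((c w.1.1 w.1.2 w.2.1 w.2.2)%:~R * f w).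

(** The factors are taken at (M - X, Y) and (M, N - Y): the second coordinates add up to N, so the
    binomial sum gives N^a. In the companion sum it is the first coordinates that add up, to M. *)
Lemma has_sum_quadratic1 :
  has_sum (fun w : Z4 => (int_eps (w.1.1 - w.2.1) w.2.2 * int_eps w.1.1 (w.1.2 - w.2.2))%:~R * f w)
    (\sum_(k < a.+1) 'C(a, k)%:R * qsum k 0 t * qsum (a - k) b t).
Proof.
have H := @has_sum_bigop _ _ _ (index_enum 'I_a.+1) xpredT _ _ (fun k _ =>
  has_sumZ ('C(a, k)%:R : C) (has_sum_qterm2 k 0 (a - k) b t0)).
pose h (w : Z4) : Z4 := ((w.1.1 - w.2.1, w.2.2), (w.1.1, w.1.2 - w.2.2)).
pose h' (u : Z4) : Z4 := ((u.2.1, u.1.2 + u.2.2), (u.2.1 - u.1.1, u.1.2)).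
have hK : cancel h h' by move=> [[M N] [X Y]]; rewrite /h /h' /= subKr addrC subrK.
have h'K : cancel h' h by move=> [[M N] [X Y]]; rewrite /h /h' /= subKr addrC addKr.
under eq_bigr do rewrite -mulrA.
apply: eq_has_sum (has_sum_bij hK h'K H) => -[[M N] [X Y]] /=.
under eq_bigr do rewrite qterm2E.
have -> : (M - X) * Y + M * (N - Y) = M * N - X * Y by ring.
have -> : f ((M, N), (X, Y)) = M%:~R ^+ b * ((N - Y)%:~R + Y%:~R) ^+ a * ee t ^+ absz (M * N - X * Y)%R.
  by rewrite -intrD subrK.
rewrite exprDn mulr_sumr mulr_suml mulr_sumr; apply: eq_bigr => k _.
by rewrite -mulr_natl expr0; ring.
Qed.

Lemma has_sum_quadratic2 :
  has_sum (fun w : Z4 => (int_eps w.2.1 (w.1.2 - w.2.2) * int_eps (w.1.1 - w.2.1) w.1.2)%:~R * f w)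
    (\sum_(k < b.+1) 'C(b, k)%:R * qsum 0 k t * qsum a (b - k) t).
Proof.
have H := @has_sum_bigop _ _ _ (index_enum 'I_b.+1) xpredT _ _ (fun k _ =>
  has_sumZ ('C(b, k)%:R : C) (has_sum_qterm2 0 k a (b - k) t0)).
pose h (w : Z4) : Z4 := ((w.2.1, w.1.2 - w.2.2), (w.1.1 - w.2.1, w.1.2)).
pose h' (u : Z4) : Z4 := ((u.1.1 + u.2.1, u.2.2), (u.1.1, u.2.2 - u.1.2)).
have hK : cancel h h' by move=> [[M N] [X Y]]; rewrite /h /h' /= subKr addrC subrK.
have h'K : cancel h' h by move=> [[M N] [X Y]]; rewrite /h /h' /= subKr addrC addKr.
under eq_bigr do rewrite -mulrA.
apply: eq_has_sum (has_sum_bij hK h'K H) => -[[M N] [X Y]] /=.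
under eq_bigr do rewrite qterm2E.
have -> : X * (N - Y) + (M - X) * N = M * N - X * Y by ring.
have -> : f ((M, N), (X, Y)) = ((M - X)%:~R + X%:~R) ^+ b * N%:~R ^+ a * ee t ^+ absz (M * N - X * Y)%R.
  by rewrite -intrD subrK.
rewrite exprDn !mulr_suml mulr_sumr; apply: eq_bigr => k _.
by rewrite -mulr_natl expr0; ring.
Qed.

Lemma has_sum_quadratic_odd :
  has_sum (half (fun M N X Y => int_eps M N * int_eps (- X) Y)) 0.
Proof.
pose s (w : Z4) : Z4 := (w.1, (- w.2.1, - w.2.2)).
have sK : involutive s by move=> [[M N] [X Y]]; rewrite /s /= !opprK.
apply: (has_sum_odd sK).
  move=> [[M N] [X Y]]; rewrite /half /s /f /= mulrNN.
  have -> : int_eps (- - X) (- Y) = - int_eps (- X) Y.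
    by rewrite !int_epsE !sgzN mulrNN mulNr; case: ifP => _; rewrite ?opprK ?oppr0// mulrN.
  by rewrite mulrN !mulrNz mulNr mulrN.
pose h (w : Z4) : Z4 := (w.1, (- w.2.1, w.2.2)).
have hK : involutive h by move=> [[M N] [X Y]]; rewrite /h /= !opprK.
apply: abs_summable_le (abs_summable_reindex (inv_inj hK)
  (abs_summableM (summable_qterm a b t0) (summable_qterm 0 0 t0))) => -[[M N] [X Y]].
rewrite /= qterm2E (_ : M * N + - X * Y = M * N - X * Y) ?mulNr // /half /f /= !expr0.
case: (0 < N); rewrite ?mul0r ?normr0 ?normr_ge0// mul1r le_eqVlt; apply/orP; left.
by apply/eqP; congr (Num.norm _); rewrite mulr1n; ring.
Qed.

Let half_val c (M N X Y k : int) e : 0 < N -> c M N X Y = k -> absz (M * N - X * Y)%R = e ->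
  k%:~R * (M%:~R ^+ b * N%:~R ^+ a * ee t ^+ e) = half c ((M, N), (X, Y)).
Proof. by move=> N0 <- <-; rewrite /half /= N0 mul1r. Qed.

Let intS (n : nat) : (Posz n.+1)%:~R = n.+1%:R :> C. Proof. by []. Qed.

(** On X = 0 with N > 0 the nonzero terms have M, Y and N - Y positive, which is the index set of
    [tterm]. The other hyperplanes are parametrized in the same manner. *)
Lemma has_sum_quadratic_X0 :
  has_sum (half (fun M N X Y => (X == 0)%:R * (int_eps M Y * int_eps M (N - Y)))) (vsum b a 0 t).
Proof.
pose h (w : nat * (nat * nat)) : Z4 := ((Posz w.1.+1, Posz (w.2.1 + w.2.2).+2), (0, Posz w.2.2.+1)).
apply: (@has_sum_reindex _ _ _ h).
- by move=> [m [u v]] [m' [u' v']]; rewrite /h /= => -[e1 e2 e3]; congr (_, (_, _)); lia.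
- move=> [[M N] [X Y]]; rewrite /half /=; case: (ltP 0 N) => [N0|_]; last by rewrite mul0r eqxx.
  have [X0|_] := eqVneq X 0; last by rewrite /= !mul0r mulr0 eqxx.
  have [->|/int_eps_neq0 e1] := eqVneq (int_eps M Y) 0; first by rewrite mul0r mulr0 mul0r mulr0 eqxx.
  have [->|/int_eps_neq0 e2] := eqVneq (int_eps M (N - Y)) 0; first by rewrite !mulr0 mul0r mulr0 eqxx.
  move=> _; exists ((absz M).-1, ((absz (N - Y)%R).-1, (absz Y).-1)); rewrite /h /=.
  by congr (_, _, (_, _)); lia.
apply: eq_has_sum (has_sum_tterm b a 0 t0) => -[m [u v]].
have E : Posz (u + v).+2 - Posz v.+1 = Posz u.+1 by lia.
have := @half_val (fun M N X Y => (X == 0)%:R * (int_eps M Y * int_eps M (N - Y)))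
  (Posz m.+1) (Posz (u + v).+2) 0 (Posz v.+1) 1 (m.+1 * (u + v).+2).
rewrite E !int_eps_pos mul0r subr0 -PoszM absz_nat => /(_ isT erefl erefl) H; apply: (etrans _ H).
by rewrite /tterm /= expr0 mulr1 mul1r !intS.
Qed.

Lemma has_sum_quadratic_Y0 :
  has_sum (half (fun M N X Y => (Y == 0)%:R * (int_eps X N * int_eps (M - X) N))) (vsum a b 0 t).
Proof.
pose h (w : nat * (nat * nat)) : Z4 := ((Posz (w.2.1 + w.2.2).+2, Posz w.1.+1), (Posz w.2.2.+1, 0)).
apply: (@has_sum_reindex _ _ _ h).
- by move=> [m [u v]] [m' [u' v']]; rewrite /h /= => -[e1 e2 e3]; congr (_, (_, _)); lia.
- move=> [[M N] [X Y]]; rewrite /half /=; case: (ltP 0 N) => [N0|_]; last by rewrite mul0r eqxx.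
  have [Y0|_] := eqVneq Y 0; last by rewrite /= !mul0r mulr0 eqxx.
  have [->|/int_eps_neq0 e1] := eqVneq (int_eps X N) 0; first by rewrite mul0r mulr0 mul0r mulr0 eqxx.
  have [->|/int_eps_neq0 e2] := eqVneq (int_eps (M - X) N) 0; first by rewrite !mulr0 mul0r mulr0 eqxx.
  move=> _; exists ((absz N).-1, ((absz (M - X)%R).-1, (absz X).-1)); rewrite /h /=.
  by congr (_, _, (_, _)); lia.
apply: eq_has_sum (has_sum_tterm a b 0 t0) => -[m [u v]].
have E : Posz (u + v).+2 - Posz v.+1 = Posz u.+1 by lia.
have := @half_val (fun M N X Y => (Y == 0)%:R * (int_eps X N * int_eps (M - X) N))
  (Posz (u + v).+2) (Posz m.+1) (Posz v.+1) 0 1 (m.+1 * (u + v).+2).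
rewrite E !int_eps_pos mulr0 subr0 -PoszM absz_nat mulnC => /(_ isT erefl erefl) H; apply: (etrans _ H).
by rewrite /tterm /= expr0 mulr1 mul1r !intS [_ ^+ b * _]mulrC.
Qed.

Lemma has_sum_quadratic_x0 :
  has_sum (half (fun M N X Y => (M - X == 0)%:R * (int_eps M N * int_eps (- X) Y))) (- vsum b 0 a t).
Proof.
pose h (w : nat * (nat * nat)) : Z4 := ((Posz w.1.+1, Posz w.2.1.+1), (Posz w.1.+1, Negz w.2.2)).
apply: (@has_sum_reindex _ _ _ h).
- by move=> [m [u v]] [m' [u' v']]; rewrite /h /= => -[-> -> _ ->].
- move=> [[M N] [X Y]]; rewrite /half /=; case: (ltP 0 N) => [N0|_]; last by rewrite mul0r eqxx.
  have [X0|_] := eqVneq (M - X) 0; last by rewrite /= !mul0r mulr0 eqxx.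
  have [->|/int_eps_neq0 e1] := eqVneq (int_eps M N) 0; first by rewrite mul0r mulr0 mul0r mulr0 eqxx.
  have [->|/int_eps_neq0 e2] := eqVneq (int_eps (- X) Y) 0; first by rewrite !mulr0 mul0r mulr0 eqxx.
  move=> _; exists ((absz M).-1, ((absz N).-1, (absz Y).-1)); rewrite /h /= NegzE.
  by congr (_, _, (_, _)); lia.
apply: eq_has_sum (has_sumN (has_sum_tterm b 0 a t0)) => -[m [u v]].
have := @half_val (fun M N X Y => (M - X == 0)%:R * (int_eps M N * int_eps (- X) Y))
  (Posz m.+1) (Posz u.+1) (Posz m.+1) (Negz v) (- 1) (m.+1 * (u + v).+2).
rewrite subrr eqxx int_eps_pos -[- Posz m.+1]NegzE int_eps_neg NegzE => /(_ isT erefl) H; apply: (etrans _ (H _)).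
  by rewrite /tterm /= expr0 mulr1 mulN1r !intS.
by rewrite mulrN opprK -mulrDr -PoszD -PoszM absz_nat; congr (_ * _)%N; lia.
Qed.

Lemma has_sum_quadratic_y0 :
  has_sum (half (fun M N X Y => (N - Y == 0)%:R * (int_eps M N * int_eps (- X) Y))) (vsum a 0 b t).
Proof.
pose h (w : nat * (nat * nat)) : Z4 := ((Posz w.2.1.+1, Posz w.1.+1), (Negz w.2.2, Posz w.1.+1)).
apply: (@has_sum_reindex _ _ _ h).
- by move=> [m [u v]] [m' [u' v']]; rewrite /h /= => -[-> -> -> _].
- move=> [[M N] [X Y]]; rewrite /half /=; case: (ltP 0 N) => [N0|_]; last by rewrite mul0r eqxx.
  have [X0|_] := eqVneq (N - Y) 0; last by rewrite /= !mul0r mulr0 eqxx.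
  have [->|/int_eps_neq0 e1] := eqVneq (int_eps M N) 0; first by rewrite mul0r mulr0 mul0r mulr0 eqxx.
  have [->|/int_eps_neq0 e2] := eqVneq (int_eps (- X) Y) 0; first by rewrite !mulr0 mul0r mulr0 eqxx.
  move=> _; exists ((absz N).-1, ((absz M).-1, (absz X).-1)); rewrite /h /= NegzE.
  by congr (_, _, (_, _)); lia.
apply: eq_has_sum (has_sum_tterm a 0 b t0) => -[m [u v]].
have := @half_val (fun M N X Y => (N - Y == 0)%:R * (int_eps M N * int_eps (- X) Y))
  (Posz u.+1) (Posz m.+1) (Negz v) (Posz m.+1) 1 (m.+1 * (u + v).+2).
rewrite subrr eqxx NegzE opprK !int_eps_pos => /(_ isT erefl) H; apply: (etrans _ (H _)).
  by rewrite /tterm /= expr0 mulr1 mul1r !intS [_ ^+ b * _]mulrC.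
by rewrite mulNr opprK -mulrDl -PoszD -PoszM absz_nat mulnC; congr (_ * _)%N; lia.
Qed.

(** Here the factor M^b is 0^b, so this hyperplane contributes for b = 0 only. *)
Lemma has_sum_quadratic_M0 :
  has_sum (half (fun M N X Y => (M == 0)%:R * (int_eps X (N - Y) * int_eps (M - X) N)))
    (- ((b == 0%N)%:R * vsum 0 0 a t)).
Proof.
pose h (w : nat * (nat * nat)) : Z4 := ((0, Posz w.2.1.+1), (Negz w.1, Posz (w.2.1 + w.2.2).+2)).
apply: (@has_sum_reindex _ _ _ h).
- by move=> [m [u v]] [m' [u' v']]; rewrite /h /= => -[e1 e2 e3]; congr (_, (_, _)); lia.
- move=> [[M N] [X Y]]; rewrite /half /=; case: (ltP 0 N) => [N0|_]; last by rewrite mul0r eqxx.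
  have [X0|_] := eqVneq M 0; last by rewrite /= !mul0r mulr0 eqxx.
  have [->|/int_eps_neq0 e1] := eqVneq (int_eps X (N - Y)) 0; first by rewrite mul0r mulr0 mul0r mulr0 eqxx.
  have [->|/int_eps_neq0 e2] := eqVneq (int_eps (M - X) N) 0; first by rewrite !mulr0 mul0r mulr0 eqxx.
  move=> _; exists ((absz X).-1, ((absz N).-1, (absz (N - Y)%R).-1)); rewrite /h /= NegzE.
  by congr (_, _, (_, _)); lia.
apply: eq_has_sum (has_sumN (has_sumZ ((b == 0%N)%:R : C) (has_sum_tterm 0 0 a t0))) => -[m [u v]].
have E : Posz u.+1 - Posz (u + v).+2 = Negz v by rewrite NegzE; lia.
have := @half_val (fun M N X Y => (M == 0)%:R * (int_eps X (N - Y) * int_eps (M - X) N))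
  0 (Posz u.+1) (Negz m) (Posz (u + v).+2) (- 1) (m.+1 * (u + v).+2).
rewrite E int_eps_neg (NegzE m) sub0r opprK int_eps_pos mul0r mulNr sub0r opprK -PoszM absz_nat.
move=> /(_ isT erefl (mulnC _ _)) H; apply: (etrans _ H); rewrite /tterm /= !expr0 !mul1r !intS mulN1r.
by case: b => [|b']; rewrite ?expr0 ?mul1r// expr0n /= !mul0r oppr0.
Qed.

Lemma quadratic_part : (0 < a)%N -> ~~ odd (a + b) ->
  \sum_(k < a.+1) 'C(a, k)%:R * qsum k 0 t * qsum (a - k) b t -
  \sum_(k < b.+1) 'C(b, k)%:R * qsum 0 k t * qsum a (b - k) t =
  2 * (vsum b a 0 t - vsum a b 0 t + vsum b 0 a t - vsum a 0 b t + (b == 0%N)%:R * vsum 0 0 a t).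
Proof.
move=> a0 ab; apply: has_sum_uniq (has_sumB has_sum_quadratic1 has_sum_quadratic2) _.
pose s (w : Z4) : Z4 := ((- w.1.1, - w.1.2), (- w.2.1, - w.2.2)).
have sK : involutive s by move=> [[M N] [X Y]]; rewrite /s /= !opprK.
(* Points with N = 0 carry the factor 0^a = 0 since a > 0; changing all four signs exchanges N > 0
   and N < 0 and, a + b being even, preserves the terms. *)
apply: (has_sum_even (P := fun w => 0 < w.1.2) sK).
- move=> [[M N] [X Y]]; rewrite /s /= -!opprD.
  have e m n : int_eps (- m) (- n) = - int_eps m n.
    by rewrite !int_epsE !sgzN mulrNN; case: ifP => _; rewrite ?oppr0.
  rewrite !e !mulrNN; suff -> : f ((- M, - N), (- X, - Y)) = f ((M, N), (X, Y)) by [].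
  rewrite /f /= !mulrNN !(mulrNz 1) [(- M%:~R) ^+ b]exprNn [(- N%:~R) ^+ a]exprNn.
  have s1 : (-1) ^+ b * (-1) ^+ a = 1 :> C by rewrite -exprD addnC -signr_odd (negPf ab) expr0.
  transitivity ((-1) ^+ b * (-1) ^+ a * (M%:~R ^+ b * N%:~R ^+ a * ee t ^+ absz (M * N - X * Y)%R) : C); first by ring.
  by rewrite s1 mul1r.
- move=> [[M N] [X Y]]; rewrite /= oppr_gt0 -leNgt le_eqVlt => h.
  suff -> : N == 0 = false by [].
  by apply: contra_neqF h => /eqP ->; rewrite /f /= expr0n gtn_eqF// mulr0 mul0r !mulr0 subrr.
have H := has_sumB (has_sumB (has_sumB (has_sumB (has_sumD has_sum_quadratic_odd has_sum_quadratic_X0)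
  has_sum_quadratic_Y0) has_sum_quadratic_x0) has_sum_quadratic_y0) has_sum_quadratic_M0.
rewrite (_ : vsum b a 0 t - _ + _ - _ + _ = 0 + vsum b a 0 t - vsum a b 0 t - (- vsum b 0 a t)
  - vsum a 0 b t - (- ((b == 0%N)%:R * vsum 0 0 a t))); last by ring.
apply: eq_has_sum H => -[[M N] [X Y]]; rewrite /half /=.
case: (ltP 0 N) => [N0|_]; last by rewrite !mul0r; ring.
by rewrite !mul1r -mulrBl -intrB quadratic_eps_identity// !intrB intrD !mulrBl mulrDl.
Qed.

End QuadraticPart.

(** The coefficients [r] are a parameter, so that the same expression makes sense over C and over
    polynomials in t. *)
Definition exchange (A : comNzRingType) (G r : nat -> nat -> A) a b : A :=
  \sum_(k < a.+1) 'C(a, k)%:R * G k 0%N * G (a - k)%N b - r a b * G a.+1 b -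
  (\sum_(k < b.+1) 'C(b, k)%:R * G 0%N k * G a (b - k)%N - r b a * G a b.+1).

Lemma exchangeC (A : comNzRingType) (G r : nat -> nat -> A) a b :
  (forall i j, G i j = G j i) -> exchange G r a b = - exchange G r b a.
Proof.
move=> GC; rewrite /exchange [RHS]opprB [G a.+1 b]GC [G a b.+1]GC; congr (_ - _ - (_ - _)).
  by apply: eq_bigr => k _; rewrite (GC k) (GC _ b).
by apply: eq_bigr => k _; rewrite (GC 0%N) (GC a).
Qed.

(** * Identity (ii) for the holomorphic functions *)

Section ExchangeHolomorphic.
Variable R : realType.
Local Notation C := (Rcomplex R).
Local Notation im := (@complex.Im R).
Local Notation beta := (zeta_neg R).
Implicit Types t : C.

Definition weight_ratio (a b : nat) : C := (a + 2 + (b == 0%N))%:R / a.+1%:R.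

Definition qsum_const t (a b : nat) : C :=
  qsum a b t + (a == 0%N)%:R * beta b + (b == 0%N)%:R * beta a.

Section Fixed.
Variable t : C.
Hypothesis t0 : 0 < im t.
Local Notation kk := (qsum_const t).

Let beta0 j : ~~ odd j -> beta j = 0. Proof. exact: zeta_neg_even. Qed.

Lemma qsum_constC a b : kk a b = kk b a.
Proof. by rewrite /qsum_const (qsumC a b t0) -!addrA [X in _ + X]addrC. Qed.

Lemma qsum_const_even a b : ~~ odd (a + b) -> kk a b = 0.
Proof.
move=> ab; rewrite /qsum_const qsum_even// add0r.
suff H i j : ~~ odd (i + j) -> (i == 0%N)%:R * beta j = 0 :> C.
  by rewrite H// H 1?addnC// addr0.
by case: i => [|i] ij; rewrite ?mul0r// beta0// mulr0.
Qed.

(** [Faulhaber_odd] applied termwise, at the second index of [dterm]; its power sum becomes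
    [vsum]. *)
Lemma sum_beta_dsum a b : (0 < a)%N ->
  \sum_(j < a.+1) 'C(a, j)%:R * beta j * dsum b (a - j) t =
  beta a * dsum b 0 t - dsum b a t / 2 - vsum b 0 a t + dsum b a.+1 t / a.+1%:R.
Proof.
move=> a0.
have H1 := @has_sum_bigop _ _ _ (index_enum 'I_a.+1) xpredT _ _ (fun j _ =>
  has_sumZ ('C(a, j)%:R * beta j) (has_sum_dterm b (a - j) t0)).
have H2 := has_sumD (has_sumB (has_sumB (has_sumZ (beta a) (has_sum_dterm b 0 t0))
  (has_sumZ 2^-1 (has_sum_dterm b a t0))) (has_sum_vterm b 0 a t0)) (has_sumZ (a.+1%:R)^-1 (has_sum_dterm b a.+1 t0)).
rewrite [_ / 2]mulrC [_ / a.+1%:R]mulrC; apply: has_sum_uniq H1 _; apply: eq_has_sum H2 => -[m n].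
rewrite /dterm /vterm /=.
transitivity (m.+1%:R ^+ b * ee t ^+ (m.+1 * n.+1) * (\sum_(j < a.+1) 'C(a, j)%:R * n.+1%:R ^+ (a - j) * beta j) : C).
  rewrite Faulhaber_odd /zeta_at_neg gtn_eqF// expr0.
  by ring.
by rewrite mulr_sumr; apply: eq_bigr => j _; ring.
Qed.

Lemma sum_beta_qsum a b : (0 < a)%N -> ~~ odd (a + b) ->
  \sum_(j < a.+1) 'C(a, j)%:R * beta j * qsum (a - j) b t =
  2 * (beta a * dsum b 0 t - dsum b a t / 2 - vsum b 0 a t + dsum b a.+1 t / a.+1%:R).
Proof.
move=> a0 ab; rewrite -sum_beta_dsum// mulr_sumr; apply: eq_bigr => j _.
have [oj|ej] := boolP (odd j); last by rewrite beta0// mulr0 !mul0r mulr0.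
rewrite qsum_dsum//; first by ring.
have ja : (j <= a)%N by rewrite -ltnS.
by move: ab; rewrite !oddD oddB// oj; case: (odd a); case: (odd b).
Qed.

Lemma beta_qsum a b : ~~ odd (a + b) -> qsum a 0 t * beta b = 2 * dsum 0 a t * beta b.
Proof.
move=> ab; have [ob|eb] := boolP (odd b); last by rewrite beta0// !mulr0.
by rewrite qsum_dsum// addn0; move: ab; rewrite oddD ob addbT negbK.
Qed.

Lemma qsum_const0 k : kk k 0 = qsum k 0 t + beta k.
Proof. by rewrite /qsum_const eqxx mul1r beta0// mulr0 addr0. Qed.

Lemma convolution_expand a b : (0 < b)%N ->
  \sum_(k < a.+1) 'C(a, k)%:R * kk k 0 * kk (a - k) b =
  \sum_(k < a.+1) 'C(a, k)%:R * qsum k 0 t * qsum (a - k) b t +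
  \sum_(k < a.+1) 'C(a, k)%:R * beta k * qsum (a - k) b t + (qsum a 0 t + beta a) * beta b.
Proof.
move=> b0; rewrite -big_split /=.
have -> : (qsum a 0 t + beta a) * beta b =
  \sum_(k < a.+1) 'C(a, k)%:R * (qsum k 0 t + beta k) * ((a - k == 0)%N%:R * beta b).
  rewrite big_ord_recr /= big1 ?add0r ?binn ?subnn ?eqxx ?mul1r// => k _.
  by rewrite subn_eq0 leqNgt ltn_ord mul0r mulr0.
rewrite -big_split /=; apply: eq_bigr => k _.
by rewrite qsum_const0 /qsum_const (gtn_eqF b0) mul0r addr0; ring.
Qed.

(** The triple sums [vsum b 0 a] and [vsum a 0 b] of the quadratic part cancel those of Faulhaber's
    formula. In the coefficient (a + 2)/(a + 1) = 1 + 1/(a + 1), the 1 comes from [vsum0] and the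
    fraction from n^(a+1)/(a + 1). *)
Lemma exchange_positive a b : (0 < a)%N -> (0 < b)%N -> ~~ odd (a + b) ->
  exchange kk weight_ratio a b = 0.
Proof.
move=> a0 b0 ab; have ba : ~~ odd (b + a) by rewrite addnC.
rewrite /exchange convolution_expand//.
have -> : \sum_(k < b.+1) 'C(b, k)%:R * kk 0 k * kk a (b - k) =
  \sum_(k < b.+1) 'C(b, k)%:R * qsum 0 k t * qsum a (b - k) t +
  \sum_(k < b.+1) 'C(b, k)%:R * beta k * qsum (b - k) a t + (qsum b 0 t + beta b) * beta a.
  under eq_bigr do rewrite (qsum_constC 0) (qsum_constC a).
  rewrite convolution_expand//; congr (_ + _ + _).
  by apply: eq_bigr => k _; rewrite (qsumC _ 0 t0) (qsumC _ a t0).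
have -> : kk a.+1 b = qsum a.+1 b t.
  by rewrite /qsum_const (gtn_eqF b0) !mul0r !addr0.
have -> : kk a b.+1 = qsum a b.+1 t.
  by rewrite /qsum_const (gtn_eqF a0) !mul0r !addr0.
have Q := quadratic_part t0 a0 ab; rewrite (gtn_eqF b0) mulr0n mul0r addr0 in Q.
rewrite !sum_beta_qsum// !mulrDl !beta_qsum// !qsum_dsum ?addSn ?addnS//=.
rewrite !vsum0// in Q; move: Q; rewrite (dsumC a 0 t0) (dsumC a b t0) (dsumC a b.+1 t0).
move: (\sum_(k < a.+1) _) (\sum_(k < b.+1) _) => Q1 Q2 /eqP; rewrite subr_eq => /eqP ->.
rewrite (dsumC 0 b t0) /weight_ratio (gtn_eqF a0) (gtn_eqF b0) !addn0 !natrD.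
have := natC_neq0 R 1; have := natC_neq0 R a; have := natC_neq0 R b.
rewrite -!natr1 => hb ha h2; field.
by rewrite ?ha ?hb.
Qed.

(** Both factors now carry zeta constants. The two cross sums agree under k -> a - k, so 1/(a + 1)
    occurs twice, whence the coefficient (a + 3)/(a + 1); the products of two constants are summed
    by [Euler_zeta]. *)
Lemma exchange_axis a : (0 < a)%N -> ~~ odd a -> exchange kk weight_ratio a 0 = 0.
Proof.
move=> a0 ea; rewrite /exchange big_ord1 bin0 subn0 mul1r [kk 0 _](qsum_const_even (a := 0) (b := 0))// mul0r.
have -> : \sum_(k < a.+1) 'C(a, k)%:R * kk k 0 * kk (a - k) 0 =
  \sum_(k < a.+1) 'C(a, k)%:R * qsum k 0 t * qsum (a - k) 0 t +
  2 * (\sum_(k < a.+1) 'C(a, k)%:R * beta k * qsum (a - k) 0 t) +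
  \sum_(k < a.+1) 'C(a, k)%:R * beta k * beta (a - k).
  have E : \sum_(k < a.+1) 'C(a, k)%:R * beta k * qsum (a - k) 0 t =
    \sum_(k < a.+1) 'C(a, k)%:R * qsum k 0 t * beta (a - k).
    rewrite (reindex_inj rev_ord_inj) /=; apply: eq_bigr => k _.
    by rewrite subSS bin_sub -1?ltnS// subKn -1?ltnS//; ring.
  rewrite mulr_natl mulr2n {2}E -!big_split /=; apply: eq_bigr => k _.
  by rewrite !qsum_const0; ring.
have := @quadratic_part _ t a 0 t0 a0; rewrite addn0 => /(_ ea).
rewrite big_ord1 (qsum_even (a := 0) (b := 0))// !mulr0 mul0r subr0 => ->.
rewrite sum_beta_qsum ?addn0// Euler_zeta// (beta0 ea) qsum_const0.
have -> : kk a 1 = qsum a 1 t by rewrite /qsum_const (gtn_eqF a0) !mul0r !addr0.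
rewrite !qsum_dsum ?addn0 ?addn1//= !vsum0// (dsumC a 0 t0) (dsumC a 1 t0).
have -> : weight_ratio a 0 = a.+3%:R / a.+1%:R by rewrite /weight_ratio eqxx addn2 addn1.
have -> : weight_ratio 0 a = 2 by rewrite /weight_ratio (gtn_eqF a0) divr1.
have e1 : a.+1%:R = a%:R + 1 :> C by rewrite -natr1.
have e3 : a.+3%:R = a%:R + 3 :> C by rewrite -addn3 natrD.
have := natC_neq0 R a; rewrite e1 e3 => ha; field.
by rewrite ?ha.
Qed.

Lemma exchange_qsum_const a b : exchange kk weight_ratio a b = 0.
Proof.
have [ab|ab] := boolP (odd (a + b)).
  rewrite /exchange [kk a.+1 b]qsum_const_even ?addSn/= ?negbK// [kk a b.+1]qsum_const_even ?addnS/= ?negbK//.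
  rewrite !mulr0 !subr0 !big1 ?subr0// => k _; have [ok|ek] := boolP (odd k).
  - rewrite [kk a _]qsum_const_even ?mulr0//.
    have kb : (k <= b)%N by rewrite -ltnS.
    by move: ab; rewrite !oddD oddB// ok; case: (odd a); case: (odd b).
  - by rewrite [kk 0 k]qsum_const_even// mulr0 mul0r.
  - rewrite [kk _ b]qsum_const_even ?mulr0//.
    have ka : (k <= a)%N by rewrite -ltnS.
    by move: ab; rewrite !oddD oddB// ok; case: (odd a); case: (odd b).
  - by rewrite [kk k 0]qsum_const_even ?addn0// mulr0 mul0r.
case: (posnP a) ab => [->|a0]; case: (posnP b) => [->|b0] ab.
- rewrite exchangeC; last exact: qsum_constC.
  by rewrite /exchange !big_ord1 (qsum_constC 1 0); ring.
- by rewrite exchangeC ?exchange_axis ?oppr0//; exact: qsum_constC.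
- by rewrite exchange_axis// -[a]addn0.
- exact: exchange_positive.
Qed.

End Fixed.

(** All terms have total weight a + b + 2, so the powers of 2 pi i/omega_1 factor out. *)
Lemma exchange_hol a b (p : C * C) : oriented_basis p ->
  exchange (fun i j => hol i j p) weight_ratio a b = 0.
Proof.
move=> op; have E i j : hol i j p = (tpi R / p.1) ^+ (i + j).+1 * qsum_const (tau p) i j.
  by rewrite hol.unlock.
suff -> : exchange (fun i j => hol i j p) weight_ratio a b =
    (tpi R / p.1) ^+ (a + b).+2 * exchange (qsum_const (tau p)) weight_ratio a b.
  by rewrite exchange_qsum_const ?mulr0// im_tau_gt0.
rewrite /exchange !mulrBr !mulr_sumr !E addSn addnS; congr (_ - _ - (_ - _)).
- apply: eq_bigr => k _; rewrite !E addn0; have ka : (k <= a)%N by rewrite -ltnS.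
  have -> : (a + b).+2 = (k.+1 + (a - k + b).+1)%N by lia.
  by rewrite exprD; ring.
- by ring.
- apply: eq_bigr => k _; rewrite !E add0n; have kb : (k <= b)%N by rewrite -ltnS.
  have -> : (a + b).+2 = (k.+1 + (a + (b - k)).+1)%N by lia.
  by rewrite exprD; ring.
- by ring.
Qed.

End ExchangeHolomorphic.

Section Morphisms.
Variables (A B : comNzRingType) (phi : {rmorphism A -> B}).
Implicit Types G r : nat -> nat -> A.

Lemma rmorph_exchange G r a b :
  phi (exchange G r a b) = exchange (fun i j => phi (G i j)) (fun i j => phi (r i j)) a b.
Proof.
rewrite /exchange !rmorphB !rmorph_sum !rmorphM; congr (_ - _ - (_ - _)).
  by apply: eq_bigr => k _; rewrite !rmorphM rmorph_nat.
by apply: eq_bigr => k _; rewrite !rmorphM rmorph_nat.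
Qed.

Lemma rmorph_reciprocity G a b c d e f :
  phi (reciprocity G a b c d e f) = reciprocity (fun i j => phi (G i j)) a b c d e f.
Proof.
rewrite /reciprocity /reciprocity1 /reciprocity2 /reciprocity3 !rmorphD !rmorph_sum.
by congr (_ + _ + _); apply: eq_bigr => k _; rewrite rmorph_sum; apply: eq_bigr => l _;
  rewrite !rmorphM !rmorph_nat rmorph_sign.
Qed.

Lemma rmorph_twist t h a b : phi (twist t h a b) = twist (phi t) (fun i j => phi (h i j)) a b.
Proof.
rewrite /twist rmorphB rmorph_sum !rmorphM !rmorph_nat rmorphXn; congr (_ - _).
by apply: eq_bigr => k _; rewrite 2!rmorphM rmorph_nat rmorphXn.
Qed.

End Morphisms.

(** * Identity (ii) under an abstract derivation *)

Section ExchangeDerivation.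
Variables (A : comNzRingType) (D : {additive A -> A}).
Hypothesis DM : forall x y, D (x * y) = D x * y + x * D y.
Variables G r : nat -> nat -> A.
Hypothesis GC : forall a b, G a b = G b a.
Hypothesis G00 : G 0 0 = 0.
Hypothesis D0 : forall b, D (G 0 b) = - (b == 1%N)%:R.
Hypothesis DSS : forall a b, D (G a.+1 b.+1) = (a.+1 * b.+1)%:R * G a b.
Hypothesis Dr : forall a b, D (r a b) = 0.
Hypothesis rE : forall a b, a.+1%:R * r a b = (a + 2 + (b == 0%N))%:R.

Let conv a b := \sum_(k < a.+1) 'C(a, k)%:R * G k 0 * G (a - k) b.

Let Daxis k : D (G k 0) = - (k == 1%N)%:R.
Proof. by rewrite GC D0. Qed.

Let Dnat n x : D (n%:R * x) = n%:R * D x.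
Proof. by rewrite !mulr_natl raddfMn. Qed.

Let D_conv a b : D (conv a.+1 b) =
  - a.+1%:R * G a b + \sum_(k < a.+2) 'C(a.+1, k)%:R * G k 0 * D (G (a.+1 - k) b).
Proof.
rewrite /conv raddf_sum.
have -> : - a.+1%:R * G a b = \sum_(k < a.+2) 'C(a.+1, k)%:R * D (G k 0) * G (a.+1 - k) b.
  rewrite big_ord_recl big_ord_recl big1 => [|k _]; last first.
    by rewrite Daxis /bump /= oppr0 mulr0 mul0r.
  by rewrite !Daxis /bump /= oppr0 mulr0 mul0r add0r addr0 bin1 subSS subn0 mulrN mulr1.
rewrite -big_split /=; apply: eq_bigr => k _.
by rewrite -mulrA Dnat DM; ring.
Qed.

Let D_convSS a b : D (conv a.+1 b.+1) =
  - a.+1%:R * G a b.+1 - (b == 0%N)%:R * G a.+1 0 + (a.+1 * b.+1)%:R * conv a b.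
Proof.
rewrite D_conv -addrA; congr (_ + _).
rewrite big_ord_recr /= binn subnn D0 eqSS addrC; congr (_ + _).
  by rewrite mul1r mulrN mulrC.
rewrite /conv mulr_sumr; apply: eq_bigr => k _.
have ka : (k <= a)%N by rewrite -ltnS.
rewrite subSn// DSS.
have H := mul_bin_down a.+1 k; rewrite /= subSn// in H.
transitivity (((a - k).+1 * 'C(a.+1, k))%:R * b.+1%:R * G k 0 * G (a - k) b).
  by rewrite !natrM; ring.
by rewrite -H !natrM; ring.
Qed.

Let D_convS0 a : D (conv a.+1 0) = - (a.+1 * 2)%:R * G a 0.
Proof.
rewrite D_conv.
have -> : \sum_(k < a.+2) 'C(a.+1, k)%:R * G k 0 * D (G (a.+1 - k) 0) = - a.+1%:R * G a 0.
  rewrite (reindex_inj rev_ord_inj) big_ord_recl big_ord_recl big1 /= => [|k _]; last first.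
    have kl := ltn_ord k; rewrite Daxis (_ : (_ == _) = false) ?oppr0 ?mulr0//.
    by apply/negbTE; rewrite /bump /=; lia.
  rewrite /bump /= !subSS !subn0 subnn subSnn !Daxis /= oppr0 mulr0 add0r addr0 mulrN mulr1 mulNr.
  by rewrite -(bin_sub (leqnSn a)) subSnn bin1.
by rewrite natrM; ring.
Qed.

Let conv0 b : conv 0 b = 0.
Proof. by rewrite /conv big_ord1 G00 mulr0 mul0r. Qed.

Let exchange_conv a b : exchange G r a b =
  conv a b - r a b * G a.+1 b - (conv b a - r b a * G b.+1 a).
Proof.
rewrite /exchange [G b.+1 a]GC; congr (_ - _ - (_ - _)).
by apply: eq_bigr => k _; rewrite (GC 0) (GC a).
Qed.

Let DrM a b x : D (r a b * x) = r a b * D x.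
Proof. by rewrite DM Dr mul0r add0r. Qed.

(** When D hits G(1, 0) or G(0, 1), the convolutions yield linear terms. Combined with D of the
    linear terms, whose coefficient has become a + 3, they leave a + 2 + [b = 0], which is (a + 1)
    r(a, b). *)
Lemma derivation_exchangeSS a b :
  D (exchange G r a.+1 b.+1) = (a.+1 * b.+1)%:R * exchange G r a b.
Proof.
rewrite !exchange_conv !raddfB !DrM /= !D_convSS !DSS.
have e1 : r a.+1 b.+1 * ((a.+2 * b.+1)%:R * G a.+1 b) = (a + 3)%:R * b.+1%:R * G a.+1 b.
  by have := rE a.+1 b.+1; rewrite addn0 => e; rewrite natrM -(addSnnS a 2) -e; ring.
have e2 : r b.+1 a.+1 * ((b.+2 * a.+1)%:R * G b.+1 a) = (b + 3)%:R * a.+1%:R * G b.+1 a.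
  by have := rE b.+1 a.+1; rewrite addn0 => e; rewrite natrM -(addSnnS b 2) -e; ring.
rewrite e1 e2 (GC a b.+1) (GC b a.+1).
transitivity ((a.+1 * b.+1)%:R * (conv a b - conv b a)
  - b.+1%:R * (a.+1%:R * r a b) * G a.+1 b + a.+1%:R * (b.+1%:R * r b a) * G b.+1 a);
  last by rewrite natrM; ring.
rewrite !rE.
have z1 : (b == 0%N)%:R * G a.+1 0 = b.+1%:R * (b == 0%N)%:R * G a.+1 b.
  by case: (b) => [|k]; rewrite ?mul1r// mulr0 !mul0r.
have z2 : (a == 0%N)%:R * G b.+1 0 = a.+1%:R * (a == 0%N)%:R * G b.+1 a.
  by case: (a) => [|k]; rewrite ?mul1r// mulr0 !mul0r.
rewrite z1 z2 [(b.+1 * a.+1)%N]mulnC natrM.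
rewrite (natrD _ (a + 2)) (natrD _ (b + 2)) (natrD _ a) (natrD _ b) (natrD _ a) (natrD _ b) -[a.+1]addn1 -[b.+1]addn1 (natrD _ a 1) (natrD _ b 1).
move: (b == 0%N)%:R (a == 0%N)%:R (conv a b) (conv b a) (G _ _) (G _ _) => x y u v g1 g2; ring.
Qed.

(** The convolution contributes -2 (a + 1) G(a, 0), one half from each end, and this is cancelled by
    r(0, a + 1) = 2. *)
Lemma derivation_exchangeS0 a : D (exchange G r a.+1 0) = 0.
Proof.
rewrite exchange_conv !raddfB !DrM /= D_convS0 conv0 raddf0.
rewrite Daxis DSS /= oppr0 mulr0 subr0 sub0r opprK mul1n (GC 0).
have := rE 0 a.+1; rewrite mul1r => ->.
by rewrite addn0 add0n natrM; ring.
Qed.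

Lemma exchange00 : exchange G r 0 0 = 0.
Proof. by rewrite exchange_conv subrr. Qed.

End ExchangeDerivation.

(** * The transform as a polynomial in its parameter, and identity (ii) for it *)

Section TwistDerivative.
Variable R : realType.
Local Notation C := (Rcomplex R).
Variable h : nat -> nat -> C.
Hypothesis hC : forall i j, h i j = h j i.

Definition twistX (a b : nat) : {poly C} := locked (twist 'X (fun i j => (h i j)%:P) a b).

Lemma twistX_horner t a b : (twistX a b).[t] = twist t h a b.
Proof.
rewrite /twistX -lock -/(horner_eval t _) rmorph_twist /= !horner_evalE hornerX.
rewrite (_ : (fun i j => _) = h)//.
by apply/funext => i; apply/funext => j; rewrite /= horner_evalE hornerC.
Qed.

Lemma twistXC a b : twistX a b = twistX b a.
Proof. by rewrite /twistX -!lock; apply: twistC => i j; rewrite hC. Qed.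

Lemma deriv_twistX0 b : (twistX 0 b)^`() = - (b == 1%N)%:R.
Proof. by rewrite /twistX -lock twist0l derivB derivC sub0r mulr_natl derivMn derivX. Qed.

Lemma deriv_twistXSS a b : (twistX a.+1 b.+1)^`() = (a.+1 * b.+1)%:R * twistX a b.
Proof.
rewrite /twistX -!lock /twist derivB linear_sum mulrBr; congr (_ - _).
  rewrite big_ord_recl /= !bin0 fact0 expr0 !mul1r derivC add0r mulr_sumr.
  apply: eq_bigr => k _; rewrite /bump /= add1n !subSS.
  have -> : (a.+1 * b.+1)%:R * (('C(a, k) * 'C(b, k) * k`!)%:R * 'X^k * (h (a - k) (b - k))%:P) =
    ('C(a.+1, k.+1) * 'C(b.+1, k.+1) * (k.+1)`! * k.+1)%:R * 'X^k * (h (a - k) (b - k))%:P :> {poly C}.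
    rewrite !mulrA -natrM; congr (_%:R * _ * _).
    have h1 := mul_bin_diag a.+1 k; have h2 := mul_bin_diag b.+1 k; rewrite /= in h1 h2.
    transitivity ((a.+1 * 'C(a, k)) * (b.+1 * 'C(b, k)) * k`!)%N; first by ring.
    by rewrite h1 h2 factS; ring.
  rewrite derivM derivC mulr0 addr0 mulr_natl derivMn derivXn /= -mulrnA [in RHS]mulr_natl.
  by congr (_ *+ _ * _); rewrite mulnC.
rewrite minnSS !eqSS; case: (boolP ((a == b.+1) || (b == a.+1))) => ab; last by rewrite !mul0r mulr0 deriv0.
rewrite !mul1r !mulr_natl derivMn derivXn /= -!mulrnA; congr (_ *+ _).
by case/orP: ab => /eqP ->; [rewrite (minn_idPr _)|rewrite (minn_idPl _)]; rewrite ?leqnSn// factS; ring.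
Qed.

Lemma twistX00 : h 0 0 = 0 -> twistX 0 0 = 0.
Proof. by move=> h0; rewrite /twistX -lock twist0l h0 mul0r subr0. Qed.

Lemma poly_eq0_deriv (p : {poly C}) : p^`() = 0 -> p.[0] = 0 -> p = 0.
Proof.
move=> dp p0; apply/polyP => -[|i]; first by rewrite -horner_coef0 p0 coef0.
have := coef_deriv p i; rewrite dp !coef0 => /esym/eqP.
by rewrite -mulr_natl mulf_eq0 (negPf (natC_neq0 R i)) => /eqP.
Qed.

Variable r : nat -> nat -> C.
Hypothesis rE : forall a b, a.+1%:R * r a b = (a + 2 + (b == 0%N))%:R.
Let rP a b : {poly C} := (r a b)%:P.

Lemma ratioP a b : a.+1%:R * rP a b = (a + 2 + (b == 0%N))%:R.
Proof. by rewrite -polyC_natr -polyCM rE polyC_natr. Qed.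

Lemma deriv_ratio a b : (rP a b)^`() = 0. Proof. exact: derivC. Qed.

Hypothesis h0 : h 0 0 = 0.

Lemma exchange_twist t a b : (forall i j, exchange h r i j = 0) ->
  exchange (twist t h) r a b = 0.
Proof.
move=> H.
have ev x i j : (exchange twistX rP i j).[x] = exchange (twist x h) r i j.
  rewrite -/(horner_eval x _) rmorph_exchange /=.
  rewrite (_ : (fun i j => horner_eval x (twistX i j)) = twist x h); last first.
    by apply/funext => k; apply/funext => l; exact: twistX_horner.
  rewrite (_ : (fun i j => horner_eval x (rP i j)) = r)//.
  by apply/funext => k; apply/funext => l; rewrite horner_evalE hornerC.
have tw0 : twist 0 h = h.
  apply/funext => i; apply/funext => j; rewrite /twist big_ord_recl big1 => [|k _].
    by rewrite !expr0 !bin0 !subn0 fact0 !mul1r exprS mul0r mulr0 subr0 addr0.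
  by rewrite /bump /= exprS mul0r mulr0 mul0r.
(* At t = 0 the transform is h, which satisfies the identity; so the polynomial is 0 once its
   derivative is. *)
have E0 i j : (exchange twistX rP i j)^`() = 0 -> exchange twistX rP i j = 0.
  by move=> d; apply: poly_eq0_deriv => //; rewrite ev tw0.
rewrite -ev (_ : exchange twistX rP a b = 0) ?horner0//.
have S0 := derivation_exchangeS0 (D := @deriv C) (@derivM C) twistXC (twistX00 h0) deriv_twistX0 deriv_twistXSS deriv_ratio ratioP.
elim: a b => [|a IH] [|b].
- exact: exchange00 twistXC.
- have := @exchangeC _ twistX rP b.+1 0 twistXC; rewrite (E0 _ _ (S0 b)).
  by move=> /esym/eqP; rewrite oppr_eq0 => /eqP.
- exact: E0 (S0 a).
- apply: E0; rewrite (derivation_exchangeSS (D := @deriv C) (@derivM C) twistXC deriv_twistX0 deriv_twistXSS deriv_ratio ratioP).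
  by rewrite (IH b) (mulr0 (a.+1 * b.+1)%:R).
Qed.

End TwistDerivative.

(** * Modular invariance and identity (i) *)

Section PowerSums.
Variable R : realType.
Local Notation C := (Rcomplex R).
Local Notation cn := (@Num.norm
  (Num_RealClosedField__to__Num_POrderedZmodule (reals_Real__to__Num_RealClosedField R))
  (complex_Rcomplex__canonical__Num_SemiNormedZmodule (reals_Real__to__Num_RealClosedField R))).
Local Notation re := (@complex.Re R).
Variable I : choiceType.
Implicit Types f x u : I -> C.

Lemma abs_summable_tail f (e : R) : abs_summable f -> 0 < e -> exists2 s0 : seq I, uniq s0 &
  forall s, uniq s -> {in s, forall i, i \notin s0} -> \sum_(i <- s) cn (f i) <= e.
Proof.
move=> fs e0; pose g i : C := ((cn (f i))%:C)%C.
have gs : abs_summable g by apply: abs_summable_le fs => i; rewrite /g normrZC normr_id.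
have e2 : 0 < e / 2 by rewrite divr_gt0.
have [s1 H] := abs_has_sum gs e2.
exists (undup s1); rewrite ?undup_uniq// => s us sd.
have sub1 : {subset s1 <= undup s1} by move=> i; rewrite mem_undup.
have := H (undup s1) (undup_uniq _) sub1.
have su : uniq (undup s1 ++ s).
  rewrite cat_uniq undup_uniq us andbT /=; apply/hasPn => i /sd.
  by [].
have := H (undup s1 ++ s) su; rewrite big_cat /=.
have sub : {subset s1 <= undup s1 ++ s} by move=> i; rewrite mem_cat mem_undup => ->.
move=> /(_ sub); move: (\sum_(i <- undup s1) g i) (sum g) => X l h1 h2.
have E : \sum_(i <- s) g i = ((\sum_(i <- s) cn (f i))%:C)%C by rewrite (rmorph_sum (real_complex R)).
rewrite E in h1; set T := \sum_(i <- s) _ in h1 *.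
have T0 : 0 <= T by apply: sumr_ge0.
have -> : T = cn ((T%:C)%C : C) by rewrite normrZC ger0_norm.
have -> : ((T%:C)%C : C) = (X + (T%:C)%C - l) - (X - l) by ring.
by have := ler_normB (X + (T%:C)%C - l) (X - l); lra.
Qed.

Lemma seq_argmax (y : I -> R) i0 s : exists2 i1, i1 \in i0 :: s & forall i, i \in i0 :: s -> y i <= y i1.
Proof.
elim: s i0 => [|j s IH] i0; first by exists i0; rewrite ?mem_head// => i; rewrite inE => /eqP ->.
have [i1 h1 H] := IH j; have [le|/ltW le] := leP (y i0) (y i1).
  exists i1; first by rewrite in_cons h1 orbT.
  by move=> i; rewrite in_cons => /orP[/eqP->|/H].
exists i0; rewrite ?mem_head// => i; rewrite in_cons => /orP[/eqP->//|/H h]; exact: le_trans h le.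
Qed.

(** Outside a finite set all terms are no larger than the one at [i0], so the maximum is attained on
    a finite set. *)
Lemma summable_argmax x i0 n : x i0 != 0 -> abs_summable (fun i => x i ^+ n.+1) ->
  exists2 i1, x i1 != 0 & forall i, cn (x i) <= cn (x i1).
Proof.
move=> x0 xs; have y0 : 0 < cn (x i0) by rewrite normr_gt0.
have e0 : 0 < cn (x i0) ^+ n.+1 by rewrite exprn_gt0.
have [s us H] := abs_summable_tail xs e0.
have [i1 h1 M] := seq_argmax (fun i => cn (x i)) i0 s.
have M0 := M _ (mem_head _ _).
exists i1; first by rewrite -normr_gt0; exact: lt_le_trans M0.
move=> i; have [iS|iS] := boolP (i \in i0 :: s); first exact: M.
apply: le_trans M0; have := H [:: i] isT; rewrite big_seq1 cnormX.
have D : {in [:: i], forall j, j \notin s}.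
  by move=> j; rewrite inE => /eqP ->; move: iS; rewrite inE negb_or => /andP[].
by move=> /(_ D); rewrite ler_pXn2r// nnegrE normr_ge0.
Qed.

(* If every power sum of even order at least 4 vanished, the Cesaro means of u_i^(2 + j), with
   u_i = (x_i / x_{i1})^2 and x_{i1} of maximal modulus, would sum to 0; but the mean tends to 1
   when u_i = 1 and to 0 otherwise. *)
Lemma power_sums_neq0 x i0 : x i0 != 0 -> abs_summable (fun i => x i ^+ 4) ->
  ~ forall k, sum (fun i => x i ^+ (4 + k.*2)) = 0.
Proof.
move=> x0 xs H0; have [i1 x1 M] := summable_argmax x0 xs.
pose u i := (x i / x i1) ^+ 2.
have u1 i : cn (u i) <= 1.
  rewrite cnormX cnormM cnormV; apply: exprn_ile1.
    exact: mulr_ge0 (normr_ge0 _) _.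
  by rewrite ler_pdivrMr ?mul1r ?normr_gt0.
have ui1 : u i1 = 1 by rewrite /u divff// expr1n.
have uE k i : u i ^+ k.+2 = x i1 ^- (4 + k.*2) * x i ^+ (4 + k.*2).
  by rewrite /u -exprM (_ : (2 * k.+2 = 4 + k.*2)%N); [rewrite expr_div_n mulrC|rewrite -addnn; lia].
have us2 : abs_summable (fun i => u i ^+ 2).
  have := abs_summableZ (x i1 ^- (4 + 0.*2)) xs; congr abs_summable; apply/funext => i.
  by rewrite -uE.
have us k : abs_summable (fun i => u i ^+ k.+2).
  apply: abs_summable_le us2 => i; rewrite -addn2 exprD cnormM; apply: ler_piMl => //.
  by rewrite cnormX; apply: exprn_ile1.
have usum k : has_sum (fun i => u i ^+ k.+2) 0.
  have S := abs_has_sum (us k); have xk : x i1 ^+ (4 + k.*2) != 0 by rewrite expf_neq0.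
  have S2 := has_sumZ (x i1 ^+ (4 + k.*2)) S.
  have E : (fun i => x i1 ^+ (4 + k.*2) * u i ^+ k.+2) = (fun i => x i ^+ (4 + k.*2)).
    by apply/funext => i; rewrite uE mulVKf.
  rewrite E in S2; have := sumP S2; rewrite H0 => /esym/eqP.
  by rewrite mulf_eq0 (negPf xk) => /eqP E0; move: S; rewrite E0.
pose S N i : C := \sum_(j < N) u i ^+ j.+2.
have Ssum N : has_sum (S N) 0.
  have := @has_sum_bigop _ _ _ (index_enum 'I_N) xpredT _ _ (fun k _ => usum k).
  by rewrite big1.
have q0 : 0 < 4^-1 :> R by rewrite invr_gt0.
(* Outside [s1] the sums [S N] total at most N/4 in modulus, while over [s2] they have real part at
   least N up to a constant; any fraction below 1 would serve. *)
have [s1 us1 T1] := abs_summable_tail us2 q0.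
pose s2 := undup (i1 :: s1).
(* For u_i different from 1 the geometric sum is bounded by 2/|u_i - 1| for all N; for u_i = 1 it
   equals N, which is nonnegative. *)
pose b i : R := if u i == 1 then 0 else 2 / cn (u i - 1).
have b0 i : 0 <= b i by rewrite /b; case: ifP => // _; rewrite divr_ge0.
have Sb N i : - b i <= re (S N i).
  rewrite /b; case: eqVneq => [e1|ui].
    rewrite oppr0 /S (eq_bigr (fun=> 1)) => [|j _]; last by rewrite e1 expr1n.
    by rewrite sumr_const card_ord natC Re_real.
  have d0 : 0 < cn (u i - 1) by rewrite normr_gt0 subr_eq0.
  have E : cn (S N i) <= 2 / cn (u i - 1).
    rewrite ler_pdivlMr// -cnormM.
    have -> : S N i * (u i - 1) = u i ^+ 2 * (u i ^+ N - 1).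
      rewrite (subrX1 (u i) N) mulrCA mulr_sumr mulrC; congr (_ * _); apply: eq_bigr => j _.
      by rewrite -exprD.
    rewrite cnormM cnormX; have h1 : cn (u i) ^+ 2 <= 1 by apply: exprn_ile1.
    have h2 : cn (u i ^+ N - 1) <= 2.
      apply: le_trans (ler_normB _ _) _; rewrite cnormX cnorm1 -(natr1 1) lerD2r.
      by apply: exprn_ile1.
    by apply: le_trans (ler_pM _ _ h1 h2) _; rewrite ?exprn_ge0// mul1r.
  by have := le_trans (ler_normRe _) E; rewrite ler_norml => /andP[].
have Re_sum (s : seq I) (F : I -> C) : re (\sum_(i <- s) F i) = \sum_(i <- s) re (F i).
  by elim: s => [|i s IH]; rewrite ?big_nil// !big_cons ReD IH.
pose B := \sum_(i <- s2) b i.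
have low N : N%:R - B <= re (\sum_(i <- s2) S N i).
  have i1s : i1 \in s2 by rewrite mem_undup mem_head.
  rewrite Re_sum (big_rem i1)//= /B (big_rem i1)//=.
  have -> : S N i1 = N%:R.
    by rewrite /S (eq_bigr (fun=> 1)) => [|j _]; rewrite ?sumr_const ?card_ord// ui1 expr1n.
  rewrite natC Re_real.
  have : - \sum_(i <- rem i1 s2) b i <= \sum_(i <- rem i1 s2) re (S N i).
    by rewrite -sumrN; apply: ler_sum => i _.
  have := b0 i1; lra.
have up N : cn (\sum_(i <- s2) S N i) <= N%:R / 4.
  pose F i : C := if i \in s2 then S N i else 0.
  have HF : has_sum F (\sum_(i <- s2) S N i).
    rewrite (_ : \sum_(i <- s2) S N i = \sum_(i <- s2) F i); last first.
      by rewrite !big_seq; apply: eq_bigr => i; rewrite /F => ->.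
    by apply: has_sum_seq; rewrite ?undup_uniq// => i /negPf; rewrite /F => ->.
  have HD := has_sumB HF (Ssum N); rewrite subr0 in HD.
  apply: (has_sum_le HD) => s us'.
  rewrite (bigID (mem s2)) /= big1 ?add0r => [|i is2]; last by rewrite /F is2 subrr normr0.
  pose s' := [seq i <- s | i \notin s2].
  rewrite (_ : \sum_(i <- s | _) _ = \sum_(i <- s') cn (F i - S N i)); last by rewrite big_filter.
  have E : \sum_(i <- s') cn (F i - S N i) <= \sum_(i <- s') N%:R * cn (u i ^+ 2).
    rewrite !big_seq; apply: ler_sum => i; rewrite mem_filter => /andP[is2 _].
    rewrite /F (negPf is2) sub0r normrN; apply: le_trans (ler_norm_sum _ _ _) _.
    rewrite -[N in N%:R]card_ord mulr_natl -sumr_const; apply: ler_sum => j _.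
    by rewrite -addn2 exprD cnormM; apply: ler_piMl => //; rewrite cnormX; apply: exprn_ile1.
  apply: le_trans E _; rewrite -mulr_sumr; apply: ler_wpM2l => //.
  apply: T1; first exact: filter_uniq.
  by move=> i; rewrite mem_filter mem_undup inE negb_or => /andP[/andP[]].
have key N : N%:R * 3 <= 4 * B.
  have := le_trans (low N) (le_trans (ler_norm _) (le_trans (ler_normRe _) (up N))).
  by lra.
have B0 : 0 <= 4 * B by rewrite mulr_ge0// sumr_ge0.
have := archi_boundP B0; have := key (Num.bound (4 * B)).
by have := ler0n R (Num.bound (4 * B)); lra.
Qed.

End PowerSums.

Section ShearInvariance.
Variable R : realType.
Local Notation C := (Rcomplex R).
Implicit Types p q : C * C.

Lemma g_twist_all a b p : oriented_basis p ->
  g a b p = twist (slope p) (fun i j => hol i j p) a b.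
Proof.
move=> op; have [ab|ab] := boolP (odd (a + b)); first exact: g_twist.
rewrite g_even// /twist big1 => [|k _].
  rewrite sub0r; case: (boolP ((a == b.+1) || (b == a.+1))) => [|_]; last by rewrite !mul0r oppr0.
  by move=> /orP[] /eqP E; move: ab; rewrite E ?addSn ?addnS /= addnn odd_double.
have ka : (k <= a)%N by rewrite -ltnS.
have [kb|kb] := leqP k b; last by rewrite (bin_small kb) muln0 !mul0r.
rewrite hol_even ?mulr0//; move: ab; rewrite !oddD !oddB//.
by case: (odd a); case: (odd b); case: (odd k).
Qed.

Lemma exchange_g a b p : oriented_basis p ->
  exchange (fun i j => g i j p) (@weight_ratio R) a b = 0.
Proof.
move=> op; rewrite (_ : (fun i j => g i j p) = twist (slope p) (fun i j => hol i j p)); last first.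
  by apply/funext => i; apply/funext => j; rewrite g_twist_all.
apply: exchange_twist.
- by move=> i j; exact: holC.
- by move=> i j; rewrite /weight_ratio mulrC divfK// natC_neq0.
- by rewrite hol_even.
- by move=> i j; exact: exchange_hol.
Qed.

Lemma g0_eisenstein k p : odd k -> (1 < k)%N -> g 0 k p = k`!%:R * eisenstein k.+1 p.
Proof.
move=> ok k1; rewrite /g add0n ok min0n max0n subn0 /= /eisenstein_star.
by rewrite ifF//; case: k k1 {ok} => [|[]].
Qed.

(** [power_sums_neq0] for the inverses of the nonzero lattice vectors, whose power sums are the
    e_k. *)
Lemma g0_neq0 p : oriented_basis p -> exists k, g 0 (3 + k.*2) p != 0.
Proof.
move=> op; apply: contrapT => H.
have p0 := oriented_neq0 op.
have s4 := summable_lat_term 0 op.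
have E k mn : lat_term k.+1 p mn = lat_term 1 p mn ^+ k.+1.
  by rewrite /lat_term; case: ifP => _; rewrite ?expr0n// expr1 exprVn.
have x0 : lat_term 1 p (0, 1) != 0 by rewrite /lat_term /= mulr0z add0r mulr1z expr1 invr_eq0.
apply: (power_sums_neq0 x0).
  by move: s4; congr abs_summable; apply/funext => mn; rewrite E.
move=> k; rewrite (_ : (fun i => _) = lat_term (k.*2).+4 p); last by apply/funext => mn; rewrite E.
have [_ /sumP<-] := fubini (summable_lat_term k.*2 op); rewrite -eisensteinE//.
apply/eqP/negPn/negP => e0; apply: H; exists k.
rewrite g0_eisenstein ?mulf_neq0 ?factC_neq0//.
by rewrite oddD /= odd_double.
Qed.

Lemma lattice_shear p : lattice (shear p) = lattice p.
Proof.
apply/seteqP; split => w /= [m [n ->]]; rewrite /shear /=.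
  by exists m, (m + n); rewrite mulrzDl mulrzDr addrA.
by exists m, (n - m); rewrite mulrzDl mulrzBr -addrA [_ + (_ - _)]addrC subrK.
Qed.

Lemma g0_shear k p : k != 1 -> g 0 k (shear p) = g 0 k p.
Proof.
have [ok|ek] := boolP (odd k); last by rewrite !g_even.
by case: k ok => [|[|k]]// ok _; rewrite !g0_eisenstein// /eisenstein lattice_shear.
Qed.

Lemma g01_shear p : oriented_basis p -> g 0 1 (shear p) = g 0 1 p.
Proof.
move=> op; have [k gk] := g0_neq0 op; have os := shear_oriented op.
pose j := (3 + k.*2)%N; have oj : odd j by rewrite oddD /= odd_double.
(* In the identity at indices (0, j + 1) every factor except g_{0,1} is already known to be
   invariant; g_{1,j+1} is so because it is W g_{0,j}. *)
have H q (oq : oriented_basis q) := exchange_g 0 j.+1 oq.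
have := H _ os; have := H _ op; rewrite /exchange !big_ord1 !bin0 !mul1r !subn0.
rewrite !(g_even (a := 0) (b := 0))// !mul0r !sub0r.
have g1 : g 1 (1 + j) (shear p) = g 1 (1 + j) p.
  by apply: g_shear_iter => // q _; exact: g0_shear.
rewrite -[j.+1]/(1 + j)%N g1 (g0_shear p (k := (1 + j).+1))// => e1 e2.
have := etrans e1 (esym e2); move/addrI/oppr_inj/addIr.
rewrite /j add1n -[(3 + k.*2).+1]/(k.*2).+4.
rewrite big_ord_recl [in RHS]big_ord_recl /=.
rewrite big_ord_recl [in RHS]big_ord_recl /=.
rewrite big_ord_recr [in RHS]big_ord_recr /=.
rewrite big_ord_recr [in RHS]big_ord_recr /=.
rewrite /bump /= !add1n !subn1 !subnn !subSnn !(g_even (a := 0) (b := 0))// !binn !bin0 !mulr0 !mul0r !addr0 !add0r /=.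
rewrite !(g0_shear p (k := k.*2.+3))//.
rewrite (_ : \sum_(i < _) _ * g _ _ (shear p) = \sum_(i < k.*2.+1) 'C(k.*2.+4, 1 + (1 + i))%:R *
   g 0 (1 + (1 + i)) p * g 0 (k.*2.+4 - (1 + (1 + i))) p); last first.
  apply: eq_bigr => i _; rewrite !g0_shear//.
  by have := ltn_ord i; apply: contraTneq; lia.
(* g_{0,1} occurs at both ends of the convolution, each time with coefficient 2k + 4 and next to the
   nonzero g_{0,2k+3}. *)
rewrite bin1 -(bin_sub (leqnSn k.*2.+3)) subSnn bin1 => e.
have : 2%:R * k.*2.+4%:R * g 0 k.*2.+3 p * (g 0 1 p - g 0 1 (shear p)) = 0.
  by move/eqP: e; rewrite -subr_eq0 => /eqP e; rewrite -e; ring.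
move/eqP; rewrite !mulf_eq0 (negPf (natC_neq0 R 1)) (negPf (natC_neq0 R _)) (negPf gk) /= subr_eq0.
by move=> /eqP.
Qed.

Lemma g_shear a b p : oriented_basis p -> g a b (shear p) = g a b p.
Proof.
move=> op; have [ab|ab] := boolP (odd (a + b)); last by rewrite !g_even.
have H a' b' : (a' <= b')%N -> odd (a' + b') -> g a' b' (shear p) = g a' b' p.
  move=> le od; rewrite -(subnKC le); apply: g_shear_iter => // [|q oq].
    by rewrite oddB// addbC -oddD.
  by have [->|k1] := eqVneq (b' - a')%N 1; [exact: g01_shear|exact: g0_shear].
by case: (leqP a b) => [le|/ltnW le]; [|rewrite ![g a b _]gC]; rewrite H// addnC.
Qed.

End ShearInvariance.

(** * Composition of transforms *)

Section TwistAction.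
Variable R : realType.
Local Notation C := (Rcomplex R).
Implicit Types (P Q : nat -> nat -> {poly C}) (h : nat -> nat -> C).

Lemma poly_eq_deriv (p q : {poly C}) : p^`() = q^`() -> p.[0] = q.[0] -> p = q.
Proof.
move=> d e; apply/eqP; rewrite -subr_eq0; apply/eqP/poly_eq0_deriv.
  by rewrite derivB d subrr.
by rewrite hornerD hornerN e subrr.
Qed.

(** The differential equations of the transform in t; by descent on the indices they determine a
    family from its values at 0. *)
Definition twist_flow P := [/\ forall a b, P a b = P b a,
  forall b, (P 0 b)^`() = - (b == 1%N)%:R &
  forall a b, (P a.+1 b.+1)^`() = (a.+1 * b.+1)%:R * P a b].

Lemma twist_flow_unique P Q a b : twist_flow P -> twist_flow Q ->
  (forall a b, (P a b).[0] = (Q a b).[0]) -> P a b = Q a b.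
Proof.
move=> [PC P0 PS] [QC Q0 QS] E; elim: a b => [|a IH] b.
  by apply: poly_eq_deriv => //; rewrite P0 Q0.
case: b => [|b]; first by rewrite PC QC; apply: poly_eq_deriv => //; rewrite P0 Q0.
by apply: poly_eq_deriv => //; rewrite PS QS IH.
Qed.

Lemma twist0t h : twist 0 h = h.
Proof.
apply/funext => i; apply/funext => j; rewrite /twist big_ord_recl big1 => [|k _].
  by rewrite !expr0 !bin0 !subn0 fact0 !mul1r exprS mul0r mulr0 subr0 addr0.
by rewrite /bump /= exprS mul0r mulr0 mul0r.
Qed.

(* Both sides solve the same differential equations in t. *)
Lemma twist_twist h s t : (forall i j, h i j = h j i) -> twist t (twist s h) = twist (t + s) h.
Proof.
move=> hC; have sC i j : twist s h i j = twist s h j i by exact: twistC.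
have P : twist_flow (twistX (twist s h)).
  by split; [exact: twistXC|exact: deriv_twistX0|exact: deriv_twistXSS].
have dX : ('X + s%:P : {poly C})^`() = 1 by rewrite derivD derivX derivC addr0.
have Q : twist_flow (fun a b => twistX h a b \Po ('X + s%:P)).
  split=> [a b|b|a b]; first by rewrite twistXC.
    by rewrite deriv_comp dX mulr1 deriv_twistX0 rmorphN rmorph_nat.
  by rewrite deriv_comp dX mulr1 deriv_twistXSS rmorphM rmorph_nat.
have E a b : (twistX (twist s h) a b).[0] = (twistX h a b \Po ('X + s%:P)).[0].
  by rewrite horner_comp hornerD hornerX hornerC add0r !twistX_horner twist0t.
apply/funext => a; apply/funext => b.
by rewrite -twistX_horner (twist_flow_unique _ _ P Q E) horner_comp hornerD hornerX hornerC twistX_horner.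
Qed.

End TwistAction.

Section ReciprocityTwisted.
Variable R : realType.
Local Notation C := (Rcomplex R).
Implicit Types p : C * C.

(** All indices in the three sums are positive, where [hol] is [qsum] times a power of 2 pi
    i/omega_1, without zeta constants. *)
Lemma eq_reciprocity (A : comNzRingType) (G H : nat -> nat -> A) (K : A) a b c d e f :
  (0 < a)%N -> (0 < b)%N -> (0 < c)%N -> (0 < d)%N -> (0 < e)%N -> (0 < f)%N ->
  (forall i j, (0 < i)%N -> (0 < j)%N -> G i j = K ^+ (i + j).+1 * H i j) ->
  reciprocity G a b c d e f = K ^+ (a + b + c + d + e + f).+2 * reciprocity H a b c d e f.
Proof.
move=> a0 b0 c0 d0 e0 f0 E.
rewrite /reciprocity /reciprocity1 /reciprocity2 /reciprocity3 !mulrDr !mulr_sumr.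
congr (_ + _ + _); apply: eq_bigr => k _; rewrite mulr_sumr; apply: eq_bigr => l _.
- rewrite (E (a - k + c)%N) ?(E (k + e)%N) ?addn_gt0 ?c0 ?b0 ?e0 ?f0 ?orbT//.
  have [kl ll] : (k <= a)%N /\ (l <= d)%N by split; rewrite -ltnS.
  have -> : (a + b + c + d + e + f).+2 = ((a - k + c + (b + l)).+1 + (k + e + (d - l + f)).+1)%N by lia.
  by rewrite (exprD K); ring.
- rewrite (E (b - k + d)%N) ?(E (a + (e - l))%N) ?addn_gt0 ?c0 ?d0 ?a0 ?f0 ?orbT//.
  have [kl ll] : (k <= b)%N /\ (l <= e)%N by split; rewrite -ltnS.
  have -> : (a + b + c + d + e + f).+2 = ((b - k + d + (c + l)).+1 + (a + (e - l) + (k + f)).+1)%N by lia.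
  by rewrite (exprD K); ring.
- rewrite (E (c - k + e)%N) ?(E (a + k)%N) ?addn_gt0 ?e0 ?d0 ?a0 ?b0 ?orbT//.
  have [kl ll] : (k <= c)%N /\ (l <= f)%N by split; rewrite -ltnS.
  have -> : (a + b + c + d + e + f).+2 = ((c - k + e + (d + l)).+1 + (a + k + (b + (f - l))).+1)%N by lia.
  by rewrite (exprD K); ring.
Qed.

Lemma shear_iter N p : iter N (@shear R) p = (p.1 + p.2 *+ N, p.2).
Proof.
elim: N => [|N IH] /=; first by rewrite mulr0n addr0; case: p.
by rewrite IH /shear /= mulrS addrAC -addrA [p.2 + _]addrC.
Qed.

Lemma shear_iter_oriented N p : oriented_basis p -> oriented_basis (iter N (@shear R) p).
Proof. by move=> op; elim: N => //= N IH; exact: shear_oriented. Qed.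

Lemma g_shear_iterated N a b p : oriented_basis p -> g a b (iter N (@shear R) p) = g a b p.
Proof.
by move=> op; elim: N => //= N IH; rewrite g_shear//; exact: shear_iter_oriented.
Qed.

(** The area being invariant, equal slopes at w_N = omega_1 + N omega_2 and w_M make conj(w_N) w_M
    real, while its imaginary part is (M - N) a(L). *)
Lemma slope_shear_inj p : oriented_basis p -> injective (fun N => slope (iter N (@shear R) p)).
Proof.
move=> op N M; have oN := shear_iter_oriented N op; have oM := shear_iter_oriented M op.
have zN := oriented_neq0 oN; have zM := oriented_neq0 oM.
have aE K : area (iter K (@shear R) p) = area p by elim: K => //= K IH; rewrite shear_area.
rewrite /slope !aE => E.
have k0 : pi / area p != 0 by rewrite mulf_neq0 ?invr_eq0 ?gt_eqF ?pi_gt0.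
have {}E := scalerI k0 E.
have {E} : conjc (iter N (@shear R) p).1 * (iter M (@shear R) p).1 =
   (conjc (iter M (@shear R) p).1 : C) * (iter N (@shear R) p).1.
  by rewrite -(divfK zN (conjc _ : C)) E; field.
rewrite !shear_iter /= -(mulr_natr p.2 N) -(mulr_natr p.2 M) (natC R N) (natC R M).
case: p op {oN oM zN zM aE k0} => -[x y] [z w].
rewrite /oriented_basis /area => op /(congr1 (@complex.Im R)) /= E; rewrite /= in op.
have : (N%:R - M%:R) * (x * w - y * z) = 0 by lra.
move/eqP; rewrite mulf_eq0 subr_eq0 eqr_nat => /orP[/eqP->//|/eqP h]; exfalso; lra.
Qed.

Lemma reciprocity_g p a b c d e f : oriented_basis p ->
  (0 < a)%N -> (0 < b)%N -> (0 < c)%N -> (0 < d)%N -> (0 < e)%N -> (0 < f)%N ->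
  reciprocity (fun i j => g i j p) a b c d e f = 0.
Proof.
move=> op a0 b0 c0 d0 e0 f0; pose G i j := g i j p.
have GC i j : G i j = G j i by exact: gC.
pose P := reciprocity (twistX G) a b c d e f.
have ev x : P.[x] = reciprocity (twist x G) a b c d e f.
  rewrite /P -/(horner_eval x _) rmorph_reciprocity /=.
  rewrite (_ : (fun i j => horner_eval x (twistX G i j)) = twist x G)//.
  by apply/funext => i; apply/funext => j; exact: twistX_horner.
(* By invariance g at p is also the transform, at the slope of the N-th basis, of [hol] at that
   basis; the parameter [s N] undoes it. *)
pose s N : C := - slope (iter N (@shear R) p).
have P0 N : root P (s N).
  have oq := shear_iter_oriented N op; set q := iter N _ p in oq.
  rewrite rootE ev (_ : twist (s N) G = fun i j => hol i j q).
    rewrite (eq_reciprocity (K := tpi R / q.1) (H := fun i j => qsum i j (tau q)))//.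
      by rewrite reciprocity_qsum ?mulr0// im_tau_gt0.
    by move=> [|i] [|j]// _ _; rewrite hol.unlock !mul0r !addr0.
  have -> : G = twist (slope q) (fun i j => hol i j q).
    by apply/funext => i; apply/funext => j; rewrite -g_twist_all// g_shear_iterated.
  by rewrite twist_twist ?addNr ?twist0t// => i j; exact: holC.
have : P = 0.
  (* A nonzero polynomial has fewer roots than its [size], so the first [size P] parameters already
     give a contradiction. *)
  apply/eqP/negPn/negP => Pn; pose r := [seq s N | N <- iota 0 (size P)].
  have ur : uniq r.
    rewrite map_inj_uniq ?iota_uniq// => i j /oppr_inj; exact: slope_shear_inj.
  have ar : all (root P) r by apply/allP => x /mapP[N _ ->].
  by have := max_poly_roots Pn ar ur; rewrite size_map size_iota ltnn.
by move=> PE; have := ev 0; rewrite PE horner0 twist0t => <-.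
Qed.

End ReciprocityTwisted.

Theorem proposition2p6p1 (R : realType) :
  (forall a b c d e f : nat,
     (0 < a)%N -> (0 < b)%N -> (0 < c)%N ->
     (0 < d)%N -> (0 < e)%N -> (0 < f)%N ->
     forall p : Rcomplex R * Rcomplex R, oriented_basis p ->
       \sum_(a1 < a.+1) \sum_(d1 < d.+1)
          (-1) ^+ (c + d1 + 1) * 'C(a, a1)%:R * 'C(d, d1)%:R
          * g (a - a1 + c) (b + d1) p * g (a1 + e) (d - d1 + f) p
     + \sum_(b1 < b.+1) \sum_(e1 < e.+1)
          (-1) ^+ (b - b1 + 1) * 'C(b, b1)%:R * 'C(e, e1)%:R
          * g (b - b1 + d) (c + e1) p * g (a + (e - e1)) (b1 + f) p
     + \sum_(c1 < c.+1) \sum_(f1 < f.+1)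
          (-1) ^+ c1 * 'C(c, c1)%:R * 'C(f, f1)%:R
          * g (c - c1 + e) (d + f1) p * g (a + c1) (b + (f - f1)) p
     = 0)
  /\
  (forall a b : nat,
     forall p : Rcomplex R * Rcomplex R, oriented_basis p ->
       \sum_(a1 < a.+1) 'C(a, a1)%:R * g a1 0 p * g (a - a1) b p
       - (a + 2 + (b == 0%N))%:R / a.+1%:R * g a.+1 b p
     = \sum_(b1 < b.+1) 'C(b, b1)%:R * g 0 b1 p * g a (b - b1) p
       - (b + 2 + (a == 0%N))%:R / b.+1%:R * g a b.+1 p).
Proof.
split=> [a b c d e f a0 b0 c0 d0 e0 f0 p op|a b p op].
  exact: reciprocity_g.
by apply/eqP; rewrite -subr_eq0; apply/eqP; exact: exchange_g.
Qed.
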